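(* There exist absolute constants $C_1,C>0$ such that the following holds. Let $1\le r\le n$ be integers and let $\boldsymbol{M}\in\mathbb{R}^{n\times n}$ be a (fixed) positive semidefinite matrix with $\operatorname{rank}(\boldsymbol{M})=r$ and spectral decomposition $\boldsymbol{M}=\sum_{i=1}^r\sigma_i\boldsymbol{u}_i\boldsymbol{u}_i^\top$, where $\sigma_1\ge\dots\ge\sigma_r>0$ and $\boldsymbol{u}_1,\dots,\boldsymbol{u}_r$ are orthonormal. Let $\kappa_r=\sigma_1/\sigma_r$, $\mu_r=\frac nr\max_{1\le i\le n}\sum_{j=1}^r u_{i,j}^2$ and $\widetilde\mu_r=\sqrt{\frac{n\|\boldsymbol{M}\|_{\ell_\infty}}{\operatorname{trace}(\boldsymbol{M})}}$. Let $p\in(0,1]$ satisfy $p\ge C_1\frac{\log n}{n}$ and, in addition, either $$p\ge C\max\left\{\frac{\mu_r r\kappa_r\log n}{n},\frac{\mu_r^2r^2\kappa_r^2}{n}\right\}$$ or $$p\ge C\max\left\{\frac{\widetilde\mu_r^2r\kappa_r\log n}{n},\frac{\widetilde\mu_r^4r^2\kappa_r^2}{n}\right\}.$$ Let $\Omega$ be sampled according to the off-diagonal symmetric independent $\mathrm{Ber}(p)$ model. Then there is an event $E$ with $\mathbb{P}[E]\ge 1-2n^{-3}$ on which the following is true: whenever $\alpha,\lambda$ satisfy $$100\sqrt{\|\boldsymbol{M}\|_{\ell_\infty}}\le\alpha\le 200\sqrt{\|\boldsymbol{M}\|_{\ell_\infty}}\quad\text{and}\quad 100\|\boldsymbol{\Omega}-p\boldsymbol{J}\|\le\lambda\le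 200\|\boldsymbol{\Omega}-p\boldsymbol{J}\|,$$ every local minimum $\widehat{\boldsymbol{X}}\in\mathbb{R}^{n\times r}$ of $$f(\boldsymbol{X})=\frac12\|\mathcal{P}_\Omega(\boldsymbol{X}\boldsymbol{X}^\top-\boldsymbol{M})\|_F^2+\lambda\sum_{i=1}^n\left[(\|\boldsymbol{x}_i\|_2-\alpha)_+\right]^4,\qquad \boldsymbol{X}=[\boldsymbol{x}_1,\dots,\boldsymbol{x}_n]^\top\in\mathbb{R}^{n\times r},$$ satisfies $\widehat{\boldsymbol{X}}\widehat{\boldsymbol{X}}^\top=\boldsymbol{M}$.
   Context: Off-diagonal symmetric independent $\mathrm{Ber}(p)$ model: $\Omega\subset[n]\times[n]$ is a random index set such that (1) $(i,i)\notin\Omega$ for all $i$; (2) for all $i<j$, $(i,j)\in\Omega$ independently with probability $p$; (3) for all $i>j$, $(i,j)\in\Omega$ if and only if $(j,i)\in\Omega$. Notation: $\boldsymbol{\Omega}\in\{0,1\}^{n\times n}$ is the matrix with $\Omega_{i,j}=1$ iff $(i,j)\in\Omega$; $\boldsymbol{J}$ is the $n\times n$ all-ones matrix; $\mathcal{P}_\Omega(\boldsymbol{A})$ is the matrix with entry $A_{i,j}$ if $(i,j)\in\Omega$ and $0$ otherwise. $\|\cdot\|$ is the spectral norm, $\|\cdot\|_F$ the Frobenius norm, $\|\boldsymbol{A}\|_{\ell_\infty}=\max_{i,j}|A_{i,j}|$. $(x)_+=\max\{x,0\}$. The vector $\boldsymbol{x}_i\in\mathbb{R}^r$ is the $i$-th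 row of $\boldsymbol{X}$, and $u_{i,j}$ denotes the $i$-th coordinate of $\boldsymbol{u}_j$. Absolute constants do not depend on $n,r,p,\boldsymbol{M}$ or anything else. *)

(* Defs.v *)
From HB Require Import structures.
From mathcomp Require Import all_boot all_order all_algebra.
From mathcomp Require Import all_classical all_reals all_analysis.

Set Implicit Arguments.
Unset Strict Implicit.
Unset Printing Implicit Defensive.

Import Order.TTheory GRing.Theory Num.Theory.
Import numFieldNormedType.Exports.
Local Open Scope classical_set_scope.
Local Open Scope ring_scope.

(* On row and column vectors this is the Euclidean norm. *)
Definition frobenius_norm (R : realType) (m n : nat) (A : 'M[R]_(m, n)) : R :=
  Num.sqrt (\sum_(i < m) \sum_(j < n) A i j ^+ 2).

(* The spectral norm is the operator norm induced by the Euclidean norms. *)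
Definition spectral_norm (R : realType) (m n : nat) (A : 'M[R]_(m, n)) : R :=
  sup [set frobenius_norm (A *m x) |
        x in [set x : 'cV[R]_n | frobenius_norm x <= 1]].

(* The library's norm on matrices is the maximum of the entries in absolute
   value. *)
Definition linfty_norm (R : realType) (m n : nat) (A : 'M[R]_(m, n)) : R :=
  mx_norm A.

Definition pos_semidef (R : realType) (n : nat) (A : 'M[R]_n) : Prop :=
  A^T = A /\ forall x : 'cV[R]_n, 0 <= (x^T *m A *m x) 0 0.

Definition spectral_decomposition (R : realType) (n r : nat) (M : 'M[R]_n)
    (sigma : 'I_r -> R) (u : 'I_r -> 'cV[R]_n) : Prop :=
  [/\ forall i j : 'I_r, (i <= j)%N -> sigma j <= sigma i,
      forall i : 'I_r, 0 < sigma i,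
      forall i j : 'I_r, ((u i)^T *m u j) 0 0 = (i == j)%:R
    & M = \sum_(i < r) sigma i *: (u i *m (u i)^T)].

(* Indices start at 0: [Ordinal hr] is the first element of ['I_r], and
   [rev_ord (Ordinal hr)] the last one. *)
Definition cond_number (R : realType) (r : nat) (hr : (0 < r)%N)
    (sigma : 'I_r -> R) : R :=
  sigma (Ordinal hr) / sigma (rev_ord (Ordinal hr)).

Definition coherence (R : realType) (n r : nat) (u : 'I_r -> 'cV[R]_n) : R :=
  n%:R / r%:R * \big[Num.max/0]_(i < n) \sum_(j < r) u j i 0 ^+ 2.

Definition spikiness (R : realType) (n : nat) (M : 'M[R]_n) : R :=
  Num.sqrt (n%:R * linfty_norm M / \tr M).

Definition indicator_mx (R : realType) (n : nat) (W : {set 'I_n * 'I_n}) :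
  'M[R]_n := \matrix_(i, j) ((i, j) \in W)%:R.

Definition mask_mx (R : realType) (n : nat) (W : {set 'I_n * 'I_n})
    (A : 'M[R]_n) : 'M[R]_n :=
  \matrix_(i, j) if (i, j) \in W then A i j else 0.

Definition objective (R : realType) (n r : nat) (M : 'M[R]_n)
    (W : {set 'I_n * 'I_n}) (alpha lambda : R) (X : 'M[R]_(n, r)) : R :=
  2^-1 * frobenius_norm (mask_mx W (X *m X^T - M)) ^+ 2
  + lambda * \sum_(i < n) Num.max (frobenius_norm (row i X) - alpha) 0 ^+ 4.

Definition local_minimum (R : realType) (T : topologicalType) (f : T -> R)
    (x : T) : Prop := \forall y \near x, f x <= f y.

(* Mutual independence of the events [A i] for [i \in D]. *)
Definition mutually_independent (R : realType) (d : measure_display)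
    (T : measurableType d) (P : probability T R) (I : finType) (D : {set I})
    (A : I -> set T) : Prop :=
  (forall i, i \in D -> measurable (A i)) /\
  forall J : {set I}, J \subset D ->
    P (\bigcap_(i in [set` J]) A i) = (\prod_(i in J) fine (P (A i)))%:E.

Definition offdiag_sym_ber (R : realType) (d : measure_display)
    (T : measurableType d) (P : probability T R) (n : nat) (p : R)
    (Omega : T -> {set 'I_n * 'I_n}) : Prop :=
  [/\ forall w (i : 'I_n), (i, i) \notin Omega w,
      mutually_independent P [set ij : 'I_n * 'I_n | (ij.1 < ij.2)%N]%SET
        (fun ij => [set w | ij \in Omega w]),
      forall i j : 'I_n, (i < j)%N -> P [set w | (i, j) \in Omega w] = p%:E
    & forall w (i j : 'I_n), (j < i)%N ->
        ((i, j) \in Omega w) = ((j, i) \in Omega w)].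

(* Main.v *)
(* Write M = U U^T with U of size n x r, rotated so that X^T U is symmetric
   positive semidefinite (polar decomposition), and D = X - U, A = X X^T - M,
   B = D D^T.  Alignment gives |B|^2 <= 2 |A|^2 and 2 |U D^T|^2 <= 3 |A|^2.  At
   a local minimum, the second variation of f in the direction D minus four
   times the first one is nonnegative, which reads
     |B|_Omega^2 - 3 |A|_Omega^2 + lambda * (regularization) >= 0.
   If the sampled norms were p times the full ones, the left-hand side would be
   at most -p |A|^2, hence A = 0.  The deviations are controlled by
   rho = |Omega - p J| through
     |sum H_ij <a_i,b_j><c_i,d_j>|
        <= rho/2 (sum |a_i|^2 |c_i|^2 + sum |b_j|^2 |d_j|^2),
   with H = Omega - p J, and, for the single term sum_ij H_ij <u_i,d_j>^2, by a
   concentration bound in dimension r for each column j of H.  The sums of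
   |d_i|^4 that remain are absorbed by the regularizer on the rows where X is
   large.

   Both sampling conditions imply p >= C b log n and p >= C n b^2 for
   b = |M|_infty / sigma_r >= r / n.  Then p / b dominates r + log n, so the
   column bound follows from a net and Bernstein's inequality, and
   rho = O(sqrt(np)) gives rho b <= 10^-11 p.  To bound rho, the trace moment of
   order 2k, with k about np, is expanded over closed walks and compared, shape
   by shape, with that of a 2k x 2k matrix with independent bounded entries,
   whose norm is bounded by another net. *)
Require Import Defs.
From HB Require Import structures.
From mathcomp Require Import all_boot all_order all_algebra.
From mathcomp Require Import all_classical all_reals all_analysis.
From mathcomp Require Import ring lra zify.

Set Implicit Arguments.
Unset Strict Implicit.
Unset Printing Implicit Defensive.

Import Order.TTheory GRing.Theory Num.Theory.
Import numFieldNormedType.Exports.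
Local Open Scope classical_set_scope.
Local Open Scope ring_scope.

(** * Frobenius and spectral norms *)

(** The coefficient four is the one for which the mixed term <A,B>_Omega cancels, because X D^T + D
    X^T = A + B. After expanding A = U D^T + D U^T + B, only the term with <u_i,d_j>^2 escapes the
    spectral bound, which would leave sum |u_i|^4, a quantity that does not vanish with D. This term
    forces an estimate column by column, where H acts through quadratic forms in r variables. In the
    bound on rho no logarithm may be lost: rho b <= c p with p of order n b^2 asks for rho^2 of
    order np. A net in dimension n does not give this, since a centered Bernoulli(p) entry has
    variance at most p but size up to one, and its exponential moments are too large against
    exponentially many (in n) net points. In the trace moment p only enters as a weight per edge, so
    the sparse matrix can be traded for a dense one of size about 2np with bounded entries of
    variance one, and for that matrix a net suffices. *)

Lemma cauchy_schwarz_sum (R : realType) (I : finType) (x y : I -> R) :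
  (\sum_i x i * y i) ^+ 2 <= (\sum_i x i ^+ 2) * (\sum_i y i ^+ 2).
Proof.
have : 0 <= \sum_i \sum_j (x i * y j - x j * y i) ^+ 2.
  by apply: sumr_ge0 => i _; apply: sumr_ge0 => j _; exact: sqr_ge0.
have -> : \sum_i \sum_j (x i * y j - x j * y i) ^+ 2 =
    2 * ((\sum_i x i ^+ 2) * (\sum_i y i ^+ 2)) - 2 * (\sum_i x i * y i) ^+ 2.
  transitivity (\sum_i \sum_j (x i ^+ 2 * y j ^+ 2 + y i ^+ 2 * x j ^+ 2
                 - 2 * (x i * y i) * (x j * y j))).
    by apply: eq_bigr => i _; apply: eq_bigr => j _; ring.
  rewrite (eq_bigr (fun i => x i ^+ 2 * (\sum_j y j ^+ 2)
    + y i ^+ 2 * (\sum_j x j ^+ 2) - 2 * (x i * y i) * (\sum_j x j * y j)));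
    last first.
    move=> i _; rewrite big_split/= sumrN big_split/= -!mulr_sumr; ring.
  rewrite big_split/= sumrN big_split/= -!mulr_suml -mulr_sumr; ring.
lra.
Qed.

Definition frob2 (R : realType) (m n : nat) (A : 'M[R]_(m, n)) : R :=
  \sum_(i < m) \sum_(j < n) A i j ^+ 2.

Section frob2.
Context {R : realType}.

Lemma frob2_ge0 m n (A : 'M[R]_(m, n)) : 0 <= frob2 A.
Proof. by apply: sumr_ge0 => i _; apply: sumr_ge0 => j _; exact: sqr_ge0. Qed.
Hint Resolve frob2_ge0 : core.

Lemma frobenius_normE m n (A : 'M[R]_(m, n)) :
  frobenius_norm A = Num.sqrt (frob2 A).
Proof. by []. Qed.

Lemma sqr_frobenius m n (A : 'M[R]_(m, n)) : frobenius_norm A ^+ 2 = frob2 A.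
Proof. by rewrite frobenius_normE sqr_sqrtr. Qed.

Lemma frobenius_ge0 m n (A : 'M[R]_(m, n)) : 0 <= frobenius_norm A.
Proof. exact: sqrtr_ge0. Qed.

Lemma frob2_trace m n (A : 'M[R]_(m, n)) : frob2 A = \tr (A *m A^T).
Proof.
apply: eq_bigr => i _; rewrite mxE; apply: eq_bigr => j _.
by rewrite mxE expr2.
Qed.

Lemma frob2_tr m n (A : 'M[R]_(m, n)) : frob2 A^T = frob2 A.
Proof.
rewrite /frob2 exchange_big; apply: eq_bigr => i _; apply: eq_bigr => j _.
by rewrite mxE.
Qed.

Lemma frob2_cV n (x : 'cV[R]_n) : frob2 x = \sum_i x i 0 ^+ 2.
Proof. by apply: eq_bigr => i _; rewrite big_ord1. Qed.

Lemma frob2_rV n (x : 'rV[R]_n) : frob2 x = \sum_i x 0 i ^+ 2.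
Proof. by rewrite /frob2 big_ord1. Qed.

Lemma frob2_eq0 m n (A : 'M[R]_(m, n)) : frob2 A = 0 -> A = 0.
Proof.
move=> A0; apply/matrixP => i j; rewrite mxE; apply/eqP.
rewrite -sqrf_eq0; apply/eqP; apply: le_anti; rewrite sqr_ge0 andbT -A0.
rewrite /frob2 (bigD1 i)//= (bigD1 j)//= -addrA lerDl addr_ge0//.
  by apply: sumr_ge0 => k _; exact: sqr_ge0.
by apply: sumr_ge0 => k _; apply: sumr_ge0 => l _; exact: sqr_ge0.
Qed.

Lemma frob2Z m n (a : R) (A : 'M[R]_(m, n)) : frob2 (a *: A) = a ^+ 2 * frob2 A.
Proof.
rewrite /frob2 mulr_sumr; apply: eq_bigr => i _; rewrite mulr_sumr.
by apply: eq_bigr => j _; rewrite mxE exprMn.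
Qed.

Lemma frob2_0 m n : frob2 (0 : 'M[R]_(m, n)) = 0.
Proof. by rewrite -(scale0r 0) frob2Z expr0n mul0r. Qed.

Lemma frobeniusZ m n (a : R) (A : 'M[R]_(m, n)) :
  frobenius_norm (a *: A) = `|a| * frobenius_norm A.
Proof.
by rewrite !frobenius_normE frob2Z sqrtrM ?sqr_ge0// sqrtr_sqr.
Qed.

Lemma frob2M m n k (A : 'M[R]_(m, n)) (B : 'M[R]_(n, k)) :
  frob2 (A *m B) <= frob2 A * frob2 B.
Proof.
rewrite {2}/frob2 mulr_suml; apply: ler_sum => i _.
rewrite -[frob2 B]frob2_tr {1}/frob2 mulr_sumr; apply: ler_sum => j _.
rewrite mxE (le_trans (cauchy_schwarz_sum _ _))//.
rewrite le_eqVlt; apply/orP; left; apply/eqP; congr (_ * _).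
by apply: eq_bigr => l _; rewrite mxE.
Qed.

Lemma dotmx_cauchy_schwarz n (x y : 'cV[R]_n) :
  ((x^T *m y) 0 0) ^+ 2 <= frob2 x * frob2 y.
Proof.
rewrite mxE !frob2_cV; under eq_bigr do rewrite mxE.
exact: cauchy_schwarz_sum.
Qed.

(** [sup] has its order-theoretic meaning only on a nonempty bounded set; the Frobenius norm of H
    bounds this one. *)
Lemma spectral_norm_has_sup m n (H : 'M[R]_(m, n)) :
  has_sup [set frobenius_norm (H *m x) |
    x in [set x : 'cV[R]_n | frobenius_norm x <= 1]].
Proof.
split.
  exists (frobenius_norm (H *m (0 : 'cV[R]_n))); exists 0 => //=.
  by rewrite frobenius_normE frob2_0 sqrtr0.
exists (frobenius_norm H) => _ [x /= x1 <-].
rewrite -(ler_pXn2r (n := 2))// ?nnegrE ?frobenius_ge0// !sqr_frobenius.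
rewrite (le_trans (frob2M _ _))// ler_piMr// -sqr_frobenius.
by rewrite expr_le1// frobenius_ge0.
Qed.

Lemma spectral_norm_ge0 m n (H : 'M[R]_(m, n)) : 0 <= spectral_norm H.
Proof.
apply: le_trans (frobenius_ge0 (H *m (0 : 'cV[R]_n))) _.
apply: sup_upper_bound; first exact: spectral_norm_has_sup.
exists 0 => //=.
by rewrite frobenius_normE frob2_0 sqrtr0.
Qed.

Lemma spectral_normP m n (H : 'M[R]_(m, n)) (x : 'cV[R]_n) :
  frob2 (H *m x) <= spectral_norm H ^+ 2 * frob2 x.
Proof.
have [x0|x0] := eqVneq (frob2 x) 0.
  by rewrite (frob2_eq0 x0) mulmx0 !frob2_0 mulr0.
have xp : 0 < frobenius_norm x.
  by rewrite lt_neqAle frobenius_ge0 andbT eq_sym -sqrf_eq0 sqr_frobenius.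
have : frobenius_norm (H *m ((frobenius_norm x)^-1 *: x)) <= spectral_norm H.
  apply: sup_upper_bound; first exact: spectral_norm_has_sup.
  exists ((frobenius_norm x)^-1 *: x) => //=.
  by rewrite frobeniusZ ger0_norm ?invr_ge0 ?frobenius_ge0// mulVf ?gt_eqF.
rewrite -scalemxAr frobeniusZ ger0_norm ?invr_ge0 ?frobenius_ge0//.
rewrite ler_pdivrMl// => h.
rewrite -!sqr_frobenius -exprMn mulrC ler_pXn2r ?nnegrE ?frobenius_ge0//.
by rewrite mulr_ge0 ?frobenius_ge0 ?spectral_norm_ge0.
Qed.

Lemma spectral_norm_le m n (H : 'M[R]_(m, n)) (t : R) :
  (forall x : 'cV[R]_n, frob2 x <= 1 -> frobenius_norm (H *m x) <= t) ->
  spectral_norm H <= t.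
Proof.
move=> Ht; apply: ge_sup; first by have [] := spectral_norm_has_sup H.
move=> _ [x /= x1 <-]; apply: Ht; rewrite -sqr_frobenius.
by rewrite expr_le1// frobenius_ge0.
Qed.

(** The geometric mean given by Cauchy-Schwarz is relaxed to an arithmetic mean, so that the bound
    can be summed over pairs of coordinates. *)
Lemma spectral_norm_bilinear n (H : 'M[R]_n) (x y : 'I_n -> R) :
  `|\sum_i \sum_j H i j * (x i * y j)| <=
    spectral_norm H / 2 * (\sum_i x i ^+ 2 + \sum_i y i ^+ 2).
Proof.
pose yv : 'cV[R]_n := \col_i y i.
have -> : \sum_i \sum_j H i j * (x i * y j) = \sum_i x i * (H *m yv) i 0.
  apply: eq_bigr => i _; rewrite mxE mulr_sumr; apply: eq_bigr => j _.
  rewrite mxE; ring.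
have h1 := cauchy_schwarz_sum x (fun i => (H *m yv) i 0).
have h2 := spectral_normP H yv.
rewrite !frob2_cV in h2.
have yE : \sum_i yv i 0 ^+ 2 = \sum_i y i ^+ 2.
  by apply: eq_bigr => i _; rewrite mxE.
rewrite yE in h2.
have s0 := spectral_norm_ge0 H.
have x0 : 0 <= \sum_i x i ^+ 2 by apply: sumr_ge0 => i _; exact: sqr_ge0.
have y0 : 0 <= \sum_i y i ^+ 2 by apply: sumr_ge0 => i _; exact: sqr_ge0.
move: h1 h2 x0 y0 s0.
set a := \sum_i x i * _; set X := \sum_i x i ^+ 2; set Y := \sum_i y i ^+ 2.
set Z := \sum_i _; set s := spectral_norm H => h1 h2 x0 y0 s0.
rewrite -(ler_pXn2r (n := 2))// ?nnegrE ?mulr_ge0 ?addr_ge0// ?invr_ge0//.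
rewrite real_normK ?num_real//.
apply: (le_trans h1); apply: (le_trans (ler_wpM2l x0 h2)).
rewrite -subr_ge0.
have -> : (s / 2 * (X + Y)) ^+ 2 - X * (s ^+ 2 * Y) = (s / 2 * (X - Y)) ^+ 2.
  by field.
exact: sqr_ge0.
Qed.

(* Expanding both inner products over coordinates [k, l] and applying the
   spectral bound to the vectors [a i k * c i l] and [b j k * d j l]. *)
Lemma spectral_norm_rows n r (H : 'M[R]_n) (a b c d : 'M[R]_(n, r)) :
  `|\sum_i \sum_j H i j * ((\sum_k a i k * b j k) * (\sum_l c i l * d j l))| <=
  spectral_norm H / 2 *
    (\sum_i (\sum_k a i k ^+ 2) * (\sum_l c i l ^+ 2) +
     \sum_j (\sum_k b j k ^+ 2) * (\sum_l d j l ^+ 2)).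
Proof.
have -> : \sum_i \sum_j H i j *
    ((\sum_k a i k * b j k) * (\sum_l c i l * d j l)) =
  \sum_k \sum_l \sum_i \sum_j H i j * ((a i k * c i l) * (b j k * d j l)).
  transitivity (\sum_i \sum_j \sum_k \sum_l
      H i j * ((a i k * c i l) * (b j k * d j l))).
    apply: eq_bigr => i _; apply: eq_bigr => j _.
    rewrite mulr_suml mulr_sumr; apply: eq_bigr => k _.
    rewrite mulr_sumr mulr_sumr; apply: eq_bigr => l _; ring.
  under eq_bigr do rewrite exchange_big.
  rewrite exchange_big; apply: eq_bigr => k _ /=.
  under eq_bigr do rewrite exchange_big.
  by rewrite exchange_big.
have sq (e f : 'M[R]_(n, r)) :
    \sum_i (\sum_k e i k ^+ 2) * (\sum_l f i l ^+ 2) =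
    \sum_k \sum_l \sum_i (e i k * f i l) ^+ 2.
  transitivity (\sum_i \sum_k \sum_l (e i k * f i l) ^+ 2).
    apply: eq_bigr => i _; rewrite mulr_suml; apply: eq_bigr => k _.
    by rewrite mulr_sumr; apply: eq_bigr => l _; rewrite exprMn.
  rewrite exchange_big; apply: eq_bigr => k _ /=.
  by rewrite exchange_big.
rewrite !sq -big_split/= mulr_sumr.
apply: (le_trans (ler_norm_sum _ _ _)); apply: ler_sum => k _.
rewrite -big_split/= mulr_sumr.
apply: (le_trans (ler_norm_sum _ _ _)); apply: ler_sum => l _.
exact: (spectral_norm_bilinear H (fun i => a i k * c i l) (fun j => b j k * d j l)).
Qed.

End frob2.
#[global] Hint Resolve frob2_ge0 : core.

(** * Alignment of two factors *)

Section aligned.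
Context {R : realType} {n r : nat}.
Implicit Types X U D : 'M[R]_(n, r).

Lemma trace_quad_ge0 (P : 'M[R]_r) D :
  (forall y : 'rV[R]_r, 0 <= (y *m P *m y^T) 0 0) ->
  0 <= \tr (D^T *m D *m P).
Proof.
move=> P0; rewrite -mulmxA mxtrace_mulC; apply: sumr_ge0 => i _.
have := P0 (row i D); rewrite -row_mul !mxE.
under eq_bigr do rewrite !mxE.
by under [X in _ -> 0 <= X]eq_bigr do rewrite !mxE.
Qed.

Lemma mxtrace_sqr_ge0 (A : 'M[R]_r) : A^T = A -> 0 <= \tr (A *m A).
Proof. by move=> As; rewrite -{2}As -frob2_trace. Qed.

Lemma mxtrace_cyc4 (a b c d : 'M[R]_(n, r)) :
  \tr (a *m b^T *m (c *m d^T)) = \tr (d^T *m a *m (b^T *m c)).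
Proof. by rewrite mulmxA mxtrace_mulC !mulmxA. Qed.

Lemma mxtrace_sqr_combo (G W : 'M[R]_r) (c : R) : G^T = G -> W^T = W ->
  0 <= \tr (G *m G) + 2 * c * \tr (G *m W) + c ^+ 2 * \tr (W *m W).
Proof.
move=> Gs Ws; have : 0 <= \tr ((G + c *: W) *m (G + c *: W)).
  by apply: mxtrace_sqr_ge0; rewrite linearD/= linearZ/= Gs Ws.
rewrite !mulmxDl !mulmxDr -!scalemxAl -!scalemxAr !linearD/= !linearZ/=.
rewrite [\tr (W *m G)]mxtrace_mulC => h.
by rewrite (le_trans h)// le_eqVlt; apply/orP; left; apply/eqP; ring.
Qed.

(** Symmetry of X^T U makes W symmetric, so that U^T D = W as well and every trace in the expansion
    reduces to G, W and S. *)
Lemma frob2_gram_diff X U (D := X - U) (G := D^T *m D) (W := D^T *m U)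
    (S := U^T *m U) :
  (X^T *m U)^T = X^T *m U ->
  frob2 (X *m X^T - U *m U^T) =
  \tr (G *m G) + 4 * \tr (G *m W) + 2 * \tr (W *m W) + 2 * \tr (G *m S).
Proof.
move=> Psym.
have Ws : W^T = W.
  rewrite /W /D linearB/= mulmxBl linearB/= Psym.
  by rewrite [(U^T *m U)^T]trmx_mul trmxK.
have WE : U^T *m D = W by rewrite -Ws /W trmx_mul trmxK.
have -> : X *m X^T - U *m U^T = U *m D^T + D *m U^T + D *m D^T.
  have -> : X = D + U by rewrite /D subrK.
  rewrite [(D + U)^T]linearD/= mulmxDl !mulmxDr addrA addrK.
  by rewrite [RHS]addrC [RHS]addrA addrAC.
clearbody D; rewrite frob2_trace.
set A := _ + _ + _.
have As : A^T = A.
  by rewrite /A !linearD/= !trmx_mul !trmxK [D *m U^T + _]addrC.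
rewrite As /A !mulmxDl !mulmxDr !linearD/= !mxtrace_cyc4 -/S -/G !WE -/W.
rewrite ![\tr (S *m G)]mxtrace_mulC ![\tr (W *m G)]mxtrace_mulC; ring.
Qed.

(* Complete the squares of [G + 4/3 W] and [G + 2 W], where [G = D^T D] and
   [W = D^T U]; what is left is a multiple of [tr (G X^T U) >= 0]. *)
Lemma aligned_bounds X U (D := X - U) :
  (X^T *m U)^T = X^T *m U ->
  (forall y : 'rV[R]_r, 0 <= (y *m (X^T *m U) *m y^T) 0 0) ->
  2 * frob2 (U *m D^T) <= 3 * frob2 (X *m X^T - U *m U^T) /\
  frob2 (D *m D^T) <= 2 * frob2 (X *m X^T - U *m U^T).
Proof.
move=> Psym P0; rewrite frob2_gram_diff// -/D.
have tP := trace_quad_ge0 D P0.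
have Gs : (D^T *m D)^T = D^T *m D by rewrite trmx_mul trmxK.
have Ws : (D^T *m U)^T = D^T *m U.
  rewrite /D linearB/= mulmxBl linearB/= Psym.
  by rewrite [(U^T *m U)^T]trmx_mul trmxK.
have sq c := mxtrace_sqr_combo c Gs Ws.
have WW : 0 <= \tr ((D^T *m U) *m (D^T *m U)) by exact: mxtrace_sqr_ge0.
have PE : X^T *m U = D^T *m U + U^T *m U.
  by rewrite /D linearB/= mulmxBl subrK.
rewrite PE mulmxDr linearD/= in tP.
have B2 : frob2 (D *m D^T) = \tr ((D^T *m D) *m (D^T *m D)).
  by rewrite frob2_trace trmx_mul trmxK mxtrace_cyc4.
have S2 : frob2 (U *m D^T) = \tr ((D^T *m D) *m (U^T *m U)).
  by rewrite frob2_trace trmx_mul trmxK mxtrace_cyc4 mxtrace_mulC.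
rewrite B2 S2.
have h1 := sq (4/3); have h2 := sq 2; clear sq.
move: tP h1 h2 WW.
set g := \tr (_ *m (D^T *m D)); set gw := \tr (_ *m _ *m (D^T *m U)).
set ww := \tr (D^T *m U *m (D^T *m U)); set gs := \tr (_ *m (U^T *m U)).
by move=> *; split; lra.
Qed.
End aligned.

(** * Polar decomposition of a square matrix *)

Section polar.
Context {R : realType} {r : nat}.

Lemma continuous_sum_fun (T : topologicalType) (I : finType) (F : I -> T -> R) :
  (forall i, continuous (F i)) -> continuous (fun x => \sum_i F i x).
Proof.
move=> cF x.
exact: (@cvg_big R I +%R 0 xpredT (@add_continuous R) T (nbhs x)
  (index_enum I) F (F^~ x) (nbhs_filter x) (fun i _ => cF i x)).
Qed.

(** Extreme value theorem on the orthogonal group, flattened to row vectors: it is cut out by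
    polynomial equations, and its entries are bounded because columns are unit vectors. *)
Lemma trace_orthogonal_max (A : 'M[R]_r) :
  exists2 Q : 'M[R]_r, Q^T *m Q = 1%:M &
  forall Q' : 'M[R]_r, Q'^T *m Q' = 1%:M -> \tr (A *m Q') <= \tr (A *m Q).
Proof.
pose K := [set v : 'rV[R]_(r * r) | (vec_mx v)^T *m vec_mx v = 1%:M].
have cc (i j : 'I_r) : continuous (fun v : 'rV[R]_(r * r) => vec_mx v i j).
  move=> v; rewrite /=.
  rewrite (_ : (fun _ => _) = fun v : 'rV[R]_(r * r) => v 0 (mxvec_index i j)).
    exact: coord_continuous.
  by apply/funext => w; rewrite mxE.
have K0 : K !=set0 by exists (mxvec 1%:M); rewrite /K/= mxvecK trmx1 mulmx1.
have Kcl : closed K.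
  have -> : K = \bigcap_(ij in [set: 'I_r * 'I_r])
     ((fun v => \sum_k vec_mx v k ij.1 * vec_mx v k ij.2) @^-1`
       [set x | x = (1%:M : 'M[R]_r) ij.1 ij.2]).
    apply/seteqP; split => v /=.
      move=> vK [i j] _ /=; rewrite -vK mxE.
      by apply: eq_bigr => k _; rewrite [_^T _ _]mxE.
    move=> h; apply/matrixP => i j; rewrite -(h (i, j) Logic.I)/= mxE.
    by apply: eq_bigr => k _; rewrite [_^T _ _]mxE.
  apply: closed_bigI => -[i j] _ /=; apply: preimage_closed; last exact: closed_eq.
  have cs := @continuous_sum_fun _ 'I_r (fun k (v : 'rV[R]_(r * r)) =>
    vec_mx v k i * vec_mx v k j).
  move=> v _; apply: cs => k {}v.
  exact: (cvgM (cc k i v) (cc k j v)).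
have Kb : bounded_set K.
  exists 1; split; first exact: num_real.
  move=> y y1 v vK; apply: le_trans (ltW y1).
  rewrite [leLHS]mx_normrE; apply: bigmax_le => // -[i j] _ /=.
  rewrite (ord1 i) => {i}; case/mxvec_indexP: j => i j.
  have : (vec_mx v i j) ^+ 2 <= 1.
    have := congr1 (fun M : 'M[R]_r => M j j) vK.
    rewrite mxE (bigD1 i)//= !mxE eqxx/= => e.
    rewrite expr2 -[leRHS]e lerDl; apply: sumr_ge0 => k _.
    by rewrite !mxE -expr2 sqr_ge0.
  by rewrite mxE -[leLHS]real_normK ?num_real// expr_le1.
have cont : {within K, continuous (fun v => \tr (A *m vec_mx v))}.
  apply: continuous_subspaceT => v.
  rewrite (_ : (fun _ => _) = (fun v : 'rV[R]_(r * r) =>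
     \sum_i \sum_k A i k * vec_mx v k i)); last first.
    by apply/funext => w; apply: eq_bigr => i _; rewrite mxE.
  move: v; apply: (@continuous_sum_fun _ _ (fun i (v : 'rV[R]_(r * r)) =>
    \sum_k A i k * vec_mx v k i)) => i.
  apply: (@continuous_sum_fun _ _ (fun k (v : 'rV[R]_(r * r)) =>
    A i k * vec_mx v k i)) => k v.
  exact: (cvgM (cvg_cst (A i k)) (cc k i v)).
have [Q QK Qmax] := @EVT_max_rV R _ (fun v => \tr (A *m vec_mx v)) K K0
  (bounded_closed_compact Kb Kcl) cont.
exists (vec_mx Q); first by move: QK; rewrite inE.
move=> Q' Q'1; have := Qmax (mxvec Q'); rewrite mxvecK; apply.
by rewrite inE /K/= mxvecK.
Qed.

Lemma mxtrace_mul_delta (B : 'M[R]_r) (a b : 'I_r) :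
  \tr (B *m delta_mx a b) = B b a.
Proof.
rewrite /mxtrace (bigD1 b)//= [X in _ + X]big1 ?addr0; last first.
  move=> k kb; rewrite mxE big1// => l _.
  by rewrite mxE (negbTE kb) andbF mulr0.
rewrite mxE (bigD1 a)//= [X in _ + X]big1 => [|k ka].
  by rewrite addr0 mxE !eqxx mulr1.
by rewrite mxE (negbTE ka) mulr0.
Qed.

(* A maximizer of [tr (A Q)] over the orthogonal group works: comparing with
   Householder reflections gives positivity, with plane rotations symmetry. *)
Lemma polar_decomposition (A : 'M[R]_r) :
  exists Q : 'M[R]_r, [/\ Q^T *m Q = 1%:M, (A *m Q)^T = A *m Q &
    forall y : 'rV[R]_r, 0 <= (y *m (A *m Q) *m y^T) 0 0].
Proof.
have [Q Q1 Qmax] := trace_orthogonal_max A.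
exists Q; set B := A *m Q.
have Bmax Q' : Q'^T *m Q' = 1%:M -> \tr (B *m Q') <= \tr B.
  move=> Q'1; rewrite /B -mulmxA; apply: Qmax.
  by rewrite trmx_mul mulmxA -(mulmxA Q'^T) Q1 mulmx1.
split => //; clearbody B.
  apply/matrixP => i j; rewrite mxE.
  have [->//|ij] := eqVneq i j.
  (* D projects onto the plane of coordinates i and j, and J generates its rotations: 1 + (c - 1) D
     + s J is the rotation with cosine c and sine s. *)
  pose D : 'M[R]_r := delta_mx i i + delta_mx j j.
  pose J : 'M[R]_r := delta_mx i j - delta_mx j i.
  have dm (a b c d : 'I_r) : (delta_mx a b *m delta_mx c d : 'M[R]_r) =
      (b == c)%:R *: delta_mx a d.
    by case: eqVneq => [->|bc]; rewrite ?mul_delta_mx ?scale1r// mul_delta_mx_0// scale0r.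
  have ji : (j == i) = false by rewrite eq_sym; exact/negbTE.
  have DD : D *m D = D.
    by rewrite /D mulmxDl !mulmxDr !dm !eqxx (negbTE ij) ji !scale1r !scale0r addr0 add0r.
  have DJ : D *m J = J.
    by rewrite /D /J mulmxDl !mulmxBr !dm !eqxx (negbTE ij) ji !scale1r !scale0r subr0 sub0r.
  have JD : J *m D = J.
    by rewrite /D /J mulmxBl !mulmxDr !dm !eqxx (negbTE ij) ji !scale1r !scale0r addr0 add0r.
  have JJ : J *m J = - D.
    rewrite /D /J mulmxBl !mulmxBr !dm !eqxx (negbTE ij) ji !scale1r !scale0r.
    by rewrite subr0 sub0r opprD.
  have DT : D^T = D by rewrite /D linearD/= !trmx_delta.
  have JT : J^T = - J by rewrite /J linearB/= !trmx_delta opprB.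
  have rot (c s : R) : c ^+ 2 + s ^+ 2 = 1 ->
      (1%:M + ((c - 1) *: D + s *: J))^T *m (1%:M + ((c - 1) *: D + s *: J)) = 1%:M.
    clearbody D J => cs.
    have -> : (1%:M + ((c - 1) *: D + s *: J))^T = 1%:M + ((c - 1) *: D - s *: J).
      by rewrite !linearD/= !linearZ/= trmx1 DT JT scalerN.
    rewrite mulmxDl mulmxBl !mulmxDr -!scalemxAl -!scalemxAr.
    rewrite !mul1mx !mulmx1 DD DJ JD JJ.
    apply/matrixP => k l; rewrite !mxE.
    transitivity ((k == l)%:R + (c ^+ 2 + s ^+ 2 - 1) * D k l); first ring.
    by rewrite cs subrr mul0r addr0.
  have rmax (c s : R) : c ^+ 2 + s ^+ 2 = 1 ->
      (c - 1) * (B i i + B j j) + s * (B j i - B i j) <= 0.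
    move=> cs; have := Bmax _ (rot _ _ cs).
    have trD : \tr (B *m D) = B i i + B j j.
      by rewrite mulmxDr linearD/= !mxtrace_mul_delta.
    have trJ : \tr (B *m J) = B j i - B i j.
      by rewrite mulmxBr linearB/= !mxtrace_mul_delta.
    rewrite !mulmxDr mulmx1 -!scalemxAr 2!mxtraceD !mxtraceZ trD trJ.
    by rewrite gerDl.
  set a := B i i + B j j in rmax; set b := B j i - B i j in rmax.
  suff /eqP : b = 0 by rewrite subr_eq0 => /eqP.
  apply/eqP; apply/negPn/negP => b0.
  (* The angle with cosine a / h and sine b / h maximizes c a + s b, with value h; maximality of the
     trace then gives h <= a, against b != 0. *)
  pose h := Num.sqrt (a ^+ 2 + b ^+ 2).
  have ab0 : 0 < a ^+ 2 + b ^+ 2.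
    by rewrite ltr_wpDl ?sqr_ge0// lt_neqAle eq_sym sqrf_eq0 b0 sqr_ge0.
  have h0 : 0 < h by rewrite sqrtr_gt0.
  have h2 : h ^+ 2 = a ^+ 2 + b ^+ 2 by rewrite sqr_sqrtr// ltW.
  have cs : (a / h) ^+ 2 + (b / h) ^+ 2 = 1.
    by rewrite !expr_div_n -mulrDl h2 divff// gt_eqF.
  have := rmax _ _ cs.
  have -> : (a / h - 1) * a + b / h * b = h - a.
    transitivity ((a ^+ 2 + b ^+ 2) / h - a); first by ring.
    by rewrite -h2 expr2 mulfK ?gt_eqF.
  rewrite subr_le0 => ha.
  have : h ^+ 2 <= a ^+ 2.
    by rewrite ler_pXn2r ?nnegrE ?(ltW h0)// (le_trans (ltW h0)).
  rewrite h2 gerDl; apply/negP; rewrite -ltNge lt_neqAle eq_sym sqrf_eq0 b0.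
  exact: sqr_ge0.
move=> y; have [y0|y0] := eqVneq (frob2 y) 0.
  by rewrite (frob2_eq0 y0) mul0mx mul0mx mxE.
have yp : 0 < frob2 y by rewrite lt_neqAle eq_sym y0 frob2_ge0.
have yy : y *m y^T = (frob2 y)%:M.
  by rewrite [LHS]mx11_scalar frob2_trace /mxtrace big_ord1.
pose c := 2 / frob2 y.
have refl : (1%:M - c *: (y^T *m y))^T *m (1%:M - c *: (y^T *m y)) = 1%:M.
  have -> : (1%:M - c *: (y^T *m y))^T = 1%:M - c *: (y^T *m y).
    by rewrite linearB/= linearZ/= trmx1 trmx_mul trmxK.
  rewrite mulmxBl !mulmxBr.
  rewrite !mul1mx !mulmx1 -!scalemxAl -!scalemxAr.
  rewrite -[y^T *m y *m _]mulmxA [y *m _]mulmxA yy mul_scalar_mx -scalemxAr !scalerA.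
  apply/matrixP => k l; rewrite !mxE.
  set q := \sum_j _; rewrite /c; field.
  by rewrite gt_eqF.
have := Bmax _ refl.
rewrite mulmxBr mulmx1 -scalemxAr raddfB/= mxtraceZ gerBl.
rewrite pmulr_rge0 ?divr_gt0// mulmxA mxtrace_mulC mulmxA.
by rewrite /mxtrace big_ord1.
Qed.
End polar.

(** * Local minima of the objective *)

Section quadratic_expansion.
Context {R : realType}.
Implicit Types f g : R -> R.

(** A two-sided Taylor estimate is kept beside the one-sided [quad_majorant] because only the former
    is stable under products. *)
Definition quad_expansion f (a b c : R) : Prop :=
  exists K, \forall t \near (0 : R),
    `|f t - (a + b * t + c * t ^+ 2)| <= K * `|t| ^+ 3.

(* An upper bound is enough to test minimality at 0, and it makes sense at the
   points where the regularizer is not smooth. *)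
Definition quad_majorant f (a b c : R) : Prop :=
  exists K, \forall t \near (0 : R),
    f t <= a + b * t + c * t ^+ 2 + K * `|t| ^+ 3.

Lemma quad_expansion_poly (a b c : R) :
  quad_expansion (fun t => a + b * t + c * t ^+ 2) a b c.
Proof. by exists 0; near=> t; rewrite subrr normr0 mul0r. Unshelve. all: by end_near. Qed.

Lemma quad_expansionD f g a b c a' b' c' :
  quad_expansion f a b c -> quad_expansion g a' b' c' ->
  quad_expansion (fun t => f t + g t) (a + a') (b + b') (c + c').
Proof.
move=> [K Kf] [L Lg]; exists (K + L); near=> t.
have hf : `|f t - (a + b * t + c * t ^+ 2)| <= K * `|t| ^+ 3 by near: t.
have hg : `|g t - (a' + b' * t + c' * t ^+ 2)| <= L * `|t| ^+ 3 by near: t.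
rewrite [leRHS]mulrDl; apply: (le_trans _ (lerD hf hg)); apply: (le_trans _ (ler_normD _ _)).
by rewrite le_eqVlt; apply/orP; left; apply/eqP; congr (`|_|); ring.
Unshelve. all: by end_near. Qed.

Lemma quad_expansionM f g a b c a' b' c' :
  quad_expansion f a b c -> quad_expansion g a' b' c' ->
  quad_expansion (fun t => f t * g t)
    (a * a') (a * b' + b * a') (a * c' + b * b' + c * a').
Proof.
move=> [K Kf] [L Lg].
pose p := `|a| + `|b| + `|c|; pose q := `|a'| + `|b'| + `|c'|.
have N1 : \forall t \near (0 : R), `|t| <= 1 := @nbhs0_le R R 1 ltr01.
exists (p * `|L| + `|K| * q + `|K| * `|L| + p * q); near=> t.
have hf : `|f t - (a + b * t + c * t ^+ 2)| <= K * `|t| ^+ 3 by near: t.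
have hg : `|g t - (a' + b' * t + c' * t ^+ 2)| <= L * `|t| ^+ 3 by near: t.
have t1 : `|t| <= 1 by near: t.
have t0 : 0 <= `|t| by [].
have t2 : `|t| ^+ 2 <= 1 by rewrite expr_le1.
have t3 : `|t| ^+ 3 <= 1 by rewrite expr_le1.
have t30 : 0 <= `|t| ^+ 3 by rewrite exprn_ge0.
have polyb (x y z : R) : `|x + y * t + z * t ^+ 2| <= `|x| + `|y| + `|z|.
  apply: (le_trans (ler_normD _ _)); apply: lerD.
    by apply: (le_trans (ler_normD _ _)); rewrite lerD2l normrM ler_piMr.
  by rewrite normrM normrX ler_piMr.
have hf' : `|f t - (a + b * t + c * t ^+ 2)| <= `|K| * `|t| ^+ 3.
  by rewrite (le_trans hf)// ler_wpM2r// ler_norm.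
have hg' : `|g t - (a' + b' * t + c' * t ^+ 2)| <= `|L| * `|t| ^+ 3.
  by rewrite (le_trans hg)// ler_wpM2r// ler_norm.
have := polyb a b c; have := polyb a' b' c'.
set P := a + _ + _; set Q := a' + _ + _ => Qq Pp.
have -> : f t * g t - (a * a' + (a * b' + b * a') * t +
     (a * c' + b * b' + c * a') * t ^+ 2) =
   P * (g t - Q) + (f t - P) * Q + (f t - P) * (g t - Q) +
   ((b * c' + c * b') + (c * c') * t) * t ^+ 3.
  by rewrite /P /Q; ring.
rewrite [leRHS]mulrDl [X in _ <= X + _]mulrDl [X in _ <= X + _ + _]mulrDl; apply: (le_trans (ler_normD _ _)); apply: lerD; last first.
  rewrite normrM normrX ler_wpM2r//.
  apply: (le_trans (ler_normD _ _)).
  apply: (@le_trans _ _ (`|b| * `|c'| + `|c| * `|b'| + `|c| * `|c'|)).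
    apply: lerD; first by rewrite -!normrM ler_normD.
    by rewrite !normrM ler_piMr// mulr_ge0.
  rewrite /p /q -subr_ge0.
  have -> : forall x y z x' y' z' : R, (x + y + z) * (x' + y' + z') -
    (y * z' + z * y' + z * z') = x * (x' + y' + z') + y * x' + y * y' + z * x'.
    by move=> *; ring.
  by rewrite !addr_ge0// mulr_ge0// !addr_ge0.
apply: (le_trans (ler_normD _ _)); apply: lerD.
  apply: (le_trans (ler_normD _ _)); apply: lerD; rewrite normrM.
    by rewrite -mulrA ler_pM.
  by rewrite mulrAC ler_pM.
rewrite normrM.
apply: (@le_trans _ _ (`|K| * `|t| ^+ 3 * `|L|)); last by rewrite mulrAC.
by rewrite ler_pM// (le_trans hg')// ler_piMr.
Unshelve. all: by end_near. Qed.

Lemma quad_expansion_eq f a b c a' b' c' :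
  a = a' -> b = b' -> c = c' ->
  quad_expansion f a b c -> quad_expansion f a' b' c'.
Proof. by move=> -> -> ->. Qed.

Lemma quad_expansion_majorant f a b c :
  quad_expansion f a b c -> quad_majorant f a b c.
Proof.
move=> [K Kf]; exists K; near=> t.
have : `|f t - (a + b * t + c * t ^+ 2)| <= K * `|t| ^+ 3 by near: t.
by rewrite ler_norml => /andP[_]; rewrite lerBlDl.
Unshelve. all: by end_near. Qed.

Lemma quad_majorant_le f g a b c : (\forall t \near (0 : R), f t <= g t) ->
  quad_majorant g a b c -> quad_majorant f a b c.
Proof.
move=> fg [K Kg]; exists K; near=> t.
by apply: (@le_trans _ _ (g t)); near: t.
Unshelve. all: by end_near. Qed.

Lemma quad_majorant_eq f a b c a' b' c' :
  a = a' -> b = b' -> c = c' ->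
  quad_majorant f a b c -> quad_majorant f a' b' c'.
Proof. by move=> -> -> ->. Qed.

Lemma quad_majorantD f g a b c a' b' c' :
  quad_majorant f a b c -> quad_majorant g a' b' c' ->
  quad_majorant (fun t => f t + g t) (a + a') (b + b') (c + c').
Proof.
move=> [K Kf] [L Lg]; exists (K + L); near=> t.
have hf : f t <= a + b * t + c * t ^+ 2 + K * `|t| ^+ 3 by near: t.
have hg : g t <= a' + b' * t + c' * t ^+ 2 + L * `|t| ^+ 3 by near: t.
apply: (le_trans (lerD hf hg)).
by rewrite le_eqVlt; apply/orP; left; apply/eqP; ring.
Unshelve. all: by end_near. Qed.

Lemma quad_majorantZ f (k : R) a b c : 0 <= k ->
  quad_majorant f a b c ->
  quad_majorant (fun t => k * f t) (k * a) (k * b) (k * c).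
Proof.
move=> k0 [K Kf]; exists (k * K); near=> t.
have hf : f t <= a + b * t + c * t ^+ 2 + K * `|t| ^+ 3 by near: t.
apply: (le_trans (ler_wpM2l k0 hf)).
by rewrite le_eqVlt; apply/orP; left; apply/eqP; ring.
Unshelve. all: by end_near. Qed.

Lemma quad_majorant_sum (I : finType) (f : I -> R -> R) (a b c : I -> R) :
  (forall i, quad_majorant (f i) (a i) (b i) (c i)) ->
  quad_majorant (fun t => \sum_i f i t) (\sum_i a i) (\sum_i b i) (\sum_i c i).
Proof.
move=> fi; elim: (index_enum I) => [|i s IH].
  by exists 0; near=> t; rewrite !big_nil !mul0r !addr0.
have [K H] := quad_majorantD (fi i) IH.
by exists K; near=> t; rewrite !big_cons; near: t.
Unshelve. all: by end_near. Qed.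

Lemma ge0_of_linear_perturbation (x y e : R) : 0 < e ->
  (forall s, 0 < s -> s < e -> 0 <= x + s * y) -> 0 <= x.
Proof.
move=> e0 h; rewrite leNgt; apply/negP => x0.
pose d := - x / (`|y| + 1).
have y1 : 0 < `|y| + 1 by rewrite ltr_wpDl.
have d0 : 0 < d by rewrite divr_gt0// oppr_gt0.
pose s := Num.min (e / 2) (d / 2).
have s0 : 0 < s by rewrite lt_min; apply/andP; split; lra.
have se : s < e by rewrite gt_min; apply/orP; left; lra.
have sd : s < d by rewrite gt_min; apply/orP; right; lra.
have := h s s0 se.
have : s * y < - x.
  apply: (@le_lt_trans _ _ (s * (`|y| + 1))).
    by rewrite ler_wpM2l ?(ltW s0)// (le_trans (ler_norm _))// lerDl.
  by rewrite -ltr_pdivlMr.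
lra.
Qed.

(** Dividing by t as t tends to 0 from either side forces b = 0; dividing by t^2 then gives c >=
    0. *)
Lemma quad_majorant_min f b c :
  (\forall t \near (0 : R), f 0 <= f t) -> quad_majorant f (f 0) b c ->
  b = 0 /\ 0 <= c.
Proof.
move=> fmin [K Kf].
have : \forall t \near (0 : R), 0 <= b * t + c * t ^+ 2 + K * `|t| ^+ 3.
  near=> t; rewrite -(lerD2l (f 0)) addr0 !addrA.
  by apply: (@le_trans _ _ (f t)); near: t.
move=> /nbhs_ballP[e /= e0 he].
have {}he t : `|t| < e -> 0 <= b * t + c * t ^+ 2 + K * `|t| ^+ 3.
  by move=> te; apply: he; rewrite /ball/= sub0r normrN.
have m0 : 0 < Num.min e 1 by rewrite lt_min e0 ltr01.
have b0 : 0 <= b.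
  apply: (ge0_of_linear_perturbation (y := `|c| + `|K|) m0) => s s0.
  rewrite lt_min => /andP[se s1].
  have := he s; rewrite gtr0_norm// => /(_ se).
  have -> : b * s + c * s ^+ 2 + K * s ^+ 3 = s * (b + s * (c + K * s)) by ring.
  rewrite pmulr_rge0// => h; apply: (le_trans h); rewrite lerD2l ler_pM2l//.
  rewrite lerD ?ler_norm// (le_trans (ler_norm _))// normrM ler_piMr//.
  by rewrite gtr0_norm// ltW.
have b1 : 0 <= - b.
  apply: (ge0_of_linear_perturbation (y := `|c| + `|K|) m0) => s s0.
  rewrite lt_min => /andP[se s1].
  have := he (- s); rewrite normrN gtr0_norm// => /(_ se).
  have -> : b * - s + c * (- s) ^+ 2 + K * s ^+ 3 = s * (- b + s * (c + K * s)) by ring.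
  rewrite pmulr_rge0// => h; apply: (le_trans h); rewrite lerD2l ler_pM2l//.
  rewrite lerD ?ler_norm// (le_trans (ler_norm _))// normrM ler_piMr//.
  by rewrite gtr0_norm// ltW.
have bE : b = 0 by apply: le_anti; rewrite b0 -oppr_ge0 b1.
split=> //; apply: (ge0_of_linear_perturbation (y := K) e0) => s s0 se.
have := he s; rewrite gtr0_norm// => /(_ se).
have -> : b * s + c * s ^+ 2 + K * s ^+ 3 = s ^+ 2 * (c + s * K).
  by rewrite bE; ring.
by rewrite pmulr_rge0// exprn_gt0.
Unshelve. all: by end_near. Qed.

(** The third Taylor polynomial of the square root: its square exceeds 1 + w by w^4 ((w - 2)^2 + 16)
    / 256. *)
Lemma sqrt1D_le (w : R) : `|w| <= 1 ->
  Num.sqrt (1 + w) <= 1 + w / 2 - w ^+ 2 / 8 + w ^+ 3 / 16.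
Proof.
rewrite ler_norml => /andP[w1 w2].
have P0 : 0 <= 1 + w / 2 - w ^+ 2 / 8 + w ^+ 3 / 16.
  have -> : 1 + w / 2 - w ^+ 2 / 8 + w ^+ 3 / 16 =
     (1 + w) / 4 + (3 / 4 + w / 4 - (w ^+ 2) * (3 / 16)) + (w ^+ 2) * (1 + w) / 16.
    by field.
  have : w ^+ 2 <= 1 by rewrite -[w ^+ 2]real_normK ?num_real// expr_le1// ler_norml w1.
  have := sqr_ge0 w; have : 0 <= w ^+ 2 * (1 + w) by rewrite mulr_ge0 ?sqr_ge0//; lra.
  lra.
rewrite -(ler_pXn2r (n := 2))// ?nnegrE ?sqrtr_ge0// sqr_sqrtr; last lra.
rewrite -subr_ge0.
have -> : (1 + w / 2 - w ^+ 2 / 8 + w ^+ 3 / 16) ^+ 2 - (1 + w) =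
  w ^+ 4 / 256 * ((w - 2) ^+ 2 + 16) by field.
rewrite mulr_ge0//; last by rewrite addr_ge0// sqr_ge0.
by rewrite mulr_ge0 ?invr_ge0// -[4%N]/(2 * 2)%N exprM sqr_ge0.
Qed.

(** Removes the positive part from an upper bound; the even power keeps this true where v is
    negative. *)
Lemma max0_pow4_le (u v : R) : u <= v -> Num.max u 0 ^+ 4 <= v ^+ 4.
Proof.
move=> uv; have [v0|v0] := leP 0 v.
  by rewrite ler_pXn2r ?nnegrE ?le_max ?lexx ?orbT// ge_max uv.
rewrite max_r ?(le_trans uv (ltW v0))// expr0n/=.
by rewrite -[4%N]/(2 * 2)%N exprM sqr_ge0.
Qed.

End quadratic_expansion.

(** * First and second variation of the objective *)

Section local_conditions.
Context {R : realType}.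

Lemma quadratic_near0 (b c e : R) : 0 < e ->
  \forall t \near (0 : R), `|b * t + c * t ^+ 2| <= e.
Proof.
move=> e0; have N1 : \forall t \near (0 : R), `|t| <= 1 := @nbhs0_le R R 1 ltr01.
have k0 : 0 < `|b| + `|c| + 1 by rewrite ltr_wpDl// addr_ge0.
have N2 : \forall t \near (0 : R), `|t| <= e / (`|b| + `|c| + 1).
  by apply: (@nbhs0_le R R); rewrite divr_gt0.
near=> t.
have t1 : `|t| <= 1 by near: t.
have : `|t| <= e / (`|b| + `|c| + 1) by near: t.
rewrite ler_pdivlMr// => te; apply: le_trans te.
apply: (le_trans (ler_normD _ _)); rewrite normrM [X in _ + X]normrM normrX.
have : `|c| * `|t| ^+ 2 <= `|c| * `|t|.
  by rewrite ler_wpM2l// expr2 ler_piMr.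
have := normr_ge0 t; nra.
Unshelve. all: by end_near. Qed.

Lemma frob2_line (r : nat) (x d : 'rV[R]_r) (t : R) :
  frob2 (x + t *: d) =
  frob2 x + (2 * \sum_k x 0 k * d 0 k) * t + frob2 d * t ^+ 2.
Proof.
rewrite !frob2_rV mulr_sumr !mulr_suml -!big_split/=.
by apply: eq_bigr => k _; rewrite !mxE; ring.
Qed.

(** Along the line the norm of the row has first derivative a and second derivative (c - a^2) / N.
    For N < alpha the penalty vanishes near 0. For N >= alpha, boundary included, dropping the
    positive part and replacing the square root by its Taylor polynomial leaves a polynomial in
    t. *)
Lemma regularizer_majorant (r : nat) (x d : 'rV[R]_r) (alpha : R)
    (N := frobenius_norm x) (tau := Num.max (N - alpha) 0)
    (a := (\sum_k x 0 k * d 0 k) / N) (c := frob2 d) :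
  0 < alpha ->
  quad_majorant (fun t => Num.max (frobenius_norm (x + t *: d) - alpha) 0 ^+ 4)
    (tau ^+ 4) (4 * tau ^+ 3 * a)
    (6 * tau ^+ 2 * a ^+ 2 + 2 * tau ^+ 3 * ((c - a ^+ 2) / N)).
Proof.
move=> al0; pose b := \sum_k x 0 k * d 0 k.
have N0 : 0 <= N by exact: frobenius_ge0.
have N2 : frob2 x = N ^+ 2 by rewrite sqr_frobenius.
have line t : frobenius_norm (x + t *: d) =
    Num.sqrt (N ^+ 2 + (2 * b) * t + c * t ^+ 2).
  by rewrite frobenius_normE frob2_line N2.
have [Nal|alN] := ltP N alpha.
  have t0 : tau = 0 by rewrite /tau max_r// subr_le0 ltW.
  apply: (quad_majorant_le (g := fun t => 0 + 0 * t + 0 * t ^+ 2)); last first.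
    apply: quad_expansion_majorant; rewrite t0 !expr0n/= !(mulr0, mul0r, addr0).
    exact: quad_expansion_poly.
  have e0 : 0 < alpha ^+ 2 - N ^+ 2.
    by rewrite subr_gt0 ltr_pXn2r ?nnegrE// ltW.
  have := quadratic_near0 (2 * b) c e0; apply: filterS => t.
  rewrite ler_norml => /andP[_ ht]; rewrite !mul0r !addr0 line max_r ?expr0n//.
  rewrite subr_le0 -[leRHS](gtr0_norm al0) -sqrtr_sqr.
  rewrite ler_sqrt ?sqr_ge0//; lra.
have Np : 0 < N by exact: lt_le_trans alN.
have Nn : N != 0 by rewrite gt_eqF.
have tE : tau = N - alpha by rewrite /tau max_l// subr_ge0.
(* N^2 (1 + w t) is the squared norm along the line. The polynomials are spelled as sums and
   products so that [quad_expansionD] and [quad_expansionM] compute their coefficients. *)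
pose w t := (0 + (2 * b / N ^+ 2) * t + (c / N ^+ 2) * t ^+ 2).
pose h t := tau + (N / 2) * w t + (- (N / 8)) * (w t * w t) +
   (N / 16) * (w t * (w t * w t)).
apply: (quad_majorant_le (g := fun t => (h t * h t) * (h t * h t))).
  have := quadratic_near0 (2 * b / N ^+ 2) (c / N ^+ 2) (@ltr01 R).
  apply: filterS => t; rewrite -(add0r (_ * t)) => wt.
  rewrite -[X in _ <= X]/((h t * h t) * (h t * h t)).
  have -> : (h t * h t) * (h t * h t) = h t ^+ 4 by ring.
  apply: max0_pow4_le; rewrite line.
  have -> : N ^+ 2 + (2 * b) * t + c * t ^+ 2 = N ^+ 2 * (1 + w t).
    by rewrite /w; field.
  rewrite sqrtrM ?sqr_ge0// sqrtr_sqr ger0_norm// /h tE.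
  have := ler_wpM2l N0 (sqrt1D_le wt); rewrite -/(w t); lra.
apply: quad_expansion_majorant.
have ew : quad_expansion w 0 (2 * b / N ^+ 2) (c / N ^+ 2).
  exact: quad_expansion_poly.
have ek (k : R) : quad_expansion (fun=> k) k 0 0.
  have [K HK] := quad_expansion_poly k 0 0; exists K.
  by apply: filterS HK => t; rewrite !mul0r !addr0.
have ew2 := quad_expansionM ew ew.
have ew3 := quad_expansionM ew ew2.
have eh := quad_expansionD (quad_expansionD (quad_expansionD (ek tau)
  (quad_expansionM (ek (N / 2)) ew)) (quad_expansionM (ek (- (N / 8))) ew2))
  (quad_expansionM (ek (N / 16)) ew3).
have eh4 := quad_expansionM (quad_expansionM eh eh) (quad_expansionM eh eh).
by apply: quad_expansion_eq eh4; rewrite /a -/b; field.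
Qed.

Definition mask_inner (n : nat) (W : {set 'I_n * 'I_n}) (A B : 'M[R]_n) : R :=
  \sum_i \sum_j ((i, j) \in W)%:R * (A i j * B i j).

Lemma frob2_mask (n : nat) (W : {set 'I_n * 'I_n}) (A : 'M[R]_n) :
  frob2 (mask_mx W A) = mask_inner W A A.
Proof.
apply: eq_bigr => i _; apply: eq_bigr => j _; rewrite mxE.
by case: ifP; rewrite ?mul1r ?mul0r ?expr2 ?mulr0.
Qed.

Lemma mask_inner_expansion (n : nat) (W : {set 'I_n * 'I_n}) (A E B : 'M[R]_n) :
  quad_majorant (fun t => mask_inner W (A + t *: E + t ^+ 2 *: B)
                                       (A + t *: E + t ^+ 2 *: B))
    (mask_inner W A A) (2 * mask_inner W A E)
    (mask_inner W E E + 2 * mask_inner W A B).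
Proof.
apply: (quad_majorant_eq (a := mask_inner W A A)
   (b := \sum_i \sum_j ((i, j) \in W)%:R * (A i j * E i j + E i j * A i j))
   (c := \sum_i \sum_j ((i, j) \in W)%:R *
     (A i j * B i j + E i j * E i j + B i j * A i j))) => //.
- rewrite mulr_sumr; apply: eq_bigr => i _; rewrite mulr_sumr.
  by apply: eq_bigr => j _; ring.
- rewrite mulr_sumr -big_split; apply: eq_bigr => i _; rewrite mulr_sumr -big_split.
  by apply: eq_bigr => j _ /=; ring.
apply: quad_majorant_sum => i; apply: quad_majorant_sum => j.
apply: quad_majorantZ; first by case: (_ \in _).
apply: quad_expansion_majorant.
have e := quad_expansion_poly (A i j) (E i j) (B i j).
have [K HK] := quad_expansionM e e; exists K; apply: filterS HK => t.
by rewrite !mxE ![t * _]mulrC ![t ^+ 2 * _]mulrC.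
Qed.

Lemma gram_line (n r : nat) (X D : 'M[R]_(n, r)) (M : 'M[R]_n) (t : R) :
  (X + t *: D) *m (X + t *: D)^T - M =
  (X *m X^T - M) + t *: (X *m D^T + D *m X^T) + t ^+ 2 *: (D *m D^T).
Proof.
have -> : (X + t *: D)^T = X^T + t *: D^T by rewrite linearD/= linearZ.
rewrite mulmxDl !mulmxDr -!scalemxAl -!scalemxAr scalerA.
by apply/matrixP => i j; rewrite !mxE; ring.
Qed.

Lemma local_minimum_line (n r : nat) (f : 'M[R]_(n, r) -> R) (X D : 'M[R]_(n, r)) :
  local_minimum f X -> \forall t \near (0 : R), f X <= f (X + t *: D).
Proof.
move=> lm.
have := @cvgD R 'M[R]_(n, r) R (nbhs 0) _ _ _ X (0 *: D) (cvg_cst X)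
  (@scalel_continuous R 'M[R]_(n, r) D 0).
rewrite scale0r addr0 => h; exact: (h (nbhs_filter 0) (nbhs_filter 0) _ lm).
Qed.

(** The derivative of the norm of row i in the direction D, where that row is nonzero. *)
Definition row_dot (n r : nat) (X D : 'M[R]_(n, r)) (i : 'I_n) : R :=
  (\sum_k X i k * D i k) / frobenius_norm (row i X).

Definition row_excess (n r : nat) (X : 'M[R]_(n, r)) (alpha : R) (i : 'I_n) : R :=
  Num.max (frobenius_norm (row i X) - alpha) 0.

(** Second derivative minus four times the first one, for the penalty of row i. *)
Definition regularizer_curvature (n r : nat) (alpha : R) (X D : 'M[R]_(n, r))
    (i : 'I_n) (tau := row_excess X alpha i) (a := row_dot X D i)
    (c := frob2 (row i D)) : R :=
  12 * tau ^+ 2 * a ^+ 2 + 4 * tau ^+ 3 * ((c - a ^+ 2) / frobenius_norm (row i X))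
   - 16 * tau ^+ 3 * a.

(* The second variation minus four times the first one, in the direction [D]. *)
Lemma local_minimum_curvature (n r : nat) (M : 'M[R]_n) (W : {set 'I_n * 'I_n})
    (alpha lambda : R) (X D : 'M[R]_(n, r))
    (A := X *m X^T - M) (E := X *m D^T + D *m X^T) (B := D *m D^T) :
  0 < alpha -> 0 <= lambda ->
  local_minimum (objective M W alpha lambda) X ->
  0 <= mask_inner W E E + 2 * mask_inner W A B - 4 * mask_inner W A E +
       lambda * \sum_i regularizer_curvature alpha X D i.
Proof.
move=> al0 l0 lm.
have hm := quad_majorantZ (k := 2^-1) _ (mask_inner_expansion W A E B).
have {}hm := hm ltac:(by rewrite invr_ge0).
have hr i : quad_majorant (fun t =>
      Num.max (frobenius_norm (row i X + t *: row i D) - alpha) 0 ^+ 4)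
    (row_excess X alpha i ^+ 4) (4 * row_excess X alpha i ^+ 3 * row_dot X D i)
    (6 * row_excess X alpha i ^+ 2 * row_dot X D i ^+ 2 +
       2 * row_excess X alpha i ^+ 3 *
       ((frob2 (row i D) - row_dot X D i ^+ 2) / frobenius_norm (row i X))).
  have -> : row_dot X D i =
      (\sum_k row i X 0 k * row i D 0 k) / frobenius_norm (row i X).
    by congr (_ / _); apply: eq_bigr => k _; rewrite !mxE.
  exact: regularizer_majorant.
have hq := quad_majorantD hm (quad_majorantZ l0 (quad_majorant_sum hr)).
have fline := local_minimum_line D lm.
pose f t := objective M W alpha lambda (X + t *: D).
have fE t : f t = 2^-1 * mask_inner W (A + t *: E + t ^+ 2 *: B)
      (A + t *: E + t ^+ 2 *: B) + lambda * \sum_i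
   Num.max (frobenius_norm (row i X + t *: row i D) - alpha) 0 ^+ 4.
  rewrite /f /objective sqr_frobenius frob2_mask gram_line; congr (_ + _ * _).
  by apply: eq_bigr => i _; rewrite linearD/= linearZ.
have f0 : 2^-1 * mask_inner W A A + lambda * \sum_i row_excess X alpha i ^+ 4 = f 0.
  rewrite fE; congr (_ * _ + _ * _).
    by rewrite scale0r expr0n/= scale0r !addr0.
  by apply: eq_bigr => i _; rewrite scale0r addr0.
have hf : \forall t \near (0 : R), f 0 <= f t.
  by move: fline; rewrite /f scale0r addr0.
have hfq := quad_majorant_eq f0 erefl erefl (quad_majorant_le (f := f) _ hq).
have [|h1 h2] := quad_majorant_min hf (hfq _).
  by near=> t; rewrite fE.
have E1 : \sum_i regularizer_curvature alpha X D i =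
    2 * (\sum_i (6 * row_excess X alpha i ^+ 2 * row_dot X D i ^+ 2 +
       2 * row_excess X alpha i ^+ 3 *
       ((frob2 (row i D) - row_dot X D i ^+ 2) / frobenius_norm (row i X))))
  - 4 * \sum_i (4 * row_excess X alpha i ^+ 3 * row_dot X D i).
  by rewrite !mulr_sumr -sumrB; apply: eq_bigr => i _; rewrite /regularizer_curvature; ring.
rewrite E1; lra.
Unshelve. all: by end_near. Qed.
End local_conditions.

(** * Absorption of the fourth powers by the regularizer *)

Section row_estimate.
Context {R : realType}.
Local Notation Kr := (2 * 10 ^+ 10 : R).

(* The regularizer vanishes for [N <= alpha]; for [N <= 10 alpha] all terms are
   O([rho m^2 c]); beyond, [tau], [a] and [sqrt c] are all close to [N], so the
   second factor is close to [(12 - 16) N^4] and absorbs [c^2]. *)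
Lemma curvature_estimate (N q U m alpha rho lambda : R)
    (c := N ^+ 2 - 2 * q + U) (tau := Num.max (N - alpha) 0)
    (a := (N ^+ 2 - q) / N) :
  0 <= N -> 0 <= U -> U <= m ^+ 2 -> q ^+ 2 <= N ^+ 2 * U -> 0 < m ->
  100 * m <= alpha -> alpha <= 200 * m -> 0 <= rho ->
  100 * rho <= lambda -> lambda <= 200 * rho ->
  10 * rho * c ^+ 2 + lambda *
   (12 * tau ^+ 2 * a ^+ 2 + 4 * tau ^+ 3 * ((c - a ^+ 2) / N) - 16 * tau ^+ 3 * a)
  <= Kr * rho * m ^+ 2 * c.
Proof.
move=> N0 U0 Um qN m0 al1 al2 r0 l1 l2.
have qm : `|q| <= N * m.
  rewrite -(ler_pXn2r (n := 2))// ?nnegrE ?mulr_ge0// ?(ltW m0)//.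
  rewrite real_normK ?num_real// (le_trans qN)// exprMn ler_wpM2l ?sqr_ge0//.
move: qm; rewrite ler_norml => /andP[q1 q2].
have c1 : c <= (N + m) ^+ 2.
  have -> : (N + m) ^+ 2 = N ^+ 2 + 2 * (N * m) + m ^+ 2 by ring.
  rewrite /c; lra.
have c0 : 0 <= c.
  have [NE|Nn] := eqVneq N 0.
    have q0 : q = 0.
      apply/eqP; rewrite -sqrf_eq0 eq_le sqr_ge0 andbT.
      by rewrite (le_trans qN)// NE expr0n mul0r.
    by rewrite /c NE q0 expr0n mulr0 subr0 add0r.
  have Np : 0 < N by rewrite lt_neqAle eq_sym Nn.
  have : 0 <= N ^+ 2 * c.
    have -> : N ^+ 2 * c = (N ^+ 2 - q) ^+ 2 + (N ^+ 2 * U - q ^+ 2) by rewrite /c; ring.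
    by rewrite addr_ge0 ?sqr_ge0// subr_ge0.
  by rewrite pmulr_rge0// exprn_gt0.
have rc : 0 <= rho * c by rewrite mulr_ge0.
have m2 : 0 <= m ^+ 2 by exact: sqr_ge0.
have rcm : 0 <= rho * c * m ^+ 2 by rewrite mulr_ge0.
have cle (k : R) : 0 <= k -> N + m <= k * m -> c <= k ^+ 2 * m ^+ 2.
  move=> k0 h; apply: (le_trans c1); rewrite -exprMn.
  by rewrite ler_pXn2r ?nnegrE ?mulr_ge0 ?addr_ge0// ltW.
have [Na|aN] := leP N alpha.
  have -> : tau = 0 by rewrite /tau max_r// subr_le0.
  rewrite !expr0n/= !(mulr0, mul0r, subr0, addr0).
  have c2 : c <= (3 * 10 ^+ 2) ^+ 2 * m ^+ 2 by apply: cle; lra.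
  have h := ler_wpM2l rc c2.
  have -> : 10 * rho * c ^+ 2 = 10 * (rho * c * c) by ring.
  have -> : Kr * rho * m ^+ 2 * c = Kr * (rho * c * m ^+ 2) by ring.
  have : rho * c * ((3 * 10 ^+ 2) ^+ 2 * m ^+ 2) = (3 * 10 ^+ 2) ^+ 2 * (rho * c * m ^+ 2) by ring.
  move: h rcm; clear; lra.
have Np : 0 < N by lra.
have tE : tau = N - alpha by rewrite /tau max_l// subr_ge0 ltW.
have t0 : 0 <= tau by rewrite tE; lra.
have tN : tau <= N by rewrite tE; lra.
have aE : a * N = N ^+ 2 - q by rewrite /a divfK ?gt_eqF.
have cE : (c - a ^+ 2) * N ^+ 2 = U * N ^+ 2 - q ^+ 2.
  by rewrite mulrBl -exprMn aE /c; ring.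
have ca : a ^+ 2 <= c.
  by rewrite -subr_ge0 -(pmulr_lge0 _ (exprn_gt0 2 Np)) cE subr_ge0 [leRHS]mulrC.
have cU : c - a ^+ 2 <= U.
  by rewrite -(ler_pM2r (exprn_gt0 2 Np)) cE lerBlDr lerDl sqr_ge0.
have NmNN : N * m <= N ^+ 2 by rewrite expr2 ler_wpM2l//; lra.
have a0 : 0 <= a by rewrite /a divr_ge0//; lra.
set gam := 12 * _ * _ + _ - _.
have l0 : 0 <= lambda by lra.
have [N10|N10] := leP N (10 * alpha).
  have g : gam <= 16 * (tau ^+ 2 * c).
    have h1 : tau ^+ 2 * a ^+ 2 <= tau ^+ 2 * c by rewrite ler_wpM2l ?sqr_ge0.
    have h2 : tau ^+ 3 * ((c - a ^+ 2) / N) <= tau ^+ 2 * c.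
      rewrite exprSr -mulrA ler_wpM2l ?sqr_ge0// mulrA ler_pdivrMr//.
      rewrite [leRHS]mulrC ler_pM//; first by rewrite subr_ge0.
      by rewrite gerBl sqr_ge0.
    have h3 : 0 <= tau ^+ 3 * a by rewrite mulr_ge0// exprn_ge0.
    rewrite /gam; move: h1 h2 h3; clear; lra.
  have tk (k : R) : tau <= k * m -> tau ^+ 2 * c <= k ^+ 2 * m ^+ 2 * c.
    move=> h; rewrite ler_wpM2r// -exprMn ler_pXn2r ?nnegrE//.
    exact: le_trans h.
  (* Here tau <= 9 alpha <= 1800 m. The resulting factor 200 * 16 * (2 * 10^3)^2 = 1.28 * 10^10
     dictates the size of [Kr]. *)
  have g2 : tau ^+ 2 * c <= (2 * 10 ^+ 3) ^+ 2 * m ^+ 2 * c by apply: tk; lra.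
  have h1 := ler_wpM2l l0 g.
  have h2 : lambda * (16 * (tau ^+ 2 * c)) <= 200 * rho * (16 * ((2 * 10 ^+ 3) ^+ 2 * m ^+ 2 * c)).
    apply: ler_pM; [exact: l0| |exact: l2|exact: (ler_wpM2l _ g2)].
    by rewrite !mulr_ge0// sqr_ge0.
  have c2 : c <= (21 * 10 ^+ 2) ^+ 2 * m ^+ 2 by apply: cle; lra.
  have h3 := ler_wpM2l rc c2.
  have -> : 10 * rho * c ^+ 2 = 10 * (rho * c * c) by ring.
  have -> : Kr * rho * m ^+ 2 * c = Kr * (rho * c * m ^+ 2) by ring.
  have e3 : rho * c * ((21 * 10 ^+ 2) ^+ 2 * m ^+ 2) = (21 * 10 ^+ 2) ^+ 2 * (rho * c * m ^+ 2) by ring.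
  have e2 : 200 * rho * (16 * ((2 * 10 ^+ 3) ^+ 2 * m ^+ 2 * c)) = 200 * 16 * (2 * 10 ^+ 3) ^+ 2 * (rho * c * m ^+ 2) by ring.
  move: h1 h2 h3 rcm; rewrite e3 e2; clear; lra.
have m1 : 10 ^+ 3 * m <= N by lra.
have Nmm : 10 ^+ 3 * (N * m) <= N ^+ 2 by rewrite expr2 mulrCA ler_wpM2l.
have c2 : c <= 2 * N ^+ 2.
  have mm : m ^+ 2 <= N * m by rewrite expr2 ler_wpM2r//; lra.
  rewrite /c; move: Nmm mm q1 Um (sqr_ge0 N); clear; lra.
have U1 : U <= N * (N / 10 ^+ 6).
  apply: (le_trans Um); have -> : N * (N / 10 ^+ 6) = (N / 10 ^+ 3) ^+ 2 by field.
  rewrite ler_pXn2r ?nnegrE//; lra.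
have t9 : 9 * N <= 10 * tau by rewrite tE; lra.
have a1 : 99 / 100 * N <= a.
  rewrite -(ler_pM2r Np) aE; move: Nmm q2 (sqr_ge0 N); clear; lra.
have cN : (c - a ^+ 2) / N <= N / 10 ^+ 6.
  by rewrite ler_pdivrMr// (le_trans cU)// [leRHS]mulrC.
(* The threshold 10 alpha makes tau at least 9/10 of N, so that 12 a - 16 tau <= (12.12 - 14.4) N is
   negative. *)
have g1 : 12 * a ^+ 2 + 4 * tau * ((c - a ^+ 2) / N) - 16 * tau * a <= - 2 * N ^+ 2.
  have a2 : a <= 101 / 100 * N.
    rewrite -(ler_pM2r Np) aE; move: Nmm q1 (sqr_ge0 N); clear; lra.
  have h1 : tau * ((c - a ^+ 2) / N) <= N * (N / 10 ^+ 6).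
    by rewrite ler_pM// divr_ge0// subr_ge0.
  have h2 : a * (12 * a - 16 * tau) <= a * (- (22 / 10) * N) by rewrite ler_wpM2l//; lra.
  have h3 : 99 / 100 * N * N <= a * N by rewrite ler_wpM2r.
  move: h1 h2 h3 (sqr_ge0 N); clear; lra.
have g : gam <= - (c ^+ 2) / 10.
  have -> : gam = tau ^+ 2 * (12 * a ^+ 2 + 4 * tau * ((c - a ^+ 2) / N) - 16 * tau * a).
    by rewrite /gam; ring.
  apply: (le_trans (ler_wpM2l (sqr_ge0 tau) g1)).
  have h1 : (9 / 10 * N) ^+ 2 * N ^+ 2 <= tau ^+ 2 * N ^+ 2.
    by rewrite ler_wpM2r ?sqr_ge0// ler_pXn2r ?nnegrE//; lra.
  have h2 : c ^+ 2 <= (2 * N ^+ 2) ^+ 2 by rewrite ler_pXn2r ?nnegrE// mulr_ge0 ?sqr_ge0.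
  have h3 : 0 <= (N ^+ 2) ^+ 2 by exact: sqr_ge0.
  move: h1 h2 h3; clear; lra.
have h1 := ler_wpM2l l0 g.
(* The gain c^2 / 10, multiplied by lambda >= 100 rho, pays exactly for 10 rho c^2. *)
have h2 : 100 * rho * c ^+ 2 <= lambda * c ^+ 2 by rewrite ler_wpM2r ?sqr_ge0.
have -> : Kr * rho * m ^+ 2 * c = Kr * (rho * c * m ^+ 2) by ring.
move: h1 h2 rcm; clear; lra.
Qed.

Lemma regularizer_row_estimate (n r : nat) (X U : 'M[R]_(n, r)) (i : 'I_n)
    (m alpha rho lambda : R) (c := frob2 (row i (X - U))) :
  frob2 (row i U) <= m ^+ 2 -> 0 < m ->
  100 * m <= alpha -> alpha <= 200 * m -> 0 <= rho ->
  100 * rho <= lambda -> lambda <= 200 * rho ->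
  10 * rho * c ^+ 2 + lambda * regularizer_curvature alpha X (X - U) i
   <= Kr * rho * m ^+ 2 * c.
Proof.
move=> Um m0 al1 al2 r0 l1 l2.
pose q := \sum_k X i k * U i k.
have rowE (A : 'M[R]_(n, r)) : frob2 (row i A) = \sum_k A i k ^+ 2.
  by rewrite frob2_rV; apply: eq_bigr => k _; rewrite mxE.
have N2 : frobenius_norm (row i X) ^+ 2 = \sum_k X i k ^+ 2.
  by rewrite sqr_frobenius rowE.
have cE : c = frobenius_norm (row i X) ^+ 2 - 2 * q + frob2 (row i U).
  rewrite N2 /c !rowE /q mulr_sumr -sumrB -big_split; apply: eq_bigr => k _ /=.
  by rewrite !mxE; ring.
have dE : row_dot X (X - U) i = (frobenius_norm (row i X) ^+ 2 - q) / frobenius_norm (row i X).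
  congr (_ / _); rewrite N2 /q -sumrB; apply: eq_bigr => k _.
  by rewrite !mxE; ring.
rewrite /regularizer_curvature dE -/c cE.
apply: curvature_estimate => //; first exact: frobenius_ge0.
by rewrite N2 rowE; exact: cauchy_schwarz_sum.
Qed.

End row_estimate.

(** * Landscape on a good sample *)

Section landscape.
Context {R : realType} {n r : nat}.
Implicit Types (X U D : 'M[R]_(n, r)) (A B H : 'M[R]_n).

Definition weighted_inner H A B : R := \sum_i \sum_j H i j * (A i j * B i j).

Lemma weighted_innerC H A B : weighted_inner H A B = weighted_inner H B A.
Proof. by apply: eq_bigr => i _; apply: eq_bigr => j _; rewrite [A i j * _]mulrC. Qed.

Lemma weighted_innerDl H A A' B :
  weighted_inner H (A + A') B = weighted_inner H A B + weighted_inner H A' B.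
Proof.
rewrite /weighted_inner -big_split; apply: eq_bigr => i _ /=; rewrite -big_split.
by apply: eq_bigr => j _ /=; rewrite mxE; ring.
Qed.

Lemma weighted_innerDr H A B B' :
  weighted_inner H A (B + B') = weighted_inner H A B + weighted_inner H A B'.
Proof. by rewrite weighted_innerC weighted_innerDl !(weighted_innerC H A). Qed.

Lemma weighted_inner_tr H A B : H^T = H ->
  weighted_inner H A^T B^T = weighted_inner H A B.
Proof.
move=> Hs; rewrite /weighted_inner exchange_big; apply: eq_bigr => i _.
by apply: eq_bigr => j _; rewrite !mxE -[in LHS]Hs mxE.
Qed.

Lemma mask_inner_split (W : {set 'I_n * 'I_n}) (p : R) A B :
  mask_inner W A B = p * weighted_inner (const_mx 1) A B +
    weighted_inner (indicator_mx R W - p *: const_mx 1) A B.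
Proof.
rewrite /mask_inner /weighted_inner mulr_sumr -big_split; apply: eq_bigr => i _ /=.
rewrite mulr_sumr -big_split; apply: eq_bigr => j _ /=.
by rewrite !mxE; ring.
Qed.

Lemma weighted_inner1 A : weighted_inner (const_mx 1) A A = frob2 A.
Proof.
by apply: eq_bigr => i _; apply: eq_bigr => j _; rewrite mxE mul1r expr2.
Qed.

Lemma frob2_rows (k : nat) (A : 'M[R]_(k, r)) : frob2 A = \sum_i frob2 (row i A).
Proof.
apply: eq_bigr => i _; rewrite frob2_rV.
by apply: eq_bigr => j _; rewrite mxE.
Qed.

Lemma mulmx_trE X D i j : (X *m D^T) i j = \sum_k X i k * D j k.
Proof. by rewrite mxE; apply: eq_bigr => k _; rewrite mxE. Qed.

Lemma spectral_norm_gram (a b c d : 'M[R]_(n, r)) H (S1 S2 : R) :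
  \sum_i frob2 (row i a) * frob2 (row i c) <= S1 ->
  \sum_i frob2 (row i b) * frob2 (row i d) <= S2 ->
  `|weighted_inner H (a *m b^T) (c *m d^T)| <= spectral_norm H / 2 * (S1 + S2).
Proof.
move=> h1 h2.
have sqE (e : 'M[R]_(n, r)) i : frob2 (row i e) = \sum_k e i k ^+ 2.
  by rewrite frob2_rV; apply: eq_bigr => k _; rewrite mxE.
apply: (@le_trans _ _ (spectral_norm H / 2 *
   (\sum_i frob2 (row i a) * frob2 (row i c) + \sum_i frob2 (row i b) * frob2 (row i d)))).
  under [X in _ <= _ * (X + _)]eq_bigr do rewrite !sqE.
  under [X in _ <= _ * (_ + X)]eq_bigr do rewrite !sqE.
  apply: le_trans (spectral_norm_rows H a b c d).
  rewrite le_eqVlt; apply/orP; left; apply/eqP; congr `|_|.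
  by apply: eq_bigr => i _; apply: eq_bigr => j _; rewrite !mulmx_trE.
by rewrite ler_wpM2l ?lerD// divr_ge0// spectral_norm_ge0.
Qed.

(** The deterministic core: randomness will enter only through the bound on rho and the bound on the
    quadratic forms given by the columns of H. *)
Lemma aligned_local_minimum (U X : 'M[R]_(n, r)) (W : {set 'I_n * 'I_n})
    (p sigma m alpha lambda : R)
    (H := indicator_mx R W - p *: const_mx 1) (rho := spectral_norm H) :
  (X^T *m U)^T = X^T *m U ->
  (forall y : 'rV[R]_r, 0 <= (y *m (X^T *m U) *m y^T) 0 0) ->
  (forall i j, ((i, j) \in W) = ((j, i) \in W)) ->
  0 < p -> 0 < m ->
  (forall i, frob2 (row i U) <= m ^+ 2) ->
  (forall y : 'cV[R]_r, sigma * frob2 y <= frob2 (U *m y)) ->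
  rho * m ^+ 2 <= 10 ^- 11 * p * sigma ->
  (forall (j : 'I_n) (y : 'cV[R]_r),
    `|\sum_i H i j * (U *m y) i 0 ^+ 2| <= 20^-1 * p * frob2 (U *m y)) ->
  100 * m <= alpha -> alpha <= 200 * m ->
  100 * rho <= lambda -> lambda <= 200 * rho ->
  local_minimum (objective (U *m U^T) W alpha lambda) X ->
  X *m X^T = U *m U^T.
Proof.
move=> Psym P0 Wsym p0 m0 Um sU rhom HU al1 al2 l1 l2 lm.
have r0 : 0 <= rho by exact: spectral_norm_ge0.
have l0 : 0 <= lambda by rewrite (le_trans _ l1)// mulr_ge0.
have a0 : 0 < alpha by rewrite (lt_le_trans _ al1)// mulr_gt0.
have Hs : H^T = H.
  by apply/matrixP => i j; rewrite !mxE Wsym.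
pose D := X - U; pose A := X *m X^T - U *m U^T; pose B := D *m D^T.
pose T := U *m D^T; pose L := T + T^T.
have [hS hB] := aligned_bounds Psym P0.
rewrite -/D -/A -/T -/B in hS hB.
have TT : T^T = D *m U^T by rewrite /T trmx_mul trmxK.
have BT : B^T = B by rewrite /B trmx_mul trmxK.
have EA : X *m D^T + D *m X^T = A + B.
  apply/matrixP => i j; rewrite /A /B /D !mxE -!sumrN -!big_split/=.
  by apply: eq_bigr => k _; rewrite !mxE; ring.
have AL : A = L + B.
  rewrite /L TT /T /A /B /D.
  apply/matrixP => i j; rewrite !mxE -!sumrN -!big_split/=.
  by apply: eq_bigr => k _; rewrite !mxE; ring.
have := local_minimum_curvature D a0 l0 lm.
rewrite -/A -/B EA.
set G := \sum_i _ => curv.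
have hG : 10 * rho * \sum_i frob2 (row i D) ^+ 2 + lambda * G <=
    2 * 10 ^+ 10 * (rho * m ^+ 2 * frob2 D).
  rewrite frob2_rows !mulr_sumr -big_split/=; apply: ler_sum => i _.
  have := regularizer_row_estimate X (Um i) m0 al1 al2 r0 l1 l2.
  by rewrite -/D !mulrA.
set s4 := \sum_i _ in hG.
have TE i j : T i j = (U *m (row j D)^T) i 0.
  by rewrite /T !mxE; apply: eq_bigr => k _; rewrite !mxE.
have ST : frob2 T = \sum_j frob2 (U *m (row j D)^T).
  rewrite {1}/frob2 exchange_big; apply: eq_bigr => j _.
  by rewrite frob2_cV; apply: eq_bigr => i _; rewrite TE.
have sD : sigma * frob2 D <= frob2 T.
  rewrite ST frob2_rows mulr_sumr; apply: ler_sum => j _.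
  by rewrite -(frob2_tr (row j D)); exact: sU.
have z : rho * m ^+ 2 * frob2 D <= 10 ^- 11 * p * frob2 T.
  apply: (le_trans (ler_wpM2r (frob2_ge0 _) rhom)).
  rewrite -[leLHS]mulrA; apply: (ler_wpM2l _ sD); apply: mulr_ge0; last exact: ltW.
  by rewrite invr_ge0 exprn_ge0.
have hTT : `|weighted_inner H T T| <= 20^-1 * p * frob2 T.
  rewrite ST mulr_sumr /weighted_inner exchange_big.
  apply: (le_trans (ler_norm_sum _ _ _)); apply: ler_sum => j _.
  apply: le_trans (HU j (row j D)^T); rewrite le_eqVlt; apply/orP; left.
  by apply/eqP; congr `|_|; apply: eq_bigr => i _; rewrite TE expr2.
have uD : \sum_i frob2 (row i U) * frob2 (row i D) <= m ^+ 2 * frob2 D.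
  by rewrite frob2_rows mulr_sumr; apply: ler_sum => i _; rewrite ler_wpM2r ?frob2_ge0 ?Um.
have Du : \sum_i frob2 (row i D) * frob2 (row i U) <= m ^+ 2 * frob2 D.
  by under eq_bigr do rewrite mulrC.
have DD : \sum_i frob2 (row i D) * frob2 (row i D) <= s4.
  by apply: ler_sum => i _; rewrite expr2.
have hTt := spectral_norm_gram H uD Du.
rewrite -/T -TT in hTt.
have hTB := spectral_norm_gram H uD DD.
have hBB := spectral_norm_gram H DD DD.
rewrite -/T -/B -/rho in hTB hBB hTt.
have mi (C E : 'M[R]_n) := mask_inner_split W p C E.
have AE : A = X *m X^T - U *m U^T by [].
clearbody A B T.
rewrite !mi !weighted_innerDl !weighted_innerDr -/H in curv.
rewrite !(weighted_innerC _ B A) !weighted_inner1 in curv.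
have HA : weighted_inner H A A = 2 * weighted_inner H T T +
   2 * weighted_inner H T T^T + 4 * weighted_inner H T B + weighted_inner H B B.
  rewrite AL /L !weighted_innerDl !weighted_innerDr.
  have -> : weighted_inner H T^T T^T = weighted_inner H T T by exact: weighted_inner_tr.
  have -> : weighted_inner H T^T B = weighted_inner H T B.
    by rewrite -{1}BT weighted_inner_tr.
  have -> : weighted_inner H B T^T = weighted_inner H T B.
    by rewrite weighted_innerC -{1}BT weighted_inner_tr.
  by rewrite (weighted_innerC H B T) (weighted_innerC H T^T T); ring.
have fA : frob2 A = 0.
  apply: le_anti; rewrite frob2_ge0 andbT.
  have := frob2_ge0 A.
  move: curv hG z hTT hTt hTB hBB hS hB p0; rewrite HA !ler_norml.
  set wTT := weighted_inner H T T; set wTt := weighted_inner H T T^T.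
  set wTB := weighted_inner H T B; set wBB := weighted_inner H B B.
  set wAB := weighted_inner H A B; set w1 := weighted_inner (const_mx 1) A B.
  set fa := frob2 A; set fb := frob2 B; set ft := frob2 T; set fd := frob2 D.
  have -> : rho / 2 * (m ^+ 2 * fd + m ^+ 2 * fd) = rho * m ^+ 2 * fd by field.
  have -> : rho / 2 * (m ^+ 2 * fd + s4) = 2^-1 * (rho * m ^+ 2 * fd) + 2^-1 * (rho * s4).
    by field.
  have -> : rho / 2 * (s4 + s4) = rho * s4 by field.
  have -> : 10 * rho * s4 = 10 * (rho * s4) by ring.
  set zz := rho * m ^+ 2 * fd; set rs := rho * s4; set lg := lambda * G.
  move=> curv hG z /andP[a1 a2] /andP[b1 b2] /andP[c1 c2] /andP[d1 d2] hS hB p0 fa0.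
  have pS : 2 * (p * ft) <= 3 * (p * fa).
    by rewrite mulrCA [leRHS]mulrCA ler_wpM2l// ltW.
  have pB : p * fb <= 2 * (p * fa) by rewrite mulrCA ler_wpM2l// ltW.
  suff : p * fa <= 0 by rewrite pmulr_rle0.
  have {}z : zz <= 10 ^- 11 * (p * ft) by rewrite mulrA.
  have {}a1 : - (20^-1 * (p * ft)) <= wTT by rewrite mulrA.
  have e0 : 0 <= 3 * (p * fa) - 2 * (p * ft) by lra.
  (* The deviations cost (6 / 20) p |T|^2, 12 zz and 8 rs; the regularizer returns 10 rs for 2 *
     10^10 zz. As zz <= 10^-11 p |T|^2, the total error is about p |T|^2 / 2 <= (3 / 4) p |A|^2,
     below the gain p |A|^2. The bounds [d1] and [d2] together also give rs >= 0. *)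
  move: curv hG z a1 b1 c1 d2 d1 pS pB; clear; rewrite !(mulrDr p).
  set q1 := p * fa; set q2 := p * fb; set q3 := p * ft; set q4 := p * w1.
  lra.
by apply/eqP; rewrite -subr_eq0 -AE (frob2_eq0 fA).
Qed.

End landscape.

(** * Removal of the alignment hypothesis *)

Section rotation.
Context {R : realType}.

Lemma frob2_mulmx_orthogonal (k r : nat) (A : 'M[R]_(k, r)) (Q : 'M[R]_r) :
  Q *m Q^T = 1%:M -> frob2 (A *m Q) = frob2 A.
Proof. by move=> QQ; rewrite !frob2_trace trmx_mul mulmxA -(mulmxA A) QQ mulmx1. Qed.

(** U may be replaced by U Q with Q from the polar decomposition of X^T U, since the Gram matrix and
    all hypotheses on U are invariant under rotation. *)
Lemma local_minimum_exact (n r : nat) (U X : 'M[R]_(n, r)) (W : {set 'I_n * 'I_n})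
    (p sigma m alpha lambda : R)
    (H := indicator_mx R W - p *: const_mx 1) (rho := spectral_norm H) :
  (forall i j, ((i, j) \in W) = ((j, i) \in W)) ->
  0 < p -> 0 < m ->
  (forall i, frob2 (row i U) <= m ^+ 2) ->
  (forall y : 'cV[R]_r, sigma * frob2 y <= frob2 (U *m y)) ->
  rho * m ^+ 2 <= 10 ^- 11 * p * sigma ->
  (forall (j : 'I_n) (y : 'cV[R]_r),
    `|\sum_i H i j * (U *m y) i 0 ^+ 2| <= 20^-1 * p * frob2 (U *m y)) ->
  100 * m <= alpha -> alpha <= 200 * m ->
  100 * rho <= lambda -> lambda <= 200 * rho ->
  local_minimum (objective (U *m U^T) W alpha lambda) X ->
  X *m X^T = U *m U^T.
Proof.
move=> Wsym p0 m0 Um sU rhom HU al1 al2 l1 l2 lm.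
have [Q [QtQ Qs Qp]] := polar_decomposition (X^T *m U).
have QQt : Q *m Q^T = 1%:M by exact: mulmx1C.
have UE : U *m U^T = (U *m Q) *m (U *m Q)^T.
  by rewrite trmx_mul mulmxA -(mulmxA U) QQt mulmx1.
rewrite UE; rewrite UE in lm; rewrite -mulmxA in Qs Qp.
apply: (@aligned_local_minimum R n r (U *m Q) X W p sigma m alpha lambda) => //.
- by move=> i; rewrite row_mul frob2_mulmx_orthogonal.
- move=> y; rewrite -mulmxA; apply: le_trans (sU (Q *m y)).
  by rewrite -[frob2 (Q *m y)]frob2_tr trmx_mul frob2_mulmx_orthogonal ?trmxK// frob2_tr.
- by move=> j y; rewrite -mulmxA; exact: HU.
Qed.

End rotation.

(** * Closed walks and trace moments *)

Section walk_shapes.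
Local Close Scope classical_set_scope.
Context {L : nat}.
Local Notation time := 'I_L.+1.
Local Notation src := (widen_ord (leqnSn L)).
Local Notation tgt := (lift (@ord0 L)).

(** An undirected edge is represented above the diagonal, where the independent entries live. *)
Definition edge_key {n} (i j : 'I_n) : 'I_n * 'I_n := if (i < j)%N then (i, j) else (j, i).

Lemma edge_keyC n (i j : 'I_n) : edge_key i j = edge_key j i.
Proof.
rewrite /edge_key; case: ltngtP => // h.
by rewrite (ord_inj h).
Qed.

Lemma edge_key_eq n (a b c d : 'I_n) :
  (edge_key a b == edge_key c d) =
  ((a == c) && (b == d)) || ((a == d) && (b == c)).
Proof.
rewrite /edge_key; case: ltnP => ab; case: ltnP => cd;
  rewrite xpair_eqE -!val_eqE /=; lia.
Qed.

Definition step_edge {n} (w : {ffun time -> 'I_n}) (t : 'I_L) : 'I_n * 'I_n :=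
  edge_key (w (src t)) (w (tgt t)).

Definition closed_walk {n} (w : {ffun time -> 'I_n}) : bool := w ord0 == w ord_max.

(* The walks along which a product of centered independent entries may have a
   nonzero expectation: no loops, and no edge is used only once. *)
Definition paired_walk {n} (w : {ffun time -> 'I_n}) : bool :=
  [forall t, w (src t) != w (tgt t)] &&
  [forall t, exists t', (t' != t) && (step_edge w t' == step_edge w t)].

Definition visited {n} (w : {ffun time -> 'I_n}) : nat := #|w @: [set: time]|.

(** The walk up to relabelling of its vertices: [pick] depends only on the set of times at the same
    vertex, so walks with the same coincidences get the same shape. The default is never taken. *)
Definition walk_shape {n} (w : {ffun time -> 'I_n}) : {ffun time -> time} :=
  [ffun a => odflt a [pick b | w b == w a]].

Lemma walk_shapeE n (w : {ffun time -> 'I_n}) a : w (walk_shape w a) = w a.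
Proof. by rewrite ffunE; case: pickP => [b /eqP//|]. Qed.

Lemma walk_shape_eq n (w : {ffun time -> 'I_n}) a b :
  (walk_shape w a == walk_shape w b) = (w a == w b).
Proof.
apply/eqP/eqP => [h|h]; first by rewrite -(walk_shapeE w a) h walk_shapeE.
rewrite !ffunE; under [in RHS]eq_pick do rewrite -h.
by case: pickP => [//|/(_ a)]; rewrite eqxx.
Qed.

Lemma walk_shape_kernel n m (w : {ffun time -> 'I_n}) (w' : {ffun time -> 'I_m}) :
  (forall a b, (w a == w b) = (w' a == w' b)) -> walk_shape w = walk_shape w'.
Proof.
move=> h; apply/ffunP => a; rewrite !ffunE; congr odflt.
by apply: eq_pick => b /=; rewrite h.
Qed.

Lemma walk_shapeK n (w : {ffun time -> 'I_n}) : walk_shape (walk_shape w) = walk_shape w.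
Proof. exact/walk_shape_kernel/walk_shape_eq. Qed.

Lemma closed_walk_shape n (w : {ffun time -> 'I_n}) :
  closed_walk (walk_shape w) = closed_walk w.
Proof. exact: walk_shape_eq. Qed.

Lemma paired_walk_shape n (w : {ffun time -> 'I_n}) :
  paired_walk (walk_shape w) = paired_walk w.
Proof.
rewrite /paired_walk; congr (_ && _).
  by apply: eq_forallb => t; rewrite walk_shape_eq.
apply: eq_forallb => t; apply: eq_existsb => t'; congr (_ && _).
by rewrite /step_edge !edge_key_eq !walk_shape_eq.
Qed.

Lemma visited_shape n (w : {ffun time -> 'I_n}) : visited (walk_shape w) = visited w.
Proof.
rewrite /visited; have -> : w @: [set: time] = w @: (walk_shape w @: [set: time]).
  apply/setP => x; apply/imsetP/imsetP => [[a _ ->]|[_ /imsetP[a _ ->] ->]].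
    by exists (walk_shape w a); rewrite ?walk_shapeE// imset_f ?inE.
  by exists a; rewrite ?inE ?walk_shapeE.
rewrite card_in_imset// => _ _ /imsetP[a _ ->] /imsetP[b _ ->].
by rewrite !walk_shapeE => /eqP; rewrite -walk_shape_eq => /eqP.
Qed.

(** A walk of shape c amounts to an injective choice of vertices for the classes, which are
    represented by the image of c. *)
Lemma card_walk_shape n (c : {ffun time -> time}) : walk_shape c = c ->
  #|[set w : {ffun time -> 'I_n} | walk_shape w == c]| = n ^_ (visited c).
Proof.
move=> cK; pose D := {x : time | x \in c @: [set: time]}.
have cin a : c a \in c @: [set: time] by rewrite imset_f ?inE.
pose Phi (g : {ffun D -> 'I_n}) : {ffun time -> 'I_n} := [ffun a => g (Sub (c a) (cin a))].
have cc a : c (c a) = c a by have := walk_shapeE c a; rewrite cK.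
have cval (x : D) : c (val x) = val x.
  by case/imsetP: (valP x) => a _ ->.
have Phi_inj : injective Phi.
  move=> g g' /ffunP gg; apply/ffunP => x; have := gg (val x); rewrite !ffunE.
  by rewrite (_ : Sub _ _ = x)//; apply: val_inj; rewrite SubK cval.
have -> : [set w : {ffun time -> 'I_n} | walk_shape w == c] =
    Phi @: [set g : {ffun D -> 'I_n} | injectiveb g].
  apply/setP => w; rewrite inE; apply/eqP/imsetP => [wc|[g]].
    exists [ffun x => w (val x)].
      rewrite inE; apply/injectiveP => x y; rewrite !ffunE => /eqP.
      by rewrite -walk_shape_eq wc !cval => /eqP /val_inj.
    by apply/ffunP => a; rewrite !ffunE SubK -[in RHS]wc walk_shapeE.
  rewrite inE => /injectiveP g_inj ->; rewrite -[RHS]cK.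
  apply: walk_shape_kernel => a b; rewrite !ffunE.
  by rewrite (inj_eq g_inj) -val_eqE !SubK.
rewrite card_imset// card_inj_ffuns card_ord; congr (_ ^_ _).
by rewrite card_sig.
Qed.

(** Walks indexed by [nat] allow induction on prefixes, which finite functions on the times do
    not. *)
Fixpoint visited_upto {n} (w : nat -> 'I_n) (l : nat) : {set 'I_n} :=
  if l is l'.+1 then w l |: visited_upto w l' else [set w 0%N].

Fixpoint edges_upto {n} (w : nat -> 'I_n) (l : nat) : {set 'I_n * 'I_n} :=
  if l is l'.+1 then edge_key (w l') (w l) |: edges_upto w l' else finset.set0.

Lemma mem_visited_upto n (w : nat -> 'I_n) l i : (i <= l)%N -> w i \in visited_upto w l.
Proof.
elim: l => [|l IH] il; first by rewrite (_ : i = 0%N) ?inE//; lia.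
rewrite /= in_setU1; case: (ltngtP i l.+1) il => // [il _|-> _]; last by rewrite eqxx.
by rewrite IH ?orbT.
Qed.

Lemma edges_upto_visited n (w : nat -> 'I_n) l e :
  e \in edges_upto w l -> (e.1 \in visited_upto w l) && (e.2 \in visited_upto w l).
Proof.
elim: l => [|l IH] /=; first by rewrite inE.
rewrite in_setU1 => /orP[/eqP->|/IH/andP[e1 e2]]; last by rewrite !in_setU1 e1 e2 !orbT.
have wl := mem_visited_upto w (leqnn l).
by rewrite /edge_key !in_setU1; case: ifP => _ /=; rewrite eqxx wl ?orbT.
Qed.

(** A step to a new vertex always uses a new edge. *)
Lemma visited_upto_edges n (w : nat -> 'I_n) l :
  (#|visited_upto w l| <= #|edges_upto w l|.+1)%N.
Proof.
elim: l => [|l IH] /=; first by rewrite cards1 cards0.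
rewrite !cardsU1; case: (boolP (w l.+1 \in _)) => wl /=.
  by rewrite add0n (leq_trans IH)// ltnS leq_addl.
rewrite (_ : (edge_key (w l) (w l.+1) \in edges_upto w l) = false) ?ltnS//.
apply/negbTE/negP => /edges_upto_visited; rewrite /edge_key.
by case: ifP => _ /=; rewrite (negbTE wl) ?andbF.
Qed.

Lemma visited_edges n (w : {ffun time -> 'I_n}) :
  (visited w <= #|step_edge w @: [set: 'I_L]|.+1)%N.
Proof.
pose v i := w (inord i).
have h1 : (visited w <= #|visited_upto v L|)%N.
  apply/subset_leq_card/fintype.subsetP => _ /imsetP[a _ ->].
  by have := @mem_visited_upto n v L a; rewrite /v inord_val; apply; rewrite -ltnS.
apply: (leq_trans h1); apply: (leq_trans (visited_upto_edges v L)).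
rewrite ltnS; apply/subset_leq_card/fintype.subsetP.
have : (L <= L)%N by [].
elim: {1 3}L => [|l IH] lL e /=; first by rewrite inE.
rewrite in_setU1 => /orP[/eqP->|]; last by apply: IH; exact: ltnW.
apply/imsetP; exists (Ordinal lL); rewrite ?inE// /step_edge /v; congr (edge_key (w _) (w _)).
  by apply: val_inj; rewrite /= inordK// ltnS ltnW.
by apply: val_inj; rewrite /= inordK.
Qed.

Definition edge_multiplicity {n} (w : {ffun time -> 'I_n}) (e : 'I_n * 'I_n) : nat :=
  #|[set t | step_edge w t == e]|.

Lemma sum_edge_multiplicity n (w : {ffun time -> 'I_n}) :
  (\sum_(e in step_edge w @: [set: 'I_L]) edge_multiplicity w e)%N = L.
Proof.
rewrite -[RHS]card_ord -sum1_card.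
rewrite (partition_big (step_edge w) [in step_edge w @: [set: 'I_L]])/=; last first.
  by move=> t _; rewrite imset_f ?inE.
by apply: eq_bigr => e _; rewrite /edge_multiplicity -sum1dep_card.
Qed.

(** Each edge is used at least twice, so there are at most L / 2 edges, and a connected graph has at
    most one more vertex than edges. *)
Lemma paired_visited n (w : {ffun time -> 'I_n}) :
  paired_walk w -> (visited w <= L./2.+1)%N.
Proof.
move=> /andP[_ /forallP pw]; apply: (leq_trans (visited_edges w)).
rewrite ltnS geq_half_double -[leqRHS](sum_edge_multiplicity w) -muln2 -sum_nat_const.
apply: leq_sum => _ /imsetP[t _ ->].
have /existsP[t' /andP[tt' /eqP e]] := pw t.
have -> : 2%N = #|[set t; t']| by rewrite cards2 eq_sym tt'.
apply/subset_leq_card/fintype.subsetP => s.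
by rewrite !inE => /orP[] /eqP->; rewrite ?e.
Qed.

End walk_shapes.

(** * Expectation over independent bits *)

Section bernoulli_product.
Context {R : realType} {I : finType}.
Variable q : R.
Hypothesis q01 : 0 <= q <= 1.
Implicit Types F G : {ffun I -> bool} -> R.

(** A finite sum, so that all estimates stay free of measure theory until [offdiag_probability]
    identifies the law of the sample. *)
Definition bern_exp F : R :=
  \sum_(f : {ffun I -> bool}) (\prod_i (if f i then q else 1 - q)) * F f.

Lemma bern_exp_prod (g : I -> bool -> R) :
  bern_exp (fun f => \prod_i g i (f i)) =
  \prod_i (q * g i true + (1 - q) * g i false).
Proof.
transitivity (\prod_i \sum_(b : bool) (if b then q else 1 - q) * g i b).
  rewrite bigA_distr_bigA; apply: eq_bigr => f _; rewrite -big_split.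
  by apply: eq_bigr.
by apply: eq_bigr => i _; rewrite big_bool.
Qed.

Lemma bern_weight_ge0 (f : {ffun I -> bool}) :
  0 <= \prod_i (if f i then q else 1 - q).
Proof.
apply: prodr_ge0 => i _; case: (f i); case/andP: q01 => // _.
by rewrite subr_ge0.
Qed.

Lemma ler_bern_exp F G : (forall f, F f <= G f) -> bern_exp F <= bern_exp G.
Proof.
by move=> FG; apply: ler_sum => f _; rewrite ler_wpM2l// bern_weight_ge0.
Qed.

Lemma eq_bern_exp F G : F =1 G -> bern_exp F = bern_exp G.
Proof. by move=> FG; apply: eq_bigr => f _; rewrite FG. Qed.

Lemma bern_exp_sum (J : Type) (r : seq J) (P : pred J)
    (F : J -> {ffun I -> bool} -> R) :
  bern_exp (fun f => \sum_(j <- r | P j) F j f) = \sum_(j <- r | P j) bern_exp (F j).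
Proof.
rewrite /bern_exp exchange_big; apply: eq_bigr => f _; exact: mulr_sumr.
Qed.

Lemma bern_expZ (c : R) F : bern_exp (fun f => c * F f) = c * bern_exp F.
Proof. by rewrite /bern_exp mulr_sumr; apply: eq_bigr => f _; rewrite mulrCA. Qed.

Lemma bern_expD F G :
  bern_exp (fun f => F f + G f) = bern_exp F + bern_exp G.
Proof. by rewrite /bern_exp -big_split; apply: eq_bigr => f _; rewrite mulrDr. Qed.

Lemma bern_exp_cst (c : R) : bern_exp (fun=> c) = c.
Proof.
have h : bern_exp (fun=> 1) = 1.
  rewrite (eq_bern_exp (G := fun f => \prod_i (fun _ _ => 1) i (f i))).
    apply: etrans (bern_exp_prod (fun _ _ => 1)) _.
    by rewrite big1// => i _; rewrite !mulr1 addrC subrK.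
  by move=> f; rewrite big1.
rewrite -[RHS]mulr1 -h -bern_expZ; apply: eq_bern_exp => f.
by rewrite mulr1.
Qed.

Lemma bern_markov F (t : R) (B : pred {ffun I -> bool}) :
  0 < t -> (forall f, 0 <= F f) -> (forall f, B f -> t <= F f) ->
  bern_exp (fun f => (B f)%:R) <= bern_exp F / t.
Proof.
move=> t0 F0 BF; rewrite ler_pdivlMr// mulrC -bern_expZ; apply: ler_bern_exp => f.
by case: (boolP (B f)) => Bf; rewrite ?mulr1 ?mulr0 ?BF.
Qed.

End bernoulli_product.

(** * Symmetric matrices with independent entries *)

Section wigner.
Context {R : realType}.
Implicit Types h : bool -> R.

(** The bits are indexed by all pairs, but only those above the diagonal are read. *)
Definition wigner_mx h {n : nat} (f : {ffun 'I_n * 'I_n -> bool}) : 'M[R]_n :=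
  \matrix_(i, j) if i == j then 0 else h (f (edge_key i j)).

Lemma wigner_mx_sym h n f : (@wigner_mx h n f)^T = wigner_mx h f.
Proof. by apply/matrixP => i j; rewrite !mxE eq_sym edge_keyC. Qed.

Definition bern_moment (q : R) h (m : nat) : R :=
  q * h true ^+ m + (1 - q) * h false ^+ m.

(** Grouping the steps by edge turns the expectation into one moment per edge; a loop meets the zero
    diagonal. *)
Lemma bern_exp_walk (q : R) h n L (w : {ffun 'I_L.+1 -> 'I_n}) :
  bern_exp q (fun f => \prod_(t < L)
     wigner_mx h f (w (widen_ord (leqnSn L) t)) (w (lift ord0 t))) =
  ([forall t, w (widen_ord (leqnSn L) t) != w (lift ord0 t)])%:R *
  \prod_e bern_moment q h (edge_multiplicity w e).
Proof.
case: forallP => [noloop|loop]; rewrite ?mul1r ?mul0r; last first.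
  have [t wt] : exists t, w (widen_ord (leqnSn L) t) == w (lift ord0 t).
    apply/existsP; apply: contra_notT loop => /existsPn nt t; exact: nt.
  rewrite (@eq_bern_exp _ _ _ _ (fun=> 0)) ?bern_exp_cst// => f.
  by rewrite (bigD1 t)//= mxE wt mul0r.
rewrite -(bern_exp_prod q (fun e b => h b ^+ edge_multiplicity w e)).
apply: eq_bern_exp => f.
rewrite (partition_big (step_edge w) xpredT)//=; apply: eq_bigr => e _.
rewrite (eq_bigr (fun=> h (f e))) => [|t /eqP te].
  rewrite prodr_const /edge_multiplicity; congr (_ ^+ _).
  by apply: eq_card => t; rewrite inE.
by rewrite mxE (negbTE (noloop t)) -te.
Qed.

End wigner.

(** * Matrix powers as sums over walks *)

Section trace_walks.
Context {R : realType}.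

Definition ffun_cons {T : finType} {l : nat} (x : T) (w : {ffun 'I_l -> T}) :
  {ffun 'I_l.+1 -> T} := [ffun i => oapp w x (unlift ord0 i)].

Lemma ffun_cons0 (T : finType) l (x : T) (w : {ffun 'I_l -> T}) :
  ffun_cons x w ord0 = x.
Proof. by rewrite ffunE unlift_none. Qed.

Lemma ffun_consS (T : finType) l (x : T) (w : {ffun 'I_l -> T}) i :
  ffun_cons x w (lift ord0 i) = w i.
Proof. by rewrite ffunE liftK. Qed.

Lemma big_ffun_cons (T : finType) l (F : {ffun 'I_l.+1 -> T} -> R) :
  \sum_w F w = \sum_x \sum_(w : {ffun 'I_l -> T}) F (ffun_cons x w).
Proof.
rewrite pair_big/=.
rewrite (reindex (fun xw : T * {ffun 'I_l -> T} => ffun_cons xw.1 xw.2))//.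
exists (fun w : {ffun 'I_l.+1 -> T} =>
    (w ord0, [ffun i => w (lift ord0 i)] : {ffun 'I_l -> T})) => /= [[x w] _|w _].
  by rewrite ffun_cons0; congr pair; apply/ffunP => i; rewrite !ffunE liftK.
apply/ffunP => i; rewrite ffunE; case: unliftP => [j ->|->] //=.
by rewrite ffunE.
Qed.

Definition walk_weight {n} (A : 'M[R]_n) {L} (w : {ffun 'I_L.+1 -> 'I_n}) : R :=
  \prod_(t < L) A (w (widen_ord (leqnSn L) t)) (w (lift ord0 t)).

Lemma walk_weight_cons n (A : 'M[R]_n) L x (w : {ffun 'I_L.+1 -> 'I_n}) :
  walk_weight A (ffun_cons x w) = A x (w ord0) * walk_weight A w.
Proof.
rewrite /walk_weight big_ord_recl; congr (A _ _ * _).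
- by rewrite (_ : widen_ord _ _ = ord0) ?ffun_cons0//; exact: val_inj.
- by rewrite ffun_consS.
apply: eq_bigr => t _; rewrite ffun_consS; congr (A _ _).
rewrite (_ : widen_ord _ _ = lift ord0 (widen_ord (leqnSn L) t)) ?ffun_consS//.
exact: val_inj.
Qed.

Lemma expmx_walks n (A : 'M[R]_n) L i j :
  (A ^+ L) i j = \sum_(w : {ffun 'I_L.+1 -> 'I_n})
    (w ord0 == i)%:R * (w ord_max == j)%:R * walk_weight A w.
Proof.
elim: L i j => [|L IH] i j.
  rewrite expr0 mxE big_ffun_cons [RHS](bigD1 i)//= [X in _ = _ + X]big1 ?addr0.
    rewrite (eq_bigr (fun=> (i == j)%:R)) => [|w _].
      rewrite sumr_const (_ : #|_| = 1%N) ?mulr1n//.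
      by rewrite card_ffun !card_ord.
    rewrite /walk_weight big_ord0 mulr1 (_ : ord_max = ord0); last exact: val_inj.
    by rewrite ffun_cons0 eqxx mul1r.
  by move=> k ki; rewrite big1// => w _; rewrite ffun_cons0 (negbTE ki) !mul0r.
rewrite exprS -mulmxE mxE [RHS]big_ffun_cons [RHS](bigD1 i)//= [X in _ = _ + X]big1 ?addr0.
  rewrite (eq_bigr (fun k => \sum_(w : {ffun 'I_L.+1 -> 'I_n}) A i k *
    ((w ord0 == k)%:R * (w ord_max == j)%:R * walk_weight A w))) => [|k _]; last first.
    by rewrite IH mulr_sumr.
  rewrite exchange_big; apply: eq_bigr => w _ /=.
  rewrite walk_weight_cons ffun_cons0 eqxx mul1r.
  rewrite (_ : ord_max = lift ord0 ord_max) ?ffun_consS; last exact: val_inj.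
  rewrite (bigD1 (w ord0))//= eqxx mul1r big1 ?addr0; first by ring.
  by move=> k kw; rewrite eq_sym (negbTE kw) !mul0r mulr0.
by move=> k ki; rewrite big1// => w _; rewrite ffun_cons0 (negbTE ki) !mul0r.
Qed.

Lemma trmx_exp_sym n (A : 'M[R]_n) k : A^T = A -> (A ^+ k)^T = A ^+ k.
Proof.
move=> As; elim: k => [|k IH]; first by rewrite !expr0 trmx1.
by rewrite {1}exprS -mulmxE trmx_mul IH As mulmxE -exprSr.
Qed.

(** For symmetric A this is the trace of A^(2k); as a squared norm it will control the spectral norm
    without any eigenvalues. *)
Lemma frob2_exp_walks n (A : 'M[R]_n) k : A^T = A ->
  frob2 (A ^+ k) = \sum_(w : {ffun 'I_(k + k).+1 -> 'I_n} | closed_walk w)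
    walk_weight A w.
Proof.
move=> As; rewrite frob2_trace trmx_exp_sym// mulmxE -exprD.
rewrite /mxtrace; under eq_bigr do rewrite expmx_walks.
rewrite exchange_big [RHS]big_mkcond; apply: eq_bigr => w _ /=.
rewrite (bigD1 (w ord0))//= eqxx mul1r big1 ?addr0; last first.
  by move=> i iw; rewrite eq_sym (negbTE iw) !mul0r.
by rewrite /closed_walk eq_sym; case: ifP => _; rewrite ?mul1r ?mul0r.
Qed.

End trace_walks.

(** * Comparison of trace moments *)

Section moment_comparison.
Context {R : realType}.

Definition centered_bern (p : R) (b : bool) : R := b%:R - p.

(* A centered two-point law all of whose other moments are at least one. *)
Definition dominating_law (b : bool) : R := if b then 2 else - 2^-1.

Lemma centered_moment0 (p : R) : bern_moment p (centered_bern p) 0 = 1.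
Proof. by rewrite /bern_moment !expr0; ring. Qed.

Lemma centered_moment1 (p : R) : bern_moment p (centered_bern p) 1 = 0.
Proof. by rewrite /bern_moment /centered_bern /= !expr1; ring. Qed.

Lemma centered_moment_le (p : R) m : 0 <= p <= 1 -> (2 <= m)%N ->
  `|bern_moment p (centered_bern p) m| <= p.
Proof.
move=> /andP[p0 p1]; case: m => [//|[//|m]] _.
rewrite /bern_moment /centered_bern/= sub0r.
apply: (le_trans (ler_normD _ _)).
rewrite normrM [X in _ + X]normrM !normrX normrN.
rewrite (ger0_norm p0) !ger0_norm ?subr_ge0//.
have a1 : (1 - p) ^+ m.+2 <= 1 - p.
  by rewrite exprS ler_piMr ?subr_ge0// exprn_ile1 ?subr_ge0// gerBl.
have a2 : p ^+ m.+2 <= p ^+ 2.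
  by rewrite -addn2 exprD ler_piMl ?sqr_ge0// exprn_ile1.
have b1 := ler_wpM2l p0 a1.
have b2 : (1 - p) * p ^+ m.+2 <= (1 - p) * p ^+ 2 by rewrite ler_wpM2l// subr_ge0.
have : 0 <= p * (p * p) by rewrite !mulr_ge0.
lra.
Qed.

Lemma dominating_moment1 : bern_moment 5^-1 dominating_law 1 = 0.
Proof. by rewrite /bern_moment /dominating_law !expr1; field. Qed.

Lemma dominating_moment_ge m : m != 1%N -> 1 <= bern_moment 5^-1 dominating_law m.
Proof.
case: m => [_|[//|[_|m _]]].
- by rewrite /bern_moment !expr0; lra.
- by rewrite /bern_moment /dominating_law; lra.
rewrite /bern_moment /dominating_law.
have h1 : (2 : R) ^+ 3 <= 2 ^+ m.+3 by rewrite ler_eXn2l// ltr1n.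
have h2 : - (2^-1) ^+ 2 <= (- 2^-1) ^+ m.+3 :> R.
  rewrite lerNl (le_trans (ler_norm _))// normrN normrX normrN.
  rewrite ger0_norm ?invr_ge0// -(addn2 m.+1) exprD ler_piMl ?sqr_ge0//.
  by rewrite exprn_ile1// invf_le1// ler1n.
lra.
Qed.

Lemma paired_walk_multiplicity n L (w : {ffun 'I_L.+1 -> 'I_n}) :
  paired_walk w -> forall e, edge_multiplicity w e != 1%N.
Proof.
move=> /andP[_ /forallP pw] e; apply/negP => /cards1P[t te].
have : t \in [set t | step_edge w t == e]%SET by rewrite te inE.
rewrite inE => /eqP et; have /existsP[t' /andP[tt' /eqP e']] := pw t.
have : t' \in [set t | step_edge w t == e]%SET by rewrite inE e' et.
by rewrite te inE (negbTE tt').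
Qed.

Lemma unpaired_walk n L (w : {ffun 'I_L.+1 -> 'I_n}) :
  ~~ paired_walk w ->
  ~~ [forall t, w (widen_ord (leqnSn L) t) != w (lift ord0 t)] \/
  exists e, edge_multiplicity w e = 1%N.
Proof.
rewrite negb_and => /orP[->|/forallPn[t /existsPn ht]]; [by left|right].
exists (step_edge w t); apply/eqP/cards1P; exists t; apply/setP => s.
rewrite !inE; apply/idP/eqP => [st|->//].
by apply/eqP; apply: contraT => nst; have := ht s; rewrite nst st.
Qed.

Lemma bern_exp_unpaired (q : R) h n L (w : {ffun 'I_L.+1 -> 'I_n}) :
  bern_moment q h 1 = 0 -> ~~ paired_walk w ->
  bern_exp q (fun f => walk_weight (wigner_mx h f) w) = 0.
Proof.
move=> h1 /unpaired_walk nw; rewrite bern_exp_walk.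
case: nw => [/negbTE->|[e e1]]; first by rewrite mul0r.
by rewrite (bigD1 e)//= e1 h1 mul0r mulr0.
Qed.

(** Each edge used contributes at most p, and there are at least [visited w - 1] edges. *)
Lemma centered_walk_le (p : R) n L (w : {ffun 'I_L.+1 -> 'I_n}) :
  0 <= p <= 1 -> paired_walk w ->
  bern_exp p (fun f => walk_weight (wigner_mx (centered_bern p) f) w) <=
    p ^+ (visited w).-1.
Proof.
move=> p01 pw; have /andP[p0 p1] := p01; rewrite bern_exp_walk.
have /andP[-> _] := pw; rewrite mul1r.
apply: (le_trans (ler_norm _)); rewrite normr_prod.
apply: (@le_trans _ _ (\prod_(e in step_edge w @: [set: 'I_L]%SET) p)).
  rewrite [leRHS]big_mkcond; apply: ler_prod => e _; rewrite normr_ge0/=.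
  case: ifPn => ew.
    apply: centered_moment_le => //.
    have := paired_walk_multiplicity pw e; case/imsetP: ew => t _ et.
    have : (0 < edge_multiplicity w e)%N.
      by rewrite card_gt0; apply/set0Pn; exists t; rewrite inE et.
    by case: (edge_multiplicity w e) => [|[]].
  rewrite (_ : edge_multiplicity w e = 0%N) ?centered_moment0 ?normr1//.
  apply/eqP; rewrite cards_eq0; apply/eqP/setP => t; rewrite !inE.
  by apply: contraNF ew => /eqP <-; rewrite imset_f ?inE.
rewrite prodr_const; apply: ler_wiXn2l => //.
by have := visited_edges w; case: (visited w).
Qed.

(** All moments that occur along a paired walk are at least one, so the trace moment of the
    comparison matrix dominates the number of closed paired walks. *)
Lemma dominating_walk_ge n L (w : {ffun 'I_L.+1 -> 'I_n}) :
  (paired_walk w)%:R <=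
    bern_exp 5^-1 (fun f => walk_weight (wigner_mx dominating_law f) w).
Proof.
case: (boolP (paired_walk w)) => pw; last first.
  by rewrite bern_exp_unpaired// dominating_moment1.
rewrite bern_exp_walk; have /andP[-> _] := pw; rewrite mul1r.
have -> : true%:R = \prod_(e : 'I_n * 'I_n) (1 : R) by rewrite big1_eq.
apply: ler_prod => e _; rewrite ler01 dominating_moment_ge//.
exact: paired_walk_multiplicity.
Qed.

Lemma visited_gt0 n L (w : {ffun 'I_L.+1 -> 'I_n}) : (0 < visited w)%N.
Proof. by rewrite card_gt0; apply/set0Pn; exists (w ord0); rewrite imset_f ?inE. Qed.

(** After the leading factor m + k come v - 1 <= k factors, each at least m. *)
Lemma ffact_ge (k v m : nat) : (0 < v)%N -> (v <= k.+1)%N ->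
  ((m + k) * m ^ v.-1 <= (m + k) ^_ v)%N.
Proof.
case: v => // v _; rewrite ltnS /= => vk.
rewrite ffactnS leq_mul2l; apply/orP; right.
elim: v vk => [//|v IH] vk; rewrite expnS ffactnSr mulnC leq_mul//; first by apply: IH; exact: ltnW.
lia.
Qed.

Lemma leq_ffact_exp (n m : nat) : (n ^_ m <= n ^ m)%N.
Proof.
elim: m => [//|m IH]; rewrite ffactnSr expnSr leq_mul// leq_subr//.
Qed.

(* A shape with [v] vertices is realized by [n ^_ v] walks of weight at most
   [p ^ (v - 1)], and [v <= k + 1]; since [np + k <= 2k], this total is at most
   [n k ^ (v - 1) <= n / (2k) * (2k) ^_ v]. *)
Lemma moment_comparison (p : R) (n k : nat) : 0 <= p <= 1 -> (0 < k)%N ->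
  n%:R * p <= k%:R ->
  bern_exp p (fun f => frob2 (wigner_mx (centered_bern p) f ^+ k : 'M[R]_n)) <=
  n%:R / (k + k)%:R * bern_exp 5^-1 (fun f =>
    frob2 (wigner_mx dominating_law f ^+ k : 'M[R]_(k + k))).
Proof.
move=> p01 k0 npk; have /andP[p0 p1] := p01.
have k2 : 0 < (k + k)%:R :> R by rewrite ltr0n; lia.
under eq_bern_exp do rewrite frob2_exp_walks ?wigner_mx_sym//.
under [in leRHS]eq_bern_exp do rewrite frob2_exp_walks ?wigner_mx_sym//.
rewrite !bern_exp_sum.
pose T := {ffun 'I_(k + k).+1 -> 'I_(k + k).+1}.
pose good (c : T) := closed_walk c && paired_walk c.
apply: (@le_trans _ _ (\sum_(w : {ffun 'I_(k + k).+1 -> 'I_n})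
   (good (walk_shape w))%:R * p ^+ (visited (walk_shape w)).-1)).
  rewrite big_mkcond; apply: ler_sum => w _.
  rewrite /good closed_walk_shape paired_walk_shape visited_shape.
  case: closed_walk => /=; last by rewrite mul0r.
  case: (boolP (paired_walk w)) => pw; first by rewrite mul1r centered_walk_le.
  by rewrite bern_exp_unpaired ?centered_moment1// mul0r.
apply: (@le_trans _ _ (n%:R / (k + k)%:R *
   \sum_(w : {ffun 'I_(k + k).+1 -> 'I_(k + k)}) (good (walk_shape w))%:R)); last first.
  rewrite ler_wpM2l ?divr_ge0 ?(ltW k2)// [leRHS]big_mkcond; apply: ler_sum => w _.
  rewrite /good closed_walk_shape paired_walk_shape.
  by case: closed_walk => //=; exact: dominating_walk_ge.
rewrite (partition_big (fun w => walk_shape w) xpredT)//=.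
rewrite [in leRHS](partition_big (fun w => walk_shape w) xpredT)//= mulr_sumr.
apply: ler_sum => c _.
rewrite (eq_bigr (fun=> (good c)%:R * p ^+ (visited c).-1)) => [|w /eqP->//].
rewrite [in leRHS](eq_bigr (fun=> (good c)%:R)) => [|w /eqP->//].
have sumc m (x : R) :
    \sum_(w : {ffun 'I_(k + k).+1 -> 'I_m} | walk_shape w == c) x =
    x *+ #|[set w : {ffun 'I_(k + k).+1 -> 'I_m} | walk_shape w == c]%SET|.
  by rewrite -sumr_const; apply: eq_bigl => w; rewrite inE.
rewrite !sumc.
case: (boolP (good c)) => gc; last by rewrite mul0r !mul0rn mulr0.
(* Only canonical labelings are shapes of walks; for the others both counts are zero. *)
have [cc|cc] := eqVneq (walk_shape c) c; last first.
  have e0 m : #|[set w : {ffun 'I_(k + k).+1 -> 'I_m} | walk_shape w == c]%SET| = 0%N.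
    apply/eqP; rewrite cards_eq0; apply/eqP/setP => w; rewrite !inE.
    by apply/negbTE; apply: contra cc => /eqP <-; rewrite walk_shapeK.
  by rewrite !e0 !mulr0n mulr0.
rewrite !card_walk_shape// mul1r -[leLHS]mulr_natr.
have /andP[_ pc] := gc.
have v0 := visited_gt0 c; have v1 := paired_visited pc.
have k2E : (k + k)./2 = k by rewrite addnn doubleK.
rewrite k2E in v1.
have h := ffact_ge k v0 v1.
set v := visited c in v0 v1 h *.
apply: (@le_trans _ _ (n%:R * k%:R ^+ v.-1)).
  apply: (@le_trans _ _ (n%:R * (n%:R * p) ^+ v.-1)); last first.
    by rewrite ler_wpM2l// lerXn2r ?nnegrE ?mulr_ge0.
  have -> : n%:R * (n%:R * p) ^+ v.-1 = p ^+ v.-1 * n%:R ^+ v.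
    by rewrite exprMn mulrA -exprS prednK// mulrC.
  rewrite ler_wpM2l ?exprn_ge0//.
  by rewrite -natrX ler_nat; exact: leq_ffact_exp.
rewrite -mulrA ler_wpM2l//.
rewrite mulrC ler_pdivlMr// mulrC -natrX -natrM ler_nat.
exact: h.
Qed.

End moment_comparison.

(** * Nets and exponential moments *)

Section exponential_bounds.
Context {R : realType}.

Lemma expR_le_quadratic (x : R) : x <= 2^-1 -> expR x <= 1 + x + 2 * x ^+ 2.
Proof.
move=> x2; have x1 : 0 < 1 - x by lra.
have h : expR x <= (1 - x)^-1.
  rewrite -[expR x]invrK -expRN lef_pV2 ?posrE ?expR_gt0//.
  exact: expR_ge1Dx.
apply: (le_trans h); rewrite -[(1 - x)^-1]mul1r ler_pdivrMr//.
have -> : (1 + x + 2 * x ^+ 2) * (1 - x) = 1 + x ^+ 2 * (1 - 2 * x) by ring.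
by rewrite lerDl mulr_ge0 ?sqr_ge0//; lra.
Qed.

(** The linear term disappears in the expectation of a centered variable, which leaves a
    sub-Gaussian bound valid for all x. *)
Lemma expR_le_gauss (x : R) : expR x <= x + expR (2 * x ^+ 2).
Proof.
have h := expR_ge1Dx (2 * x ^+ 2).
have [x1|x1] := leP x (- 2^-1).
  have : expR x <= 1 by rewrite -expR0 ler_expR; lra.
  have : 0 <= x * (1 + 2 * x) by rewrite mulr_le0//; lra.
  lra.
have [x2|x2] := leP x 2^-1; first by have := expR_le_quadratic x2; lra.
have : expR x <= expR (2 * x ^+ 2).
  rewrite ler_expR; have : 0 <= x * (2 * x - 1) by rewrite mulr_ge0//; lra.
  lra.
lra.
Qed.

(** The m-th power of x / m <= exp (x / m); it trades moments for exponential moments. *)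
Lemma exprn_le_expR (x : R) m : 0 <= x -> x ^+ m <= m%:R ^+ m * expR x.
Proof.
move=> x0; case: m => [|m]; first by rewrite !expr0 mul1r -expR0 ler_expR.
have m0 : 0 < m.+1%:R :> R by rewrite ltr0n.
rewrite -ler_pdivrMl ?exprn_gt0// mulrC -expr_div_n.
have -> : expR x = expR (x / m.+1%:R) ^+ m.+1.
  by rewrite -expRM_natl mulrCA divff ?mulr1// gt_eqF.
rewrite lerXn2r ?nnegrE ?divr_ge0 ?expR_ge0 ?(ltW m0)//.
by rewrite (le_trans _ (expR_ge1Dx _))// lerDr.
Qed.

End exponential_bounds.

(** * Nets of the Euclidean ball *)

Section nets.
Context {R : realType}.

(** A sign and an integer per coordinate, with mesh 1 / (4 sqrt m): rounding all coordinates moves a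
    vector by at most 1/4. *)
Definition grid_point {m : nat} (g : {ffun 'I_m -> 'I_(4 * m).+1 * bool}) : 'cV[R]_m :=
  \col_i ((-1) ^+ (g i).2 * (val (g i).1)%:R / (4 * Num.sqrt m%:R)).

Lemma geometric_half_le N : \sum_(a < N) (2^-1 : R) ^+ a <= 2.
Proof.
suff -> : \sum_(a < N) (2^-1 : R) ^+ a = 2 - 2 * 2^-1 ^+ N.
  by rewrite gerBl mulr_ge0// exprn_ge0// invr_ge0.
elim: N => [|N IH]; first by rewrite big_ord0 expr0; lra.
by rewrite big_ord_recr/= IH exprS; set y := _ ^+ N; field.
Qed.

(* Each grid point of l1-norm at most [4m] has weight at least one under the
   product of geometric weights [2 ^ (4 - a)]. *)
Lemma card_grid (m : nat) :
  (#|[set g : {ffun 'I_m -> 'I_(4 * m).+1 * bool} |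
       (\sum_i (g i).1 <= 4 * m)%N]%SET|%:R : R) <= 64 ^+ m.
Proof.
rewrite -sum1_card natr_sum.
apply: (@le_trans _ _ (\sum_(g : {ffun 'I_m -> 'I_(4 * m).+1 * bool})
   \prod_i (2 ^+ 4 * 2^-1 ^+ (g i).1 : R))).
  rewrite [leLHS]big_mkcond; apply: ler_sum => g _; rewrite inE.
  have p0 : 0 <= \prod_i (2 ^+ 4 * 2^-1 ^+ (g i).1 : R).
    by apply: prodr_ge0 => i _; rewrite mulr_ge0// exprn_ge0// invr_ge0.
  case: ifP => // gm; rewrite big_split/= prodr_const card_ord -exprM.
  rewrite -(big_morph (fun a : nat => 2^-1 ^+ a : R) (exprD _) (expr0 _)).
  rewrite exprVn -ler_pdivrMr ?invr_gt0 ?exprn_gt0// invrK mul1r.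
  by rewrite ler_weXn2l ?ler1n.
rewrite -(bigA_distr_bigA (fun (i : 'I_m) (ab : 'I_(4 * m).+1 * bool) =>
  2 ^+ 4 * 2^-1 ^+ ab.1 : R)) prodr_const card_ord.
apply: lerXn2r; rewrite ?nnegrE//.
  by apply: sumr_ge0 => i _; rewrite mulr_ge0// exprn_ge0// invr_ge0.
rewrite -(pair_bigA _ (fun (a : 'I_(4 * m).+1) (b : bool) => 2 ^+ 4 * 2^-1 ^+ a : R))/=.
under eq_bigr do rewrite sumr_const card_bool -mulrnAr.
(* Per coordinate: 16 from the weight, 2 from the sign and 2 from the geometric series, which makes
   64. *)
rewrite -mulr_sumr sumrMnl mulr2n; have := geometric_half_le (4 * m).+1; lra.
Qed.

(** Coordinates are rounded toward zero, which keeps the grid point in the ball; Cauchy-Schwarz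
    bounds its integers by 4m in total, the case counted by [card_grid]. *)
Lemma ball_net (m : nat) : exists s : seq 'cV[R]_m,
  [/\ (size s)%:R <= 64 ^+ m :> R,
      forall x, x \in s -> frob2 x <= 1 &
      forall x : 'cV[R]_m, frob2 x <= 1 ->
        exists2 y, y \in s & frob2 (x - y) <= 16^-1].
Proof.
case: m => [|m].
  exists [:: 0]; split => //=.
    by move=> x _; rewrite /frob2 big_ord0 ler01.
  move=> x _; exists 0; first by rewrite inE.
  by rewrite /frob2 big_ord0 invr_ge0.
set M := m.+1.
pose G := [set g : {ffun 'I_M -> 'I_(4 * M).+1 * bool} |
       (\sum_i (g i).1 <= 4 * M)%N && (frob2 (grid_point g) <= 1)]%SET.
exists [seq grid_point g | g <- enum G]; split.
- rewrite size_map -cardE; apply: le_trans (card_grid M).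
  rewrite ler_nat; apply/subset_leq_card/fintype.subsetP => g.
  by rewrite !inE => /andP[].
- by move=> x /mapP[g]; rewrite mem_enum inE => /andP[_ ?] ->.
move=> x x1.
have M0 : 0 < M%:R :> R by rewrite ltr0n.
have sM0 : 0 < Num.sqrt M%:R :> R by rewrite sqrtr_gt0.
pose c : R := 4 * Num.sqrt M%:R.
have c0 : 0 < c by rewrite mulr_gt0.
have xi1 i : `|x i 0| <= 1.
  rewrite -(@expr_le1 _ 2)// real_normK ?num_real// (le_trans _ x1)//.
  rewrite frob2_cV (bigD1 i)//= lerDl; apply: sumr_ge0 => k _; exact: sqr_ge0.
pose a i : nat := Num.truncn (c * `|x i 0|).
have ca0 i : 0 <= c * `|x i 0| by rewrite mulr_ge0// ltW.
have a1 i : (a i)%:R <= c * `|x i 0| by rewrite truncn_le.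
have a2 i : c * `|x i 0| < (a i)%:R + 1.
  by have := truncnS_gt (c * `|x i 0|); rewrite -natr1.
have sum1 : (\sum_i (a i) <= 4 * M)%N.
  rewrite -(ler_nat R) natr_sum (le_trans (ler_sum _ (fun i _ => a1 i)))//.
  rewrite -mulr_sumr natrM /c -mulrA ler_wpM2l//.
  have h : \sum_i `|x i 0| <= Num.sqrt M%:R.
    rewrite -(ler_pXn2r (n := 2))// ?nnegrE ?sumr_ge0// ?(ltW sM0)//.
    rewrite sqr_sqrtr ?ler0n//.
    have := cauchy_schwarz_sum (fun=> 1) (fun i : 'I_M => `|x i 0|).
    under eq_bigr do rewrite mul1r.
    under [X in _ <= _ * X]eq_bigr do rewrite real_normK ?num_real//.
    rewrite -frob2_cV expr1n sumr_const card_ord => /le_trans; apply.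
    by rewrite -[leRHS]mulr1 ler_wpM2l.
  rewrite (le_trans (ler_wpM2l (ltW sM0) h))// -expr2 sqr_sqrtr ?ler0n//.
have aM i : (a i < (4 * M).+1)%N.
  by rewrite ltnS (leq_trans _ sum1)// (bigD1 i)//= leq_addr.
pose g : {ffun 'I_M -> 'I_(4 * M).+1 * bool} := [ffun i => (Ordinal (aM i), x i 0 < 0)].
have gE i : grid_point g i 0 = (-1) ^+ (x i 0 < 0)%R * ((a i)%:R / c).
  by rewrite mxE ffunE/= mulrA.
have xE i : x i 0 = (-1) ^+ (x i 0 < 0)%R * `|x i 0| by rewrite -numEsign.
have sq1 (b : bool) (y : R) : ((-1) ^+ b * y) ^+ 2 = y ^+ 2.
  by rewrite exprMn -exprM mulnC exprM sqrrN expr1n expr1n mul1r.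
have gx i : (a i)%:R / c <= `|x i 0| by rewrite ler_pdivrMr// mulrC.
exists (grid_point g).
  apply/mapP; exists g => //; rewrite mem_enum inE; apply/andP; split.
    by under eq_bigr do rewrite ffunE.
  apply: le_trans x1; rewrite !frob2_cV; apply: ler_sum => i _.
  rewrite gE sq1 -[leRHS]real_normK ?num_real//.
  by rewrite ler_pXn2r ?nnegrE// divr_ge0// ltW.
rewrite frob2_cV; apply: (@le_trans _ _ (\sum_(i < M) (16 * M%:R)^-1)).
  apply: ler_sum => i _; have -> : (x - grid_point g) i 0 = x i 0 - grid_point g i 0 by rewrite !mxE.
  rewrite gE {1}xE -mulrBr sq1.
  have -> : (16 * M%:R)^-1 = (1 / c) ^+ 2.
    rewrite expr_div_n expr1n div1r /c exprMn sqr_sqrtr ?ler0n//; congr (_ * _)^-1.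
    by rewrite -natrX.
  rewrite ler_pXn2r ?nnegrE ?subr_ge0 ?divr_ge0 ?(ltW c0)//.
  by rewrite lerBlDr -mulrDl ler_pdivlMr// mulrC addrC ltW.
by rewrite sumr_const card_ord -[leLHS]mulr_natr invfM -mulrA mulVf ?mulr1 ?gt_eqF.
Qed.

Lemma dotmx_le (n : nat) (x y : 'cV[R]_n) (s t : R) : 0 <= s -> 0 <= t ->
  frob2 x <= s ^+ 2 -> frob2 y <= t ^+ 2 -> (x^T *m y) 0 0 <= s * t.
Proof.
move=> s0 t0 xs yt; apply: (le_trans (ler_norm _)).
rewrite -(ler_pXn2r (n := 2))// ?nnegrE ?mulr_ge0// real_normK ?num_real//.
by rewrite (le_trans (dotmx_cauchy_schwarz _ _))// exprMn ler_pM ?frob2_ge0.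
Qed.

(** Moving each of the two arguments to the net costs a quarter of the norm; the resulting half is
    absorbed on the left. *)
Lemma spectral_norm_net (m : nat) (s : seq 'cV[R]_m) (S : 'M[R]_m) (t : R) :
  (forall x, x \in s -> frob2 x <= 1) ->
  (forall x : 'cV[R]_m, frob2 x <= 1 -> exists2 y, y \in s & frob2 (x - y) <= 16^-1) ->
  (forall x y, x \in s -> y \in s -> (x^T *m S *m y) 0 0 <= t) ->
  spectral_norm S <= 2 * t.
Proof.
move=> s1 net St; set sg := spectral_norm S.
have sg0 : 0 <= sg := spectral_norm_ge0 S.
have e4 : (16^-1 : R) = 4^-1 ^+ 2 by field.
suff : sg <= t + sg / 2 by lra.
apply: spectral_norm_le => y y1.
have [y' ys yy'] := net y y1.
pose Ny := frobenius_norm (S *m y).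
have Ny0 : 0 <= Ny := frobenius_ge0 _.
have Nys : frob2 (S *m y) <= sg ^+ 2.
  by rewrite (le_trans (spectral_normP _ _))// ler_piMr// sqr_ge0.
have [x x1 xN] : exists2 x : 'cV[R]_m, frob2 x <= 1 & (x^T *m (S *m y)) 0 0 = Ny.
  have [N0|N0] := eqVneq Ny 0.
    exists 0; first by rewrite frob2_0.
    by rewrite linear0 mul0mx mxE N0.
  exists (Ny^-1 *: (S *m y)).
    by rewrite frob2Z -sqr_frobenius -exprMn mulVf// expr1n.
  rewrite linearZ/= -scalemxAl mxE.
  have -> : ((S *m y)^T *m (S *m y)) 0 0 = Ny ^+ 2.
    rewrite sqr_frobenius -frob2_tr frob2_trace trmxK /mxtrace big_ord1//.
  by rewrite expr2 mulrA mulVf// mul1r.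
have [x' xs xx'] := net x x1.
rewrite -/Ny -xN.
have -> : (x^T *m (S *m y)) 0 0 = (x'^T *m S *m y') 0 0 +
   ((x - x')^T *m (S *m y)) 0 0 + (x'^T *m (S *m (y - y'))) 0 0.
  have -> : x^T *m (S *m y) = x'^T *m S *m y' + (x - x')^T *m (S *m y) +
      x'^T *m (S *m (y - y')).
    rewrite [(x - x')^T]linearB/= mulmxBl !mulmxBr !mulmxA.
    move: (x^T *m S *m y) (x'^T *m S *m y) (x'^T *m S *m y') => A1 A2 A3.
    by apply/matrixP => k l; rewrite !mxE; ring.
  by rewrite mxE [X in X + _]mxE.
have h1 := St x' y' xs ys.
have h2 : ((x - x')^T *m (S *m y)) 0 0 <= 4^-1 * sg.
  by apply: dotmx_le => //; rewrite ?invr_ge0// -e4.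
have h3 : (x'^T *m (S *m (y - y'))) 0 0 <= 1 * (sg * 4^-1).
  apply: dotmx_le => //; rewrite ?mulr_ge0 ?invr_ge0// ?expr1n ?s1//.
  by rewrite (le_trans (spectral_normP _ _))// exprMn -e4 ler_wpM2l// sqr_ge0.
lra.
Qed.

End nets.

(** * Spectral norm and powers of a symmetric matrix *)

Section matrix_powers.
Context {R : realType}.

Lemma frob2_mul_spectral (m k : nat) (S : 'M[R]_m) (B : 'M[R]_(m, k)) :
  frob2 (S *m B) <= spectral_norm S ^+ 2 * frob2 B.
Proof.
have cols (A : 'M[R]_(m, k)) : frob2 A = \sum_j frob2 (col j A).
  rewrite /frob2 exchange_big; apply: eq_bigr => j _; apply: eq_bigr => i _.
  by rewrite big_ord1 mxE.
rewrite !cols mulr_sumr; apply: ler_sum => j _.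
by rewrite !colE -mulmxA spectral_normP.
Qed.

Lemma frob2_exp_le (m k : nat) (S : 'M[R]_m) :
  frob2 (S ^+ k) <= m%:R * spectral_norm S ^+ (2 * k).
Proof.
elim: k => [|k IH].
  rewrite muln0 !expr0 mulr1 frob2_trace trmx1 mulmx1 mxtrace1.
  exact: lexx.
rewrite exprS -mulmxE (le_trans (frob2_mul_spectral _ _))//.
by rewrite mulnS exprD mulrCA ler_wpM2l// sqr_ge0.
Qed.

(** By symmetry |S^(k+1) x|^2 is the inner product of S^k x and S^(k+2) x. *)
Lemma frob2_exp_log_convex (m k : nat) (S : 'M[R]_m) (x : 'cV[R]_m) :
  S^T = S ->
  frob2 (S ^+ k.+1 *m x) ^+ 2 <= frob2 (S ^+ k *m x) * frob2 (S ^+ k.+2 *m x).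
Proof.
move=> Ss; set y := S ^+ k.+1 *m x.
have -> : frob2 y = ((S ^+ k *m x)^T *m (S ^+ k.+2 *m x)) 0 0.
  rewrite -frob2_tr frob2_trace trmxK /mxtrace big_ord1 /y !trmx_mul !trmx_exp_sym//.
  have key : S ^+ k.+1 *m S ^+ k.+1 = S ^+ k *m S ^+ k.+2.
    by rewrite !mulmxE -exprD addSnnS exprD.
  by congr (_ 0 0); rewrite mulmxA -(mulmxA x^T) key !mulmxA.
exact: dotmx_cauchy_schwarz.
Qed.

(** The squared lengths of the S^i x form a log-convex sequence starting at most at one, so they
    grow at least geometrically with ratio |S x|^2. This replaces diagonalization. *)
Lemma frob2_mulmx_exp (m k : nat) (S : 'M[R]_m) (x : 'cV[R]_m) :
  S^T = S -> frob2 x <= 1 -> frob2 (S *m x) ^+ k.+1 <= frob2 (S ^+ k.+1 *m x).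
Proof.
move=> Ss x1; pose a i := frob2 (S ^+ i *m x).
have a0 i : 0 <= a i by exact: frob2_ge0.
have step i : a 1%N * a i <= a i.+1.
  elim: i => [|i IH].
    by rewrite ler_piMr// /a expr0 mul1mx.
  have [ai0|ai0] := eqVneq (a i.+1) 0; first by rewrite ai0 mulr0.
  have h := frob2_exp_log_convex i x Ss; rewrite -!/(a _) in h.
  have aip : 0 < a i.
    rewrite lt_neqAle a0 andbT eq_sym; apply: contraNneq ai0 => ai.
    by rewrite -sqrf_eq0 eq_le sqr_ge0 andbT (le_trans h)// ai mul0r.
  rewrite -(ler_pM2l aip); apply: le_trans h.
  by rewrite expr2 mulrA ler_wpM2r// mulrC.
have aS : a 1%N = frob2 (S *m x) by rewrite /a expr1.
rewrite -aS -/(a _).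
elim: k => [|k IH]; first by rewrite expr1.
by rewrite exprS (le_trans _ (step _))// ler_wpM2l.
Qed.

Lemma spectral_norm_le_power (m k : nat) (S : 'M[R]_m) (t : R) : S^T = S ->
  (0 < k)%N -> 0 <= t -> frob2 (S ^+ k) <= t ^+ k -> spectral_norm S ^+ 2 <= t.
Proof.
move=> Ss k0 t0 St.
suff h : spectral_norm S <= Num.sqrt t.
  by rewrite -(sqr_sqrtr t0) ler_pXn2r ?nnegrE ?sqrtr_ge0 ?spectral_norm_ge0.
apply: spectral_norm_le => x x1; rewrite frobenius_normE ler_sqrt//.
case: k k0 St => // k k0 St; have h := frob2_mulmx_exp k Ss x1.
rewrite -(ler_pXn2r k0) ?nnegrE ?frob2_ge0//.
apply: (le_trans h); apply: le_trans St; apply: (le_trans (frob2M _ _)).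
by rewrite ler_piMr// frob2_ge0.
Qed.

End matrix_powers.

(** * Exponential moments of linear statistics *)

Section wigner_mgf.
Context {R : realType}.

(** The total coefficient of the bit e, which occurs at two symmetric positions. *)
Definition upper_coef {n} (Z : 'I_n -> 'I_n -> R) (e : 'I_n * 'I_n) : R :=
  if (e.1 < e.2)%N then Z e.1 e.2 + Z e.2 e.1 else 0.

Lemma wigner_inner h n (Z : 'I_n -> 'I_n -> R) f :
  \sum_i \sum_j Z i j * wigner_mx h f i j = \sum_e upper_coef Z e * h (f e).
Proof.
transitivity (\sum_(i < n) \sum_(j < n) (if (i < j)%N then Z i j * h (f (i, j)) else 0) +
    \sum_(i < n) \sum_(j < n) (if (j < i)%N then Z i j * h (f (j, i)) else 0)).
  rewrite -big_split; apply: eq_bigr => i _; rewrite -big_split; apply: eq_bigr => j _ /=.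
  rewrite mxE /edge_key; case: eqVneq => [->|ij].
    by rewrite ltnn mulr0 addr0.
  case: ltngtP => [_|_|/ord_inj ji]; rewrite ?addr0 ?add0r//.
  by rewrite ji eqxx in ij.
rewrite [X in _ + X]exchange_big -big_split /=.
rewrite [RHS](eq_bigr (fun e => upper_coef Z (e.1, e.2) * h (f (e.1, e.2)))) => [|[]//].
rewrite -(pair_bigA _ (fun i j : 'I_n => upper_coef Z (i, j) * h (f (i, j))))/=.
apply: eq_bigr => i _; rewrite -big_split; apply: eq_bigr => j _ /=.
by rewrite /upper_coef/=; case: ifP => _; rewrite ?mulrDl// mul0r addr0.
Qed.

Lemma sum_upper_coef_sqr n (Z : 'I_n -> 'I_n -> R) :
  \sum_e upper_coef Z e ^+ 2 <= 2 * \sum_i \sum_j Z i j ^+ 2.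
Proof.
rewrite (eq_bigr (fun e => upper_coef Z (e.1, e.2) ^+ 2)) => [|[]//].
rewrite -(pair_bigA _ (fun i j : 'I_n => upper_coef Z (i, j) ^+ 2))/=.
apply: (@le_trans _ _ (\sum_(i < n) \sum_(j < n) (if (i < j)%N then 2 * Z i j ^+ 2 else 0) +
    \sum_(i < n) \sum_(j < n) (if (j < i)%N then 2 * Z i j ^+ 2 else 0))).
  rewrite [X in _ <= _ + X]exchange_big -big_split; apply: ler_sum => i _ /=.
  rewrite -big_split; apply: ler_sum => j _; rewrite /upper_coef/=.
  case: ifP => _; last by rewrite expr0n addr0.
  by have := sqr_ge0 (Z i j - Z j i); nra.
rewrite -big_split mulr_sumr; apply: ler_sum => i _ /=.
rewrite -big_split mulr_sumr; apply: ler_sum => j _ /=.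
by case: ltngtP => _; rewrite ?addr0 ?add0r// mulr_ge0// sqr_ge0.
Qed.

Lemma upper_coef_le n (Z : 'I_n -> 'I_n -> R) (c : R) e :
  (forall i j, `|Z i j| <= c) -> `|upper_coef Z e| <= 2 * c.
Proof.
move=> Zc; have c0 : 0 <= c := le_trans (normr_ge0 _) (Zc e.1 e.2).
rewrite /upper_coef; case: ifP => _; last by rewrite normr0 mulr_ge0.
by rewrite (le_trans (ler_normD _ _))// mulr_natl mulr2n lerD.
Qed.

(** Independence reduces the claim to a bound for one bit; the factor 2 comes from merging symmetric
    positions. *)
Lemma wigner_mgf (q b : R) h n (Z : 'I_n -> 'I_n -> R) :
  0 <= q <= 1 -> 0 <= b ->
  (forall e, q * expR (upper_coef Z e * h true) +
     (1 - q) * expR (upper_coef Z e * h false) <= expR (b * upper_coef Z e ^+ 2)) ->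
  bern_exp q (fun f => expR (\sum_i \sum_j Z i j * wigner_mx h f i j)) <=
  expR (2 * b * \sum_i \sum_j Z i j ^+ 2).
Proof.
move=> /andP[q0 q1] b0 hq.
under eq_bern_exp do rewrite wigner_inner expR_sum.
rewrite (bern_exp_prod q (fun e x => expR (upper_coef Z e * h x))).
apply: (@le_trans _ _ (\prod_e expR (b * upper_coef Z e ^+ 2))).
  apply: ler_prod => e _; rewrite hq andbT.
  by rewrite addr_ge0// mulr_ge0 ?expR_ge0// subr_ge0.
rewrite -expR_sum ler_expR -mulr_sumr [2 * b]mulrC -mulrA ler_wpM2l//.
exact: sum_upper_coef_sqr.
Qed.

(** The linear terms of [expR_le_gauss] cancel by centering, and 8 = 2 * 2^2 because the entries are
    at most 2 in absolute value. *)
Lemma dominating_mgf (c : R) :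
  5^-1 * expR (c * dominating_law true) + (1 - 5^-1) * expR (c * dominating_law false)
  <= expR (8 * c ^+ 2).
Proof.
have h1 := expR_le_gauss (c * dominating_law true).
have h2 := expR_le_gauss (c * dominating_law false).
have e1 : expR (2 * (c * dominating_law true) ^+ 2) <= expR (8 * c ^+ 2) :> R.
  by rewrite ler_expR /dominating_law; have := sqr_ge0 c; lra.
have e2 : expR (2 * (c * dominating_law false) ^+ 2) <= expR (8 * c ^+ 2) :> R.
  by rewrite ler_expR /dominating_law; have := sqr_ge0 c; lra.
move: h1 h2 e1 e2; rewrite /dominating_law; lra.
Qed.

(** A Bernstein-type bound: the variance p must survive in the exponent, at the price of a
    restricted range for c. *)
Lemma centered_mgf (p c : R) : 0 <= p <= 1 -> `|c| <= 2^-1 ->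
  p * expR (c * centered_bern p true) + (1 - p) * expR (c * centered_bern p false)
  <= expR (2 * p * c ^+ 2).
Proof.
move=> /andP[p0 p1] c2; rewrite /centered_bern/= sub0r mulrN.
have [c1 c3] : - 2^-1 <= c /\ c <= 2^-1 by move: c2; rewrite ler_norml => /andP.
have cp : `|c * (1 - p)| <= 2^-1.
  by rewrite normrM (le_trans _ c2)// ler_piMr// ger0_norm ?subr_ge0// gerBl.
have cq : `|- (c * p)| <= 2^-1.
  by rewrite normrN normrM (le_trans _ c2)// ler_piMr// ger0_norm.
have h1 := expR_le_quadratic (le_trans (ler_norm _) cp).
have h2 := expR_le_quadratic (le_trans (ler_norm _) cq).
have q0 : 0 <= 1 - p by rewrite subr_ge0.
apply: (le_trans (lerD (ler_wpM2l p0 h1) (ler_wpM2l q0 h2))).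
apply: le_trans (expR_ge1Dx _).
have -> : p * (1 + c * (1 - p) + 2 * (c * (1 - p)) ^+ 2) +
   (1 - p) * (1 + - (c * p) + 2 * (- (c * p)) ^+ 2) =
   1 + 2 * p * c ^+ 2 - 2 * (p * c) ^+ 2 by ring.
by rewrite gerBl mulr_ge0// sqr_ge0.
Qed.

End wigner_mgf.

(** * Tail bounds *)

Section tails.
Context {R : realType}.

Lemma ler_sum_size (J : eqType) (s : seq J) (F : J -> R) (c : R) :
  (forall x, x \in s -> F x <= c) -> \sum_(x <- s) F x <= (size s)%:R * c.
Proof.
elim: s => [|x s IH] Fc; first by rewrite big_nil mul0r.
rewrite big_cons/= -natr1 mulrDl mul1r addrC lerD//; last by rewrite Fc ?mem_head.
by apply: IH => y ys; rewrite Fc// inE ys orbT.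
Qed.

Lemma ler_sum_mem (J : eqType) (s : seq J) (F : J -> R) x :
  (forall y, 0 <= F y) -> x \in s -> F x <= \sum_(y <- s) F y.
Proof.
by move=> F0 xs; rewrite (big_rem x)//= lerDl; apply: sumr_ge0.
Qed.

Lemma mulmx_bilinear n (x y : 'cV[R]_n) (S : 'M[R]_n) :
  (x^T *m S *m y) 0 0 = \sum_i \sum_j x i 0 * y j 0 * S i j.
Proof.
rewrite mxE exchange_big; apply: eq_bigr => j _; rewrite mxE mulr_suml.
by apply: eq_bigr => i _; rewrite mxE mulrAC.
Qed.

(** A union bound in expectation: it dominates every exponential on the net, and its mean is
    computed term by term. *)
Definition exp_net_sum m (s : seq 'cV[R]_m) (theta : R) (S : 'M[R]_m) : R :=
  \sum_(x <- s) \sum_(y <- s) expR (theta * (x^T *m S *m y) 0 0).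

Lemma exp_net_sum_mem m (s : seq 'cV[R]_m) theta (S : 'M[R]_m) x y :
  x \in s -> y \in s ->
  expR (theta * (x^T *m S *m y) 0 0) <= exp_net_sum s theta S.
Proof.
move=> xs ys.
apply: (@le_trans _ _ (\sum_(y <- s) expR (theta * (x^T *m S *m y) 0 0))).
  by apply: (@ler_sum_mem _ s (fun y => expR (theta * (x^T *m S *m y) 0 0)))
    => // z; exact: expR_ge0.
apply: (@ler_sum_mem _ s (fun x => \sum_(y <- s) expR (theta * (x^T *m S *m y) 0 0)))
  => // z; by apply: sumr_ge0 => ? _; exact: expR_ge0.
Qed.

(* With [E = 1 + exp_net_sum], the bilinear form is at most [ln E / theta] on the
   net, and [(ln E) ^ k <= k ^ k E]. *)
Lemma spectral_norm_power_le m (s : seq 'cV[R]_m) (S : 'M[R]_m) (theta : R) k :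
  0 < theta ->
  (forall x, x \in s -> frob2 x <= 1) ->
  (forall x : 'cV[R]_m, frob2 x <= 1 -> exists2 y, y \in s & frob2 (x - y) <= 16^-1) ->
  spectral_norm S ^+ k <= (2 / theta) ^+ k * (k%:R ^+ k * (1 + exp_net_sum s theta S)).
Proof.
move=> th0 s1 net; set E := 1 + _.
have E0 : 0 <= exp_net_sum s theta S.
  by apply: sumr_ge0 => x _; apply: sumr_ge0 => y _; exact: expR_ge0.
have E1 : 1 <= E by rewrite lerDl.
have Ep : 0 < E by exact: lt_le_trans E1.
have lE : 0 <= ln E by rewrite ln_ge0.
have h : spectral_norm S <= 2 * (ln E / theta).
  apply: spectral_norm_net s1 net _ => x y xs ys.
  rewrite ler_pdivlMr// mulrC -ler_expR lnK ?posrE//.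
  by rewrite (le_trans (exp_net_sum_mem _ _ xs ys))// lerDr.
apply: (@le_trans _ _ ((2 / theta) ^+ k * ln E ^+ k)).
  rewrite -exprMn mulrAC -mulrA lerXn2r ?nnegrE ?spectral_norm_ge0//.
  by rewrite mulr_ge0// divr_ge0// ltW.
rewrite ler_wpM2l ?exprn_ge0 ?divr_ge0 ?(ltW th0)//.
by have := exprn_le_expR k lE; rewrite lnK ?posrE.
Qed.

Lemma dominating_trace_bound (k : nat) : (0 < k)%N ->
  bern_exp 5^-1 (fun f => frob2 (wigner_mx dominating_law f ^+ k : 'M[R]_(k + k)))
  <= (k + k)%:R * (2 * (8 * 64 ^+ 4 * expR 32 * k%:R) ^+ k).
Proof.
move=> k0; have kp : 0 < k%:R :> R by rewrite ltr0n.
have q01 : 0 <= (5^-1 : R) <= 1 by apply/andP; split; lra.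
have [s [ss s1 net]] := ball_net (R := R) (k + k).
(* With theta^2 = 2k the exponent 16 theta^2 = 32 k is of the order of the log-size of the net, and
   (2 / theta)^(2k) (2k)^(2k) = (8k)^k. *)
pose theta : R := Num.sqrt (k + k)%:R.
have th0 : 0 < theta by rewrite sqrtr_gt0 ltr0n; lia.
have th2 : theta ^+ 2 = 2 * k%:R.
  by rewrite sqr_sqrtr ?ler0n// natrD mulr_natl mulr2n.
pose W f := @wigner_mx R dominating_law (k + k) f.
apply: (@le_trans _ _ (bern_exp 5^-1 (fun f => (k + k)%:R *
   ((8 * k%:R) ^+ k * (1 + exp_net_sum s theta (W f)))))).
  apply: ler_bern_exp => // f; apply: (le_trans (frob2_exp_le _ _)).
  rewrite ler_wpM2l//; apply: (le_trans (spectral_norm_power_le _ _ th0 s1 net)).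
  rewrite mulrA le_eqVlt; apply/orP; left; apply/eqP; congr (_ * _).
  rewrite -exprMn exprM; congr (_ ^+ _); rewrite exprMn expr_div_n th2 natrM.
  by field; rewrite gt_eqF.
rewrite bern_expZ ler_wpM2l// bern_expZ bern_expD bern_exp_cst.
have hE : bern_exp 5^-1 (fun f => exp_net_sum s theta (W f)) <=
    64 ^+ (k + k) * (64 ^+ (k + k) * expR (32 * k%:R)).
  rewrite /exp_net_sum bern_exp_sum.
  apply: (@le_trans _ _ ((size s)%:R * ((size s)%:R * expR (32 * k%:R)))); last first.
    by rewrite ler_pM ?mulr_ge0 ?expR_ge0// ler_wpM2r ?expR_ge0.
  apply: ler_sum_size => x xs; rewrite bern_exp_sum; apply: ler_sum_size => y ys.
  under eq_bern_exp => f.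
    rewrite mulmx_bilinear mulr_sumr; under eq_bigr do rewrite mulr_sumr.
    under eq_bigr do under eq_bigr do rewrite mulrA.
    over.
  apply: (le_trans (wigner_mgf (b := 8) q01 _ _)) => //.
    by move=> e; exact: dominating_mgf.
  rewrite ler_expR.
  have -> : \sum_(i < k + k) \sum_(j < k + k) (theta * (x i 0 * y j 0)) ^+ 2 =
      theta ^+ 2 * (frob2 x * frob2 y).
    rewrite !frob2_cV mulr_suml mulr_sumr; apply: eq_bigr => i _.
    by rewrite !mulr_sumr; apply: eq_bigr => j _; rewrite !exprMn.
  have xy1 : frob2 x * frob2 y <= 1.
    by rewrite mulr_ile1 ?frob2_ge0 ?s1.
  rewrite th2; have := ler_wpM2l (ltW kp) xy1; lra.
have e1 : 64 ^+ (k + k) * (64 ^+ (k + k) * expR (32 * k%:R)) =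
    (64 ^+ 4 * expR 32) ^+ k :> R.
  rewrite exprMn expRM_natr -exprM mulrA -exprD; congr (_ ^+ _ * _); lia.
rewrite e1 in hE.
have one : 1 <= (64 ^+ 4 * expR 32) ^+ k :> R.
  rewrite exprn_ege1// mulr_ege1 ?exprn_ege1 ?ler1n//.
  by rewrite -expR0 ler_expR.
have -> : 8 * 64 ^+ 4 * expR 32 * k%:R = (8 * k%:R) * (64 ^+ 4 * expR 32) :> R by ring.
rewrite [in leRHS]exprMn [leRHS]mulrCA ler_wpM2l ?exprn_ge0 ?mulr_ge0//.
rewrite mulr_natl mulr2n lerD//.
Qed.

(** The constant of [dominating_trace_bound] times exp 8: the excess exp (8k) absorbs the 2 n^4 left
    by Markov's inequality, as ln n <= k. *)
Definition spectral_constant : R := 8 * 64 ^+ 4 * expR 40.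

Lemma spectral_tail (p : R) (n k : nat) : 0 <= p <= 1 -> (0 < n)%N -> (0 < k)%N ->
  n%:R * p <= k%:R -> ln (n%:R : R) <= k%:R ->
  bern_exp p (fun f => (~~ (spectral_norm (wigner_mx (centered_bern p) f : 'M[R]_n) ^+ 2
     <= spectral_constant * k%:R))%:R) <= n%:R ^- 3.
Proof.
move=> p01 n0 k0 npk lnk.
have kp : 0 < k%:R :> R by rewrite ltr0n.
have np : 0 < n%:R :> R by rewrite ltr0n.
have D0 : 0 < spectral_constant.
  by rewrite /spectral_constant !mulr_gt0 ?exprn_gt0 ?expR_gt0.
have t0 : 0 < spectral_constant * k%:R by rewrite mulr_gt0.
apply: (le_trans (bern_markov (F := fun f =>
  frob2 (wigner_mx (centered_bern p) f ^+ k : 'M[R]_n)) p01 (exprn_gt0 k t0) _ _)).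
- by move=> f; exact: frob2_ge0.
- move=> f; apply: contraNT; rewrite -ltNge => /ltW.
  by apply: spectral_norm_le_power => //; [exact: wigner_mx_sym | exact: ltW].
rewrite ler_pdivrMr ?exprn_gt0//.
apply: (le_trans (moment_comparison p01 k0 npk)).
have k2 : 0 < (k + k)%:R :> R by rewrite ltr0n; lia.
apply: (@le_trans _ _ (n%:R / (k + k)%:R *
   ((k + k)%:R * (2 * (8 * 64 ^+ 4 * expR 32 * k%:R) ^+ k)))).
  by rewrite ler_wpM2l ?divr_ge0 ?(ltW k2) ?(ltW np)// dominating_trace_bound.
rewrite [leLHS]mulrA divfK ?gt_eqF//.
have -> : spectral_constant * k%:R = (8 * 64 ^+ 4 * expR 32 * k%:R) * expR 8.
  rewrite /spectral_constant (_ : 40 = 32 + 8 :> R); last by ring.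
  by rewrite expRD; ring.
set A := 8 * 64 ^+ 4 * expR 32 * k%:R.
have A0 : 0 <= A ^+ k by rewrite exprn_ge0// !mulr_ge0 ?exprn_ge0 ?expR_ge0.
clearbody A; rewrite exprMn mulrA [leRHS]mulrA [leRHS]mulrAC ler_wpM2r//.
rewrite ler_pdivlMl ?exprn_gt0//.
have ne : n%:R <= expR k%:R :> R by rewrite -[leLHS]lnK ?posrE// ler_expR.
have e4 : n%:R ^+ 4 <= expR k%:R ^+ 4 :> R by rewrite lerXn2r ?nnegrE ?expR_ge0 ?(ltW np).
have e5 : 2 <= expR k%:R ^+ 4 :> R.
  rewrite -expRM_natl (le_trans _ (expR_ge1Dx _))//.
  have : 1 <= k%:R :> R by rewrite ler1n.
  lra.
have -> : expR 8 ^+ k = expR k%:R ^+ 4 * expR k%:R ^+ 4 :> R.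
  by rewrite -exprD -expRM_natl -expRM_natl mulrC.
have -> : n%:R ^+ 3 * (n%:R * 2) = n%:R ^+ 4 * 2 :> R by ring.
by rewrite ler_pM// exprn_ge0// ltW.
Qed.

End tails.

(** * Quadratic forms given by the columns *)

Section gram_tail.
Context {R : realType} {n r : nat}.
Implicit Types (V : 'M[R]_(n, r)) (X : 'M[R]_n) (x y : 'cV[R]_r).

(** The matrix V^T diag(x) V, where x is column j of X. *)
Definition column_gram V X (j : 'I_n) : 'M[R]_r :=
  \matrix_(k, l) \sum_i X i j * (V i k * V i l).

Lemma column_gramE V X j x y : (x^T *m column_gram V X j *m y) 0 0 =
  \sum_i X i j * ((V *m x) i 0 * (V *m y) i 0).
Proof.
rewrite mulmx_bilinear.
transitivity (\sum_k \sum_l \sum_i X i j * ((V i k * x k 0) * (V i l * y l 0))).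
  apply: eq_bigr => k _; apply: eq_bigr => l _; rewrite mxE mulr_sumr.
  by apply: eq_bigr => i _; ring.
transitivity (\sum_i \sum_k \sum_l X i j * ((V i k * x k 0) * (V i l * y l 0))).
  rewrite [RHS]exchange_big; apply: eq_bigr => k _ /=.
  by rewrite [RHS]exchange_big.
apply: eq_bigr => i _; rewrite !mxE mulr_suml mulr_sumr; apply: eq_bigr => k _.
by rewrite mulr_sumr mulr_sumr.
Qed.

Lemma row_mulmx_sqr_le V x i : (V *m x) i 0 ^+ 2 <= frob2 (row i V) * frob2 x.
Proof.
have := dotmx_cauchy_schwarz (row i V)^T x.
by rewrite trmxK frob2_tr -row_mul mxE.
Qed.

(** The coefficients are supported on column j. Their size is at most theta B <= 1/4, so merged
    coefficients stay within the range 1/2 of [centered_mgf]; the sum of their squares is at most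
    theta^2 B because V is a contraction with rows of squared norm at most B. *)
Lemma column_gram_mgf (p B theta : R) V j x y :
  0 <= p <= 1 -> 0 <= theta -> 0 <= B -> theta * B <= 4^-1 ->
  (forall i, frob2 (row i V) <= B) -> (forall y, frob2 (V *m y) <= frob2 y) ->
  frob2 x <= 1 -> frob2 y <= 1 ->
  bern_exp p (fun f => expR (theta *
      (x^T *m column_gram V (wigner_mx (centered_bern p) f) j *m y) 0 0)) <=
  expR (4 * p * theta ^+ 2 * B).
Proof.
move=> p01 th0 B0 thB VB V1 x1 y1; have /andP[p0 p1] := p01.
pose Z i j' : R := theta * ((V *m x) i 0 * (V *m y) i 0) * (j' == j)%:R.
have sqB (z : 'cV[R]_r) i : frob2 z <= 1 -> (V *m z) i 0 ^+ 2 <= B.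
  move=> z1; rewrite (le_trans (row_mulmx_sqr_le _ _ _))// (le_trans _ (VB i))//.
  by rewrite ler_piMr// frob2_ge0.
have xyB i : `|(V *m x) i 0 * (V *m y) i 0| <= B.
  have := sqB x i x1; have := sqB y i y1.
  move: ((V *m x) i 0) ((V *m y) i 0) => a b hb ha.
  rewrite -(ler_pXn2r (n := 2))// ?nnegrE// real_normK ?num_real// exprMn expr2.
  by rewrite ler_pM ?sqr_ge0.
have Zle i j' : `|Z i j'| <= 4^-1.
  apply: le_trans thB; rewrite /Z normrM.
  apply: (@le_trans _ _ `|theta * ((V *m x) i 0 * (V *m y) i 0)|).
    by rewrite ler_piMr//; case: (_ == _); rewrite ?normr1 ?normr0.
  by rewrite normrM (ger0_norm th0) ler_wpM2l.
rewrite (@eq_bern_exp _ _ _ _ (fun f =>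
    expR (\sum_i \sum_j' Z i j' * wigner_mx (centered_bern p) f i j'))); last first.
  move=> f; congr expR; rewrite column_gramE mulr_sumr; apply: eq_bigr => i _.
  rewrite (bigD1 j)//= big1 ?addr0 => [|k kj]; last by rewrite /Z (negbTE kj) mulr0 mul0r.
  by rewrite /Z eqxx mulr1; ring.
apply: (le_trans (wigner_mgf (b := 2 * p) p01 _ _)).
- by rewrite mulr_ge0.
- move=> e; apply: centered_mgf => //.
  by apply: (le_trans (upper_coef_le e Zle)); lra.
rewrite ler_expR.
have -> : \sum_i \sum_j' Z i j' ^+ 2 =
    theta ^+ 2 * \sum_i ((V *m x) i 0 ^+ 2 * (V *m y) i 0 ^+ 2).
  rewrite mulr_sumr; apply: eq_bigr => i _.
  rewrite (bigD1 j)//= big1 ?addr0 => [|k kj]; last by rewrite /Z (negbTE kj) mulr0 expr0n.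
  by rewrite /Z eqxx mulr1; ring.
have h : \sum_i ((V *m x) i 0 ^+ 2 * (V *m y) i 0 ^+ 2) <= B.
  apply: (@le_trans _ _ (\sum_i (B * (V *m y) i 0 ^+ 2))).
    by apply: ler_sum => i _; rewrite ler_wpM2r ?sqr_ge0// sqB.
  by rewrite -mulr_sumr -frob2_cV ler_piMr ?(le_trans (V1 y)).
have -> : 2 * (2 * p) * (theta ^+ 2 * \sum_i ((V *m x) i 0 ^+ 2 * (V *m y) i 0 ^+ 2)) =
  4 * p * theta ^+ 2 * \sum_i ((V *m x) i 0 ^+ 2 * (V *m y) i 0 ^+ 2) by ring.
by rewrite ler_wpM2l// !mulr_ge0// sqr_ge0.
Qed.

Lemma gram_tail (p e B : R) V : 0 <= p <= 1 -> 0 < e -> e <= 1 -> 0 < B ->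
  (forall i, frob2 (row i V) <= B) -> (forall y, frob2 (V *m y) <= frob2 y) ->
  bern_exp p (fun f => (~~ [forall j, spectral_norm
      (column_gram V (wigner_mx (centered_bern p) f) j) <= 2 * (e * p)])%:R)
  <= n%:R * (64 ^+ (r + r) * expR (- (e ^+ 2 * p / (16 * B)))).
Proof.
move=> p01 e0 e1 B0 VB V1.
have [s [ss s1 net]] := ball_net (R := R) r.
(* This minimizes 4 p theta^2 B - theta e p, with value - e^2 p / (16 B). *)
pose theta := e / (8 * B); have th0 : 0 < theta by rewrite divr_gt0// mulr_gt0.
pose S f j := column_gram V (wigner_mx (centered_bern p) f) j.
apply: (@le_trans _ _ (bern_exp p (fun f => \sum_(j < n)
   expR (- (theta * (e * p))) * exp_net_sum s theta (S f j)))).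
  apply: ler_bern_exp => // f.
  have E0 j : 0 <= expR (- (theta * (e * p))) * exp_net_sum s theta (S f j).
    rewrite mulr_ge0 ?expR_ge0//; apply: sumr_ge0 => x _.
    by apply: sumr_ge0 => y _; exact: expR_ge0.
  case: forallP => [_|bad]; first exact: sumr_ge0.
  have [j jbad] : exists j, ~~ (spectral_norm (S f j) <= 2 * (e * p)).
    by apply/existsP; apply: contra_notT bad => /existsPn h j; apply/negPn; exact: h.
  apply: (@le_trans _ _ (expR (- (theta * (e * p))) * exp_net_sum s theta (S f j))).
    move: jbad; apply: contraNT; rewrite -ltNge => small.
    apply: spectral_norm_net s1 net _ => x y xs ys.
    rewrite -(ler_pM2l th0) -ler_expR ltW//.
    apply: (le_lt_trans (exp_net_sum_mem _ _ xs ys)).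
    by move: small; rewrite expRN ltr_pdivrMl ?expR_gt0// mulr1.
  by rewrite (bigD1 j)//= lerDl sumr_ge0.
rewrite bern_exp_sum -[n in n%:R]card_ord mulr_natl -sumr_const.
apply: ler_sum => j _; rewrite bern_expZ.
have hE : bern_exp p (fun f => exp_net_sum s theta (S f j)) <=
    64 ^+ r * (64 ^+ r * expR (4 * p * theta ^+ 2 * B)).
  rewrite /exp_net_sum bern_exp_sum.
  apply: (@le_trans _ _ ((size s)%:R * ((size s)%:R * expR (4 * p * theta ^+ 2 * B)))); last first.
    by rewrite ler_pM ?mulr_ge0 ?expR_ge0// ler_wpM2r ?expR_ge0.
  apply: ler_sum_size => x xs; rewrite bern_exp_sum; apply: ler_sum_size => y ys.
  apply: column_gram_mgf => //; rewrite ?s1// ?(ltW th0) ?(ltW B0)//.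
  rewrite /theta invfM mulrA mulfVK ?gt_eqF//; lra.
apply: (le_trans (ler_wpM2l (expR_ge0 _) hE)).
rewrite mulrCA exprD -[leRHS]mulrA ler_wpM2l ?exprn_ge0// mulrCA ler_wpM2l ?exprn_ge0//.
rewrite -expRD ler_expR le_eqVlt; apply/orP; left; apply/eqP.
by rewrite /theta; field; rewrite gt_eqF.
Qed.

End gram_tail.

(** * Law of the sampled set *)

Section offdiagonal_law.
Context {R : realType} {d : measure_display} {T : measurableType d}.
Variable P : probability T R.

Lemma probability_mem_seq (J : eqType) (g : T -> J) (c : J -> R) (s : seq J) :
  uniq s ->
  (forall V, V \in s -> measurable [set w | g w = V] /\ P [set w | g w = V] = (c V)%:E) ->
  measurable [set w | g w \in s] /\ P [set w | g w \in s] = (\sum_(V <- s) c V)%:E.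
Proof.
elim: s => [|V s IH] /=.
  move=> _ _; rewrite big_nil (_ : [set w | _] = set0); last by apply/seteqP; split.
  by rewrite measure0.
move=> /andP[Vs us] h.
have [m1 p1] : measurable [set w | g w \in s] /\
    P [set w | g w \in s] = (\sum_(V <- s) c V)%:E.
  by apply: IH => // U Us; apply: h; rewrite inE Us orbT.
have [m0 p0] := h V (mem_head _ _).
have -> : [set w | g w \in V :: s] = [set w | g w = V] `|` [set w | g w \in s].
  apply/seteqP; split=> w /=; rewrite inE.
    by move=> /orP[/eqP ->|->]; [left|right].
  by move=> [->|->]; rewrite ?eqxx ?orbT.
split; first exact: measurableU.
rewrite measureU//; first by rewrite big_cons EFinD -p0 -p1.
by rewrite -subset0 => w /= [gV gs]; move: Vs; rewrite -gV gs.
Qed.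

Lemma disjoint_setU1 (J : finType) (e : J) (A B : {set J}) :
  [disjoint (e |: A)%SET & B]%B = (e \notin B) && [disjoint A & B]%B.
Proof.
by rewrite -!finset.setI_eq0 finset.setIUl finset.setU_eq0 !finset.setI_eq0 disjoints1.
Qed.

Lemma sum_mem_seq (J : eqType) (x : J) (s : seq J) : uniq s ->
  \sum_(V <- s) (V == x)%:R = (x \in s)%:R :> R.
Proof.
elim: s => [|V s IH] /=; first by rewrite big_nil.
move=> /andP[Vs us]; rewrite big_cons IH// inE eq_sym.
by case: eqVneq => [->|_]; rewrite ?(negbTE Vs) ?addr0 ?add0r.
Qed.

Variables (n : nat) (p : R) (Omega : T -> {set 'I_n * 'I_n}).
Hypothesis HO : offdiag_sym_ber P p Omega.

Local Definition upper : {set 'I_n * 'I_n} := [set ij : 'I_n * 'I_n | (ij.1 < ij.2)%N]%SET.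

Lemma offdiag_inter (J : {set 'I_n * 'I_n}) : J \subset upper ->
  measurable [set w | J \subset Omega w] /\
  P [set w | J \subset Omega w] = (p ^+ #|J|)%:E.
Proof.
have [_ [mA indep] Pp _] := HO; move=> JD.
have JE : [set w | J \subset Omega w] =
    \bigcap_(i in [set` J]) [set w | i \in Omega w].
  apply/seteqP; split=> w /=.
    by move=> /fintype.subsetP h i /= iJ; exact: h.
  by move=> h; apply/fintype.subsetP => i iJ; exact: h.
have JD' i : i \in J -> (i.1 < i.2)%N.
  by move=> iJ; have := fintype.subsetP JD i iJ; rewrite inE.
split.
  rewrite JE; apply: fin_bigcap_measurable; first exact: finite_finset.
  by move=> i /= iJ; apply: mA; rewrite inE JD'.
rewrite JE indep//; congr (_%:E); rewrite -prodr_const; apply: eq_bigr => -[i j] ij.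
by rewrite Pp//; exact: (JD' _ ij).
Qed.

(** Independence is given for inclusions only; exclusions are added one index at a time, as a
    difference of two nested events. *)
Lemma offdiag_inter_compl (K J : {set 'I_n * 'I_n}) :
  J \subset upper -> K \subset upper -> [disjoint J & K]%B ->
  measurable [set w | (J \subset Omega w) && [disjoint K & Omega w]%B] /\
  P [set w | (J \subset Omega w) && [disjoint K & Omega w]%B] =
    (p ^+ #|J| * (1 - p) ^+ #|K|)%:E.
Proof.
move: {2}#|K| (erefl #|K|) => k; elim: k K J => [|k IH] K J Kk JD KD JK.
  have -> : K = finset.set0 by apply/eqP; rewrite -cards_eq0 Kk.
  rewrite cards0 expr0 mulr1.
  rewrite (_ : [set w | _] = [set w | J \subset Omega w]); first exact: offdiag_inter.
  by apply/seteqP; split=> w /=; rewrite -finset.setI_eq0 finset.set0I eqxx andbT.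
have [e eK] : exists e, e \in K by apply/finset.set0Pn; rewrite -cards_eq0 Kk.
pose K' := (K :\ e)%SET; have K'k : #|K'| = k.
  by apply/eqP; rewrite -eqSS -Kk (cardsD1 e K) eK.
have K'D : K' \subset upper by apply: fintype.subset_trans KD; exact: finset.subD1set.
have eD : e \in upper by exact: (fintype.subsetP KD).
have eJ : e \notin J by rewrite (disjointFl JK).
have JK' : [disjoint J & K']%B by apply: disjointWr JK; exact: finset.subD1set.
have eJD : (e |: J)%SET \subset upper by rewrite finset.subUset finset.sub1set eD.
have eJK' : [disjoint (e |: J)%SET & K']%B.
  by rewrite disjoint_setU1 JK' !inE eqxx.
have [m1 p1] := IH K' J K'k JD K'D JK'.
have [m2 p2] := IH K' (e |: J)%SET K'k eJD K'D eJK'.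
set A := [set w | (J \subset Omega w) && [disjoint K' & Omega w]%B] in m1 p1.
set B := [set w | ((e |: J)%SET \subset Omega w) && [disjoint K' & Omega w]%B] in m2 p2.
have -> : [set w | (J \subset Omega w) && [disjoint K & Omega w]%B] = A `\` B.
  have KE : K = (e |: K')%SET by rewrite finset.setD1K.
  apply/seteqP; split=> w /=.
    rewrite {1}KE disjoint_setU1 => /andP[Jw /andP[eW Kw]].
    split; rewrite /A /B/= ?Jw ?Kw// finset.subUset finset.sub1set (negbTE eW)//.
  move=> [/andP[Jw Kw] nB]; rewrite Jw KE disjoint_setU1 Kw andbT.
  by apply/negP => eW; apply: nB; rewrite /B/= finset.subUset finset.sub1set eW Jw Kw.
split; first exact: measurableD.
rewrite measureD//; last first.
  by rewrite (le_lt_trans (probability_le1 P m1))// ltry.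
have AB : A `&` B = B.
  by apply/setIidr => w; rewrite /A /B/= finset.subUset => /andP[/andP[_ ->] ->].
rewrite AB Kk.
transitivity ((p ^+ #|J| * (1 - p) ^+ #|K'|)%:E -
  (p ^+ #|(e |: J)%SET| * (1 - p) ^+ #|K'|)%:E)%E; first by rewrite -p1 -p2.
rewrite -EFinB K'k; congr (_%:E).
by rewrite cardsU1 eJ/= add1n !exprS; ring.
Qed.

Definition graph_of (f : {ffun 'I_n * 'I_n -> bool}) : {set 'I_n * 'I_n} :=
  [set ij : 'I_n * 'I_n | (ij.1 != ij.2) && f (edge_key ij.1 ij.2)]%SET.

Local Definition symmetrize (V : {set 'I_n * 'I_n}) : {set 'I_n * 'I_n} :=
  [set ij : 'I_n * 'I_n | (ij.1 != ij.2) && (edge_key ij.1 ij.2 \in V)]%SET.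

Lemma edge_key_upper (i j : 'I_n) : i != j -> edge_key i j \in upper.
Proof.
move=> ij; rewrite /edge_key inE; case: (ltngtP i j) => //= h.
by rewrite (ord_inj h) eqxx in ij.
Qed.

Lemma symmetrize_upper (W : {set 'I_n * 'I_n}) :
  (forall i, (i, i) \notin W) ->
  (forall i j : 'I_n, (j < i)%N -> ((i, j) \in W) = ((j, i) \in W)) ->
  symmetrize (W :&: upper)%SET = W.
Proof.
move=> W0 Ws; apply/setP => -[i j]; rewrite inE/=.
case: eqVneq => [->|ij]; first by rewrite (negbTE (W0 j)).
rewrite inE (edge_key_upper ij) andbT /edge_key/=.
case: (ltngtP i j) => //= h; first by rewrite (Ws i j h).
by rewrite (ord_inj h) eqxx in ij.
Qed.

Lemma graph_of_law (V : {set 'I_n * 'I_n}) : V \subset upper ->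
  bern_exp p (fun f => ((graph_of f :&: upper)%SET == V)%:R) =
  p ^+ #|V| * (1 - p) ^+ #|(upper :\: V)%SET|.
Proof.
move=> VD.
pose g (e : 'I_n * 'I_n) (b : bool) : R := ((e \in upper) ==> (b == (e \in V)))%:R.
rewrite (@eq_bern_exp _ _ _ _ (fun f => \prod_e g e (f e))); last first.
  move=> f; case: eqP => [fV|fV].
    rewrite big1// => -[i j] _; rewrite /g; case: (boolP (_ \in _)) => // ij /=.
    rewrite -fV !inE/= /edge_key; rewrite inE/= in ij; rewrite ij andbT.
    by rewrite (_ : i != j) ?eqxx//; apply: contraTneq ij => ->; rewrite ltnn.
  have [e he] : exists e, ~~ ((e \in upper) ==> (f e == (e \in V))).
    apply/existsP; apply: contra_notT fV => /existsPn h; apply/setP => -[i j].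
    have := h (i, j); rewrite negbK !inE/= /edge_key.
    case: ltnP => /= ij; last first.
      rewrite andbF => _; apply/esym/negbTE/negP => /(fintype.subsetP VD).
      by rewrite inE/= ltnNge ij.
    rewrite andbT => /eqP <-; rewrite (_ : i != j)//.
    by apply: contraTneq ij => ->; rewrite ltnn.
  by rewrite (bigD1 e)//= /g (negbTE he) mul0r.
rewrite bern_exp_prod.
rewrite -!prodr_const [X in _ = X * _]big_mkcond [X in _ = _ * X]big_mkcond.
rewrite -big_split; apply: eq_bigr => e _; rewrite /g/= finset.in_setD.
case: (boolP (e \in upper)) => eD /=.
  by case: (e \in V); rewrite /= !(mulr1, mulr0, addr0, add0r, mul1r).
rewrite (_ : (e \in V) = false)/=; first by rewrite !mulr1 addrC subrK.
by apply: contraNF eD; exact: (fintype.subsetP VD).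
Qed.

(** The sample is determined by its part above the diagonal, which takes finitely many values of
    known probability; hence every event about it is measurable. *)
Lemma offdiag_probability (B : pred {set 'I_n * 'I_n}) :
  measurable [set w | B (Omega w)] /\
  P [set w | B (Omega w)] = (bern_exp p (fun f => (B (graph_of f))%:R))%:E.
Proof.
have [noloop _ _ Os] := HO.
pose s := [seq V <- enum (powerset upper) | B (symmetrize V)].
pose c (V : {set 'I_n * 'I_n}) := p ^+ #|V| * (1 - p) ^+ #|(upper :\: V)%SET|.
have sD V : V \in s -> V \subset upper.
  by rewrite mem_filter mem_enum inE => /andP[].
have us : uniq s by rewrite filter_uniq// enum_uniq.
have [|m1 p1] := @probability_mem_seq _ (fun w => (Omega w :&: upper)%SET) c s us.
  move=> V /sD VD.
  have DV : (upper :\: V)%SET \subset upper by exact: finset.subsetDl.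
  have dis : [disjoint V & (upper :\: V)%SET]%B.
    by rewrite -finset.setI_eq0; apply/eqP/setP => e; rewrite !inE; case: (e \in V).
  rewrite (_ : [set w | _] =
    [set w | (V \subset Omega w) && [disjoint (upper :\: V)%SET & Omega w]%B]).
    exact: offdiag_inter_compl.
  apply/seteqP; split=> w /=.
    move=> <-; rewrite finset.subsetIl/= -finset.setI_eq0; apply/eqP/setP => e; rewrite !inE.
    by case: (e \in Omega w); rewrite /= ?andbF// andbT; case: (e.1 < e.2)%N.
  move=> /andP[VO dO]; apply/setP => e; rewrite finset.in_setI.
  apply/idP/idP => [/andP[eO eD]|eV].
    apply: contraTT eO => eV; have h : e \in (upper :\: V)%SET.
      by rewrite finset.in_setD eV eD.
    by rewrite (disjointFr dO h).
  by rewrite (fintype.subsetP VO _ eV) (fintype.subsetP VD _ eV).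
have sO w : symmetrize (Omega w :&: upper)%SET = Omega w.
  by apply: symmetrize_upper; [exact: noloop | exact: Os].
have OE : [set w | B (Omega w)] = [set w | (Omega w :&: upper)%SET \in s].
  by apply/seteqP; split=> w /=; rewrite mem_filter mem_enum inE finset.subsetIr andbT sO.
rewrite OE; split=> //; rewrite p1; congr (_%:E).
rewrite (eq_big_seq (fun V => bern_exp p (fun f => ((graph_of f :&: upper)%SET == V)%:R))); last first.
  by move=> V /sD VD; rewrite graph_of_law.
rewrite -bern_exp_sum; apply: eq_bern_exp => f.
have -> : B (graph_of f) = ((graph_of f :&: upper)%SET \in s).
  rewrite mem_filter mem_enum inE finset.subsetIr andbT symmetrize_upper//.
    by move=> i; rewrite inE/= eqxx.
  by move=> i j ji; rewrite !inE/= eq_sym edge_keyC.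
rewrite -sum_mem_seq//.
by apply: eq_bigr => V _; rewrite eq_sym.
Qed.
End offdiagonal_law.

(** * Sampling conditions and conclusion *)

Section spectral_factor.
Context {R : realType} {n r : nat}.
Variables (hr : (0 < r)%N) (M : 'M[R]_n) (sigma : 'I_r -> R) (u : 'I_r -> 'cV[R]_n).
Hypothesis HM : spectral_decomposition M sigma u.

Definition eigenvector_mx : 'M[R]_(n, r) := \matrix_(i, j) u j i 0.
Definition spectral_factor : 'M[R]_(n, r) := \matrix_(i, j) (Num.sqrt (sigma j) * u j i 0).

Local Notation V := eigenvector_mx.
Local Notation U := spectral_factor.
Local Notation smin := (sigma (rev_ord (Ordinal hr))).
Local Notation smax := (sigma (Ordinal hr)).

Lemma sigma_gt0 i : 0 < sigma i. Proof. by have [_ ->] := HM. Qed.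

Lemma sigma_ge_min i : smin <= sigma i.
Proof. by have [+ _ _ _] := HM; apply => /=; have := ltn_ord i; lia. Qed.

Lemma sigma_le_max i : sigma i <= smax.
Proof. by have [+ _ _ _] := HM; apply => /=; lia. Qed.

Lemma eigenvector_mx_orthonormal : V^T *m V = 1%:M.
Proof.
have [_ _ uu _] := HM; apply/matrixP => i j; rewrite [RHS]mxE -uu !mxE.
by apply: eq_bigr => k _; rewrite !mxE.
Qed.

Lemma frob2_eigenvector_mx (y : 'cV[R]_r) : frob2 (V *m y) = frob2 y.
Proof.
rewrite -[LHS]frob2_tr -[RHS]frob2_tr !frob2_trace !trmxK trmx_mul.
by rewrite mulmxA -(mulmxA y^T) eigenvector_mx_orthonormal mulmx1.
Qed.

Lemma spectral_factor_mulmx (y : 'cV[R]_r) :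
  U *m y = V *m (\col_k (Num.sqrt (sigma k) * y k 0)).
Proof.
apply/matrixP => i j; rewrite !mxE; apply: eq_bigr => k _.
by rewrite !mxE (ord1 j); ring.
Qed.

Lemma frob2_spectral_factor_ge (y : 'cV[R]_r) :
  smin * frob2 y <= frob2 (U *m y).
Proof.
rewrite spectral_factor_mulmx frob2_eigenvector_mx !frob2_cV mulr_sumr.
apply: ler_sum => k _; rewrite mxE exprMn sqr_sqrtr ?(ltW (sigma_gt0 k))//.
by rewrite ler_wpM2r ?sqr_ge0// sigma_ge_min.
Qed.

Lemma spectral_decomposition_entry i j : M i j = \sum_k sigma k * (u k i 0 * u k j 0).
Proof.
have [_ _ _ ->] := HM; rewrite summxE; apply: eq_bigr => k _.
by rewrite !mxE big_ord1 mxE.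
Qed.

Lemma spectral_factor_gram : M = U *m U^T.
Proof.
apply/matrixP => i j; rewrite spectral_decomposition_entry mxE; apply: eq_bigr => k _.
rewrite !mxE -{1}(sqr_sqrtr (ltW (sigma_gt0 k))); ring.
Qed.

Lemma linfty_norm_ge i j : `|M i j| <= linfty_norm M.
Proof.
rewrite /linfty_norm mx_normrE.
by apply/bigmax_geP; right; exists (i, j).
Qed.

Lemma frob2_row_spectral_factor i : frob2 (row i U) <= linfty_norm M.
Proof.
apply: le_trans (linfty_norm_ge i i); apply: le_trans (ler_norm _).
rewrite spectral_decomposition_entry frob2_rV; apply: ler_sum => k _.
by rewrite !mxE exprMn sqr_sqrtr ?(ltW (sigma_gt0 k))// expr2.
Qed.

(** Scaling the columns of V by the roots of the eigenvalues gives U, and the squared norm of row i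
    of U is the diagonal entry M_ii. *)
Lemma frob2_row_eigenvector_mx_le i : frob2 (row i V) <= linfty_norm M / smin.
Proof.
rewrite ler_pdivlMr ?sigma_gt0//; apply: le_trans (frob2_row_spectral_factor i).
rewrite !frob2_rV mulr_suml; apply: ler_sum => k _.
rewrite !mxE exprMn sqr_sqrtr ?(ltW (sigma_gt0 k))// mulrC.
by rewrite ler_wpM2r ?sqr_ge0// sigma_ge_min.
Qed.

(** The squared row norms of V add up to r. *)
Lemma rank_le_leverage : r%:R <= n%:R * (linfty_norm M / smin).
Proof.
have -> : r%:R = \sum_(i < n) frob2 (row i V).
  rewrite -frob2_rows -frob2_tr frob2_trace trmxK eigenvector_mx_orthonormal.
  by rewrite mxtrace1.
rewrite -[n in n%:R]card_ord mulr_natl -sumr_const.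
by apply: ler_sum => i _; exact: frob2_row_eigenvector_mx_le.
Qed.

Lemma linfty_le_coherence :
  linfty_norm M <= smax * \big[Num.max/0]_(i < n) \sum_(j < r) u j i 0 ^+ 2.
Proof.
set mm := \big[_/_]_(i < n) _.
have mi i : \sum_(j < r) u j i 0 ^+ 2 <= mm by exact: le_bigmax.
have mm0 : 0 <= mm by exact: bigmax_ge_id.
rewrite /linfty_norm mx_normrE; apply: bigmax_le => [|[i j] _ /=].
  by rewrite mulr_ge0// ltW// sigma_gt0.
rewrite spectral_decomposition_entry (le_trans (ler_norm_sum _ _ _))//.
apply: (@le_trans _ _ (smax * \sum_k (u k i 0 ^+ 2 + u k j 0 ^+ 2) / 2)).
  rewrite mulr_sumr; apply: ler_sum => k _; rewrite normrM.
  apply: ler_pM => //; first by rewrite ger0_norm ?sigma_le_max// ltW// sigma_gt0.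
  rewrite ler_norml; have := sqr_ge0 (u k i 0 - u k j 0).
  have := sqr_ge0 (u k i 0 + u k j 0); move: (u k i 0) (u k j 0) => a b.
  by move=> h1 h2; apply/andP; split; lra.
rewrite ler_wpM2l ?(ltW (sigma_gt0 _))// -mulr_suml big_split/=.
by rewrite ler_pdivrMr//; have := mi i; have := mi j; lra.
Qed.

Lemma mxtrace_spectral : \tr M = \sum_k sigma k.
Proof.
rewrite {1}spectral_factor_gram -frob2_trace /frob2 exchange_big.
apply: eq_bigr => k _.
transitivity (sigma k * \sum_i u k i 0 ^+ 2).
  rewrite mulr_sumr; apply: eq_bigr => i _.
  by rewrite mxE exprMn sqr_sqrtr// ltW// sigma_gt0.
have [_ _ uu _] := HM; have := uu k k; rewrite eqxx mxE => h.
rewrite -[RHS]mulr1 -[1 in RHS]h; congr (_ * _).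
by apply: eq_bigr => i _; rewrite mxE expr2.
Qed.

(* Both sampling conditions are used only through the ratio of the largest
   entry of [M] to its smallest nonzero eigenvalue. *)
Lemma sampling_conditions (C p : R) : 0 <= C -> (0 < n)%N ->
  let kappa := cond_number hr sigma in
  let mu := coherence u in
  let mut := spikiness M in
  (C * Num.max (mu * r%:R * kappa * ln n%:R / n%:R)
               (mu ^+ 2 * r%:R ^+ 2 * kappa ^+ 2 / n%:R) <= p \/
   C * Num.max (mut ^+ 2 * r%:R * kappa * ln n%:R / n%:R)
               (mut ^+ 4 * r%:R ^+ 2 * kappa ^+ 2 / n%:R) <= p) ->
  let b := linfty_norm M / smin in
  C * (b * ln n%:R) <= p /\ C * (n%:R * b ^+ 2) <= p.
Proof.
move=> C0 n0 kappa mu mut hp b.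
have np : 0 < n%:R :> R by rewrite ltr0n.
have rp : 0 < r%:R :> R by rewrite ltr0n.
have s0 := sigma_gt0 (rev_ord (Ordinal hr)).
have s1 := sigma_gt0 (Ordinal hr).
have nu0 : 0 <= linfty_norm M.
  by rewrite (le_trans (normr_ge0 _) (linfty_norm_ge (Ordinal n0) (Ordinal n0))).
have b0 : 0 <= b by rewrite divr_ge0// ltW.
have ln0 : 0 <= ln (n%:R : R) by rewrite ln_ge0// ler1n.
(* Each sampling condition has this form, with q = mu r kappa / n or q = mut^2 r kappa / n; the
   second q is at least b because the trace is at most r times the largest eigenvalue. *)
suff [q [bq h]] : exists q, b <= q /\
    C * Num.max (q * ln n%:R) (n%:R * q ^+ 2) <= p.
  split; apply: le_trans h; rewrite ler_wpM2l//.
    by rewrite le_max ler_wpM2r.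
  by rewrite le_max; apply/orP; right; rewrite ler_wpM2l ?(ltW np)// lerXn2r ?nnegrE ?(le_trans b0).
case: hp => hp.
  exists (mu * r%:R * kappa / n%:R); split.
    rewrite /mu /coherence /kappa /cond_number.
    set mm := \big[_/_]_(i < n) _.
    have -> : n%:R / r%:R * mm * r%:R * (smax / smin) / n%:R = smax * mm / smin.
      by field; rewrite !gt_eqF.
    by rewrite ler_wpM2r ?invr_ge0 ?(ltW s0)// linfty_le_coherence.
  move: hp; congr (_ * Num.max _ _ <= _); first ring.
  by field; rewrite gt_eqF.
have trp : 0 < \tr M.
  rewrite mxtrace_spectral (bigD1 (Ordinal hr))//= ltr_pwDl//.
  by apply: sumr_ge0 => k _; exact: ltW (sigma_gt0 k).
exists (mut ^+ 2 * r%:R * kappa / n%:R); split.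
  have -> : mut ^+ 2 = n%:R * linfty_norm M / \tr M.
    by rewrite sqr_sqrtr// divr_ge0 ?mulr_ge0 ?(ltW trp) ?(ltW np).
  rewrite /kappa /cond_number.
  have -> : n%:R * linfty_norm M / \tr M * r%:R * (smax / smin) / n%:R =
     b * ((r%:R * smax) / \tr M).
    by rewrite /b; field; rewrite !gt_eqF.
  rewrite ler_peMr// ler_pdivlMr// mul1r mxtrace_spectral.
  rewrite -[r in r%:R]card_ord mulr_natl -sumr_const.
  by apply: ler_sum => k _; exact: sigma_le_max.
move: hp; rewrite -[4%N]/(2 * 2)%N exprM; congr (_ * Num.max _ _ <= _); first ring.
by field; rewrite gt_eqF.
Qed.

End spectral_factor.

(** * The good event and its probability *)

Section good_event.
Context {R : realType} {n r : nat}.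
Implicit Types (W : {set 'I_n * 'I_n}) (V : 'M[R]_(n, r)).

(** Omega - p J has the deterministic diagonal -p; without it the matrix is centered. The diagonal
    is restored in [spectral_norm_sub_scalar] and [column_gram_quadratic]. *)
Definition offdiag_part (p : R) W : 'M[R]_n :=
  \matrix_(i, j) if i == j then 0 else ((i, j) \in W)%:R - p.

Lemma offdiag_part_graph (p : R) f :
  offdiag_part p (graph_of f) = wigner_mx (centered_bern p) f.
Proof.
apply/matrixP => i j; rewrite !mxE inE/= /centered_bern.
by case: eqVneq.
Qed.

Lemma indicator_offdiag (p : R) W : (forall i, (i, i) \notin W) ->
  indicator_mx R W - p *: const_mx 1 = offdiag_part p W - p%:M.
Proof.
move=> W0; apply/matrixP => i j; rewrite !mxE mulr1.
by case: eqVneq => [->|_]; rewrite ?(negbTE (W0 j)) ?subr0.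
Qed.

Definition good_sample (p t e : R) V W : bool :=
  (spectral_norm (offdiag_part p W) ^+ 2 <= t) &&
  [forall j, spectral_norm (column_gram V (offdiag_part p W) j) <= 2 * (e * p)].

Lemma good_sample_probability (p e B : R) (k : nat) V :
  0 <= p <= 1 -> (0 < n)%N -> (0 < k)%N -> n%:R * p <= k%:R ->
  ln (n%:R : R) <= k%:R -> 0 < e -> e <= 1 -> 0 < B ->
  (forall i, frob2 (row i V) <= B) -> (forall y : 'cV[R]_r, frob2 (V *m y) <= frob2 y) ->
  128 * r%:R + 4 * ln (n%:R : R) <= e ^+ 2 * p / (16 * B) ->
  1 - 2 * n%:R ^- 3 <= bern_exp p (fun f =>
    (good_sample p (spectral_constant * k%:R) e V (graph_of f))%:R).
Proof.
move=> p01 n0 k0 npk lnk e0 e1 B0 VB V1 hexp.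
have np : 0 < n%:R :> R by rewrite ltr0n.
have h1 := spectral_tail p01 n0 k0 npk lnk.
have h2 : bern_exp p (fun f => (~~ [forall j, spectral_norm
      (column_gram V (wigner_mx (centered_bern p) f) j) <= 2 * (e * p)])%:R) <= n%:R ^- 3.
  apply: (le_trans (gram_tail p01 e0 e1 B0 VB V1)).
  (* A crude use of 64 <= exp 64; the summand 4 ln n then turns the union over n columns into
     n^-3. *)
  have e64 : (64 : R) ^+ (r + r) <= expR (128 * r%:R).
    have -> : expR (128 * r%:R) = expR 64 ^+ (r + r) :> R.
      by rewrite -expRM_natl natrD; congr expR; ring.
    rewrite lerXn2r ?nnegrE ?expR_ge0//.
    by rewrite (le_trans _ (expR_ge1Dx _))// lerDr.
  apply: (@le_trans _ _ (n%:R * (expR (128 * r%:R) * expR (- (128 * r%:R + 4 * ln n%:R))))).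
    rewrite ler_wpM2l ?(ltW np)// ler_pM ?exprn_ge0 ?expR_ge0//.
    by rewrite ler_expR lerN2.
  rewrite -expRD opprD addrA subrr add0r expRN.
  have -> : expR (4 * ln (n%:R : R)) = n%:R ^+ 4.
    by rewrite (expRM_natl 4) lnK ?posrE.
  rewrite le_eqVlt; apply/orP; left; apply/eqP; field.
  by rewrite gt_eqF.
have := bern_exp_cst (I := ('I_n * 'I_n)%type) p (1 : R).
rewrite (@eq_bern_exp _ _ _ (fun=> 1) (fun f =>
  (good_sample p (spectral_constant * k%:R) e V (graph_of f))%:R +
  (~~ good_sample p (spectral_constant * k%:R) e V (graph_of f))%:R)); last first.
  by move=> f; case: good_sample; rewrite /= ?addr0 ?add0r.
rewrite bern_expD => tot.
have h3 : bern_exp p (fun f =>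
    (~~ good_sample p (spectral_constant * k%:R) e V (graph_of f))%:R) <=
   n%:R ^- 3 + n%:R ^- 3.
  apply: le_trans (lerD h1 h2); rewrite -bern_expD; apply: ler_bern_exp => // f.
  have nb (a b : bool) : (~~ (a && b))%:R <= (~~ a)%:R + (~~ b)%:R :> R.
    by case: a b => [] [] /=; lra.
  by rewrite /good_sample offdiag_part_graph; exact: nb.
lra.
Qed.

Lemma spectral_norm_sub_scalar (A : 'M[R]_n) (p t : R) :
  spectral_norm A ^+ 2 <= t ->
  spectral_norm (A - p%:M) ^+ 2 <= 2 * t + 2 * p ^+ 2.
Proof.
move=> At; have t0 : 0 <= t := le_trans (sqr_ge0 _) At.
have s0 : 0 <= 2 * t + 2 * p ^+ 2 by rewrite addr_ge0// mulr_ge0// sqr_ge0.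
rewrite -(sqr_sqrtr s0) ler_pXn2r ?nnegrE ?sqrtr_ge0 ?spectral_norm_ge0//.
apply: spectral_norm_le => x x1; rewrite frobenius_normE ler_sqrt//.
rewrite mulmxBl mul_scalar_mx.
have h : frob2 (A *m x - p *: x) <= 2 * frob2 (A *m x) + 2 * frob2 (p *: x).
  rewrite !frob2_cV !mulr_sumr -big_split; apply: ler_sum => i _ /=.
  rewrite (_ : (A *m x - p *: x) i 0 = (A *m x) i 0 - (p *: x) i 0); last by rewrite !mxE.
  by move: ((A *m x) i 0) ((p *: x) i 0) => a b; have := sqr_ge0 (a + b); nra.
apply: (le_trans h); rewrite frob2Z.
have h1 : frob2 (A *m x) <= t.
  by rewrite (le_trans (spectral_normP _ _))// (le_trans _ At)// ler_piMr// sqr_ge0.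
have h2 : p ^+ 2 * frob2 x <= p ^+ 2 by rewrite ler_piMr// sqr_ge0.
lra.
Qed.

Lemma column_gram_quadratic (p e B : R) V W (y : 'cV[R]_r) (j : 'I_n) :
  (forall i, (i, i) \notin W) -> 0 <= p ->
  (forall i, frob2 (row i V) <= B) ->
  spectral_norm (column_gram V (offdiag_part p W) j) <= 2 * (e * p) ->
  `|\sum_i (indicator_mx R W - p *: const_mx 1) i j * (V *m y) i 0 ^+ 2| <=
    (2 * e + B) * p * frob2 y.
Proof.
move=> W0 p0 VB hj; rewrite indicator_offdiag//.
have -> : \sum_i (offdiag_part p W - p%:M) i j * (V *m y) i 0 ^+ 2 =
   (y^T *m column_gram V (offdiag_part p W) j *m y) 0 0 - p * (V *m y) j 0 ^+ 2.
  rewrite column_gramE.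
  have -> : p * (V *m y) j 0 ^+ 2 = \sum_i (p%:M : 'M[R]_n) i j * (V *m y) i 0 ^+ 2.
    have pM i : (p%:M : 'M[R]_n) i j = p *+ (i == j) by rewrite mxE.
    rewrite (bigD1 j)//= pM eqxx big1 ?addr0// => i ij.
    by rewrite pM (negbTE ij) mul0r.
  rewrite -sumrB; apply: eq_bigr => i _.
  rewrite (_ : (offdiag_part p W - p%:M) i j = offdiag_part p W i j - (p%:M : 'M[R]_n) i j).
    by rewrite mulrBl mulrA.
  by rewrite !mxE.
have h1 : `|(y^T *m column_gram V (offdiag_part p W) j *m y) 0 0| <= 2 * (e * p) * frob2 y.
  rewrite mulmx_bilinear; under eq_bigr do under eq_bigr do rewrite mulrC.
  apply: (le_trans (spectral_norm_bilinear _ _ _)).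
  rewrite -frob2_cV -mulr2n -(mulr_natl (frob2 y)) mulrA divfK//.
  by rewrite ler_wpM2r// frob2_ge0.
have h2 : `|p * (V *m y) j 0 ^+ 2| <= p * (B * frob2 y).
  rewrite normrM (ger0_norm p0) ger0_norm ?sqr_ge0//; apply: ler_wpM2l => //.
  by rewrite (le_trans (row_mulmx_sqr_le _ _ _))// ler_wpM2r ?frob2_ge0.
apply: (le_trans (ler_normB _ _)); apply: (le_trans (lerD h1 h2)).
by rewrite le_eqVlt; apply/orP; left; apply/eqP; ring.
Qed.

End good_event.

(** With k <= 2np and p^2 <= np, the spectral bound gives rho^2 <= (4 [spectral_constant] + 2) np;
    the factor 10^22 is the square of the 10^11 required of rho b. *)
Definition sampling_constant (R : realType) : R :=
  10 ^+ 22 * (4 * @spectral_constant R + 2).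

Lemma sampling_constant_ge (R : realType) : 2 * 10 ^+ 22 <= sampling_constant R.
Proof.
rewrite /sampling_constant mulrC ler_wpM2l ?exprn_ge0// lerDr.
by rewrite /spectral_constant !mulr_ge0// ?exprn_ge0// expR_ge0.
Qed.

Lemma sampling_numerics (R : realType) (n r : nat) (b p : R) :
  (0 < n)%N -> (0 < r)%N -> 0 < p -> p <= 1 -> 0 < b -> r%:R <= n%:R * b ->
  sampling_constant R * (b * ln n%:R) <= p ->
  sampling_constant R * (n%:R * b ^+ 2) <= p ->
  exists k : nat, [/\ (0 < k)%N /\ n%:R * p <= k%:R, ln (n%:R : R) <= k%:R,
    128 * r%:R + 4 * ln (n%:R : R) <= (10 ^- 2) ^+ 2 * p / (16 * b),
    2 * 10 ^- 2 + b <= 20^-1 &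
    forall rho, 0 <= rho ->
      rho ^+ 2 <= 2 * (@spectral_constant R * k%:R) + 2 * p ^+ 2 ->
      rho * b <= 10 ^- 11 * p].
Proof.
move=> n0 r0 p0 p1 b0 rb hp1 hp2.
have Cge := sampling_constant_ge R.
have CE : sampling_constant R = 10 ^+ 22 * (4 * @spectral_constant R + 2) by [].
set C := sampling_constant R in hp1 hp2 Cge CE; set D : R := spectral_constant in CE *.
clearbody C.
have D0 : 0 <= D by rewrite /D /spectral_constant !mulr_ge0// ?exprn_ge0// expR_ge0.
clearbody D.
have np : 0 < n%:R :> R by rewrite ltr0n.
have r1 : 1 <= r%:R :> R by rewrite ler1n.
have big1 : 1 <= 2 * 10 ^+ 22 :> R by rewrite mulr_ege1 ?exprn_ege1 ?ler1n.
have C1 : 1 <= C by exact: le_trans Cge.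
have C0 : 0 < C by exact: lt_le_trans C1.
have ln0 : 0 <= ln (n%:R : R) by rewrite ln_ge0// ler1n.
have nb1 : 1 <= n%:R * b by exact: le_trans rb.
have Cbr : C * (b * r%:R) <= p.
  apply: le_trans hp2; rewrite ler_wpM2l ?(ltW C0)// expr2 mulrCA mulrA.
  by rewrite -mulrA ler_wpM2l ?(ltW b0)//.
have Cb : C * b <= p.
  by apply: le_trans Cbr; rewrite ler_wpM2l ?(ltW C0)// ler_peMr// ltW.
(* Since n b >= r >= 1, the quadratic condition gives np >= C (n b)^2 >= 1, so that rounding np up
   to the integer k at most doubles it. *)
have np1 : 1 <= n%:R * p.
  have h : n%:R * (C * (n%:R * b ^+ 2)) <= n%:R * p by rewrite ler_wpM2l// ltW.
  apply: le_trans h.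
  have -> : n%:R * (C * (n%:R * b ^+ 2)) = C * (n%:R * b) ^+ 2 by ring.
  by rewrite mulr_ege1// exprn_ege1.
have lnp : ln (n%:R : R) <= n%:R * p.
  have h : n%:R * (C * (b * ln n%:R)) <= n%:R * p by rewrite ler_wpM2l// ltW.
  apply: le_trans h.
  have -> : n%:R * (C * (b * ln n%:R)) = C * (n%:R * b) * ln n%:R by ring.
  by rewrite ler_peMl// mulr_ege1.
have h0 : 0 <= n%:R * p by rewrite mulr_ge0// ltW.
have k1 : n%:R * p <= (Num.truncn (n%:R * p)).+1%:R by rewrite ltW// truncnS_gt.
have k2 : (Num.truncn (n%:R * p)).+1%:R <= 2 * (n%:R * p).
  have : (Num.truncn (n%:R * p))%:R <= n%:R * p by rewrite truncn_le.
  by rewrite -natr1; lra.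
exists (Num.truncn (n%:R * p)).+1; split => //.
- exact: le_trans k1.
- rewrite ler_pdivlMr ?mulr_gt0//.
  have g1 : 2 * 10 ^+ 22 * (b * r%:R) <= p.
    by apply: le_trans Cbr; rewrite ler_wpM2r// mulr_ge0// ltW.
  have g2 : 2 * 10 ^+ 22 * (b * ln n%:R) <= p.
    by apply: le_trans hp1; rewrite ler_wpM2r// mulr_ge0// ltW.
  have -> : (128 * r%:R + 4 * ln n%:R) * (16 * b) =
    128 * 16 * (b * r%:R) + 64 * (b * ln n%:R) by ring.
  have : 0 <= b * r%:R by rewrite mulr_ge0// ltW.
  have : 0 <= b * ln n%:R by rewrite mulr_ge0// ltW.
  move: g1 g2; clear; set x := b * r%:R; set y := b * ln n%:R; lra.
- have : 2 * 10 ^+ 22 * b <= p.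
    by apply: le_trans Cb; rewrite ler_wpM2r// ltW.
  move: p1; clear; lra.
move=> rho rho0 hrho.
have q0 : 0 <= 10 ^- 11 * p by rewrite mulr_ge0 ?invr_ge0 ?exprn_ge0// ltW.
rewrite -(ler_pXn2r (n := 2))// ?nnegrE ?mulr_ge0// ?(ltW b0)//.
have pnp : p ^+ 2 <= n%:R * p.
  by rewrite expr2 ler_wpM2r ?(ltW p0)// (le_trans p1)// ler1n.
have hr2 : rho ^+ 2 <= (4 * D + 2) * (n%:R * p).
  apply: (le_trans hrho).
  have : D * (Num.truncn (n%:R * p)).+1%:R <= D * (2 * (n%:R * p)) by rewrite ler_wpM2l.
  by move: pnp; clear; lra.
rewrite exprMn; apply: (le_trans (ler_wpM2r (sqr_ge0 b) hr2)).
have e22 : 10 ^+ 22 * ((4 * D + 2) * (n%:R * b ^+ 2)) <= p by rewrite mulrA -CE.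
have -> : (4 * D + 2) * (n%:R * p) * b ^+ 2 = p * ((4 * D + 2) * (n%:R * b ^+ 2)) by ring.
have -> : (10 ^- 11 * p) ^+ 2 = p * (10 ^- 22 * p).
  by rewrite exprMn exprVn -exprM expr2 mulrCA.
rewrite ler_wpM2l ?(ltW p0)// ler_pdivlMl ?exprn_gt0//.
Qed.

Theorem corollary2p2 (R : realType) :
  exists C1 C : R, [/\ 0 < C1, 0 < C &
  forall (n r : nat) (hr : (0 < r)%N) (hrn : (r <= n)%N)
    (M : 'M[R]_n) (sigma : 'I_r -> R) (u : 'I_r -> 'cV[R]_n) (p : R),
  pos_semidef M ->
  \rank M = r ->
  spectral_decomposition M sigma u ->
  0 < p -> p <= 1 ->
  C1 * (ln n%:R / n%:R) <= p ->
  let kappa := cond_number hr sigma in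
  let mu := coherence u in
  let mut := spikiness M in
  (C * Num.max (mu * r%:R * kappa * ln n%:R / n%:R)
               (mu ^+ 2 * r%:R ^+ 2 * kappa ^+ 2 / n%:R) <= p \/
   C * Num.max (mut ^+ 2 * r%:R * kappa * ln n%:R / n%:R)
               (mut ^+ 4 * r%:R ^+ 2 * kappa ^+ 2 / n%:R) <= p) ->
  forall (d : measure_display) (T : measurableType d) (P : probability T R)
    (Omega : T -> {set 'I_n * 'I_n}),
  offdiag_sym_ber P p Omega ->
  exists E : set T,
    [/\ measurable E,
        ((1 - 2 * n%:R ^- 3)%:E <= P E)%E &
        forall w, E w -> forall alpha lambda : R,
          100 * Num.sqrt (linfty_norm M) <= alpha ->
          alpha <= 200 * Num.sqrt (linfty_norm M) ->
          100 * spectral_norm (indicator_mx R (Omega w) - p *: const_mx 1)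
            <= lambda ->
          lambda <= 200 * spectral_norm (indicator_mx R (Omega w) - p *: const_mx 1) ->
          forall X : 'M[R]_(n, r),
            local_minimum (objective M (Omega w) alpha lambda) X ->
            X *m X^T = M]].
Proof.
have C0 : 0 < sampling_constant R.
  by apply: lt_le_trans (sampling_constant_ge R); rewrite mulr_gt0// exprn_gt0.
exists 1, (sampling_constant R); split => //.
move=> n r hr hrn M sigma u p _ _ HM p0 p1 _ kappa mu mut hp d T P Omega HO.
have n0 : (0 < n)%N by exact: leq_trans hrn.
have np : 0 < n%:R :> R by rewrite ltr0n.
have s0 := sigma_gt0 HM (rev_ord (Ordinal hr)).
have [hp1 hp2] := sampling_conditions HM (ltW C0) n0 hp.
have rb := rank_le_leverage hr HM.
have VB := frob2_row_eigenvector_mx_le hr HM.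
have sU := frob2_spectral_factor_ge hr HM.
set smin := sigma (rev_ord (Ordinal hr)) in s0 hp1 hp2 rb VB sU.
set b := linfty_norm M / smin in hp1 hp2 rb VB.
have b0 : 0 < b.
  rewrite -(pmulr_rgt0 _ np); apply: lt_le_trans rb; by rewrite ltr0n.
have nu0 : 0 < linfty_norm M by move: b0; rewrite pmulr_lgt0 ?invr_gt0.
have [k [[k0 npk] lnk hexp eb hrho]] := sampling_numerics n0 hr p0 p1 b0 rb hp1 hp2.
have p01 : 0 <= p <= 1 by rewrite ltW.
(* Deviation level for the columns: with e = 10^-2, (2 e + b) p stays below the p / 20 that the
   landscape argument tolerates. *)
have e0 : 0 < 10 ^- 2 :> R by rewrite invr_gt0 exprn_gt0.
have e1 : 10 ^- 2 <= 1 :> R by rewrite invf_le1 ?exprn_gt0// exprn_ege1// ler1n.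
pose V := eigenvector_mx u; pose U := spectral_factor sigma u.
have V1 (y : 'cV[R]_r) : frob2 (V *m y) <= frob2 y by rewrite (frob2_eigenvector_mx HM).
pose good := good_sample p (spectral_constant * k%:R) (10 ^- 2) V.
have [mE PE] := offdiag_probability HO good.
have [noloop _ _ Os] := HO.
exists [set w | good (Omega w)]; split => //.
  rewrite PE lee_fin; exact: good_sample_probability VB V1 hexp.
move=> w /andP[gspec /forallP ggram] alpha lambda al1 al2 l1 l2 X.
have MU := spectral_factor_gram HM; rewrite -/U in MU.
rewrite [X in objective X]MU [X in _ -> _ = X]MU => lm.
have W0 i : (i, i) \notin Omega w by exact: noloop.
(* With m^2 the largest entry and sigma the least eigenvalue, m^2 / sigma is b, so the requirement
   on rho reads rho b <= 10^-11 p. *)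
apply: (local_minimum_exact (p := p) (sigma := smin) (m := Num.sqrt (linfty_norm M))
  _ p0 _ _ sU _ _ al1 al2 l1 l2 lm).
- move=> i j; case: (ltngtP i j) => [ij|ij|/ord_inj->//]; first by rewrite [RHS]Os.
  by rewrite Os.
- by rewrite sqrtr_gt0.
- by move=> i; rewrite sqr_sqrtr ?(ltW nu0)// (frob2_row_spectral_factor HM).
- rewrite sqr_sqrtr ?(ltW nu0)//.
  have -> : linfty_norm M = b * smin by rewrite divfK// gt_eqF.
  rewrite mulrA ler_wpM2r ?(ltW s0)// hrho ?spectral_norm_ge0//.
  rewrite indicator_offdiag//; exact: spectral_norm_sub_scalar.
move=> j y; rewrite spectral_factor_mulmx (frob2_eigenvector_mx HM).
apply: (le_trans (column_gram_quadratic _ W0 (ltW p0) VB (ggram j))).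
by rewrite -!mulrA ler_wpM2r// mulr_ge0 ?frob2_ge0// ltW.
Qed.
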